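(* There is an absolute constant $C$ such that every tangled-thrackle on $n$ vertices has at most $C n$ edges. That is, every tangled-thrackle on $n$ vertices has $O(n)$ edges.
   Context: All graphs are finite, undirected, without loops or multiple edges. A drawing of a graph $G$ in the plane, in which vertices are represented by distinct points and edges by Jordan arcs between the corresponding points, is a tangled-thrackle if: (a) no edge intersects any vertex other than its endpoints; (b) any two edges have only a finite number of interior points in common; (c) no three edges have a common interior point; and every pair of distinct edges have precisely one point in common, where this point is either a common endpoint, or a proper crossing, or a point of tangency (a point interior to both arcs at which they touch without properly crossing). *)

(* Defs.v *)
From HB Require Import structures.
From mathcomp Require Import all_boot all_order all_algebra.
From mathcomp Require Import all_classical all_reals all_analysis.
Import Order.TTheory GRing.Theory Num.Theory.
Import numFieldNormedType.Exports.

Set Implicit Arguments.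
Unset Strict Implicit.
Unset Printing Implicit Defensive.

Local Open Scope classical_set_scope.
Local Open Scope ring_scope.

Record sgraph := SGraph {
  vertex :> finType;
  adj : rel vertex;
  adj_sym : symmetric adj;
  adj_irrefl : irreflexive adj }.

(* Edges are unordered: each edge is the two-element set of its endpoints. *)
Definition edges (G : sgraph) : {set {set G}} :=
  [set e | [exists u : G, exists v : G, adj u v && (e == [set u; v]%SET)]]%SET.

Section Arcs.
Variable R : realType.
Implicit Types (a b : R -> R * R) (p : R * R).

(* A parametrized arc is a total function on R of which only the restriction  *)
(* to [0, 1] is meaningful.                                                   *)
Definition arc_pts a : set (R * R) := a @` `[0, 1].

Definition arc_int a : set (R * R) := a @` `]0, 1[.

Definition jordan_arc a :=
  {within `[0, 1], continuous a} /\ {in `[0, 1] &, injective a}.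

(* A common interior point p is a proper crossing when some open neighborhood *)
(* of p is the image of the plane under a homeomorphism g (with inverse h)    *)
(* that maps the origin to p, the horizontal axis to the part of a inside the *)
(* neighborhood, and the vertical axis to the part of b inside it. Thus each  *)
(* arc passes at p from one side of the other arc to its opposite side.       *)
Definition proper_crossing a b p :=
  [/\ arc_int a p, arc_int b p &
      exists g h : R * R -> R * R,
        [/\ continuous g, cancel g h, open (range g) &
            {within range g, continuous h}] /\
        [/\ g (0, 0) = p,
            g @` [set z | z.2 = 0] = arc_pts a `&` range g &
            g @` [set z | z.1 = 0] = arc_pts b `&` range g]].

Definition tangency a b p :=
  [/\ arc_int a p, arc_int b p & ~ proper_crossing a b p].

End Arcs.

(* The values of arc outside edges G are irrelevant. *)
Definition is_drawing (R : realType) (G : sgraph)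
    (pos : G -> R * R) (arc : {set G} -> R -> R * R) :=
  injective pos /\
  forall e, e \in edges G ->
    jordan_arc (arc e) /\
    exists u v : G, [/\ e = [set u; v]%SET, arc e 0 = pos u & arc e 1 = pos v].

Definition tangled_thrackle (R : realType) (G : sgraph)
    (pos : G -> R * R) (arc : {set G} -> R -> R * R) :=
  is_drawing pos arc /\
  [/\ forall e v, e \in edges G -> v \notin e -> ~ arc_pts (arc e) (pos v),
      forall e f, e \in edges G -> f \in edges G -> e != f ->
        finite_set (arc_int (arc e) `&` arc_int (arc f)),
      forall e f g, e \in edges G -> f \in edges G -> g \in edges G ->
        e != f -> e != g -> f != g ->
        arc_int (arc e) `&` arc_int (arc f) `&` arc_int (arc g) = set0 &
      forall e f, e \in edges G -> f \in edges G -> e != f ->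
        exists p : R * R,
          arc_pts (arc e) `&` arc_pts (arc f) = [set p] /\
          [\/ exists v : G, [/\ v \in e, v \in f & p = pos v],
              proper_crossing (arc e) (arc f) p |
              tangency (arc e) (arc f) p]].

(* Main.v *)
(* A cut meets half of the edges, so the graph may be taken bipartite. Replace *)
(* every edge by a polygon: a radius of a small disk at each end, and a fine   *)
(* sample of the arc in between, so that two polygons with no common vertex    *)
(* come close only near the unique common point of the arcs. Count crossings   *)
(* modulo 2. For edges with a common vertex this parity depends on the order   *)
(* of their radii; independent edges of parity 0 are called tangent.           *)
(* Pasting pieces of edges together at the common points shows that a large    *)
(* biclique of tangent pairs would draw K_{3,3} with even parities, so the     *)
(* tangency relation has few pairs. Split the vertices into vertices of        *)
(* bounded degree. If there were many edges, some subgraph would be an         *)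
(* expander, on which random walks mix quickly, and nine random walks would    *)
(* connect 3 + 3 branch vertices without tangent pairs. On this subdivision of *)
(* K_{3,3} all parities are given by a bilinear form in the ends of the edges, *)
(* which is impossible because the parities of the crossings between disjoint  *)
(* edges of K_{3,3} add up to 1.                                               *)

From Stdlib Require Import Btauto.
Require Import Defs.
From mathcomp Require Import all_boot all_order all_algebra.
From mathcomp Require Import ring lra zify.
Import Order.TTheory GRing.Theory Num.Theory.

Set Implicit Arguments.
Unset Strict Implicit.
Unset Printing Implicit Defensive.

(** * Parity of crossings *)

(** Everything rests on one parity fact: in a drawing of K_{3,3} the crossing parities of the pairs
    of disjoint edges add up to 1. [K33_parity] states it for polygonal chains mod 2, in the form
    that these parities cannot be a sum of four terms, one for each pair of ends of the two paths
    (with a symmetric term between the two ends in the second class). In particular they cannot all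
    vanish. This fact is used twice.

    It is first used with all parities 0. Take three edges and three other edges such that each of
    the nine pairs across is independent and crosses evenly, and such that every mutual meeting
    inside one triple lies on one side of the meetings with the other triple. Walking along one
    edge, changing over at the meeting and walking along the other draws K_{3,3} with even parities
    ([three_by_three]). Two pigeonholes give this position inside any large biclique, so tangent
    pairs contain no large biclique ([tangent_biclique_free]). The Kovari-Sos-Turan bound
    [biclique_free_count] then saves a power in the number of tangent pairs.

    The second use is on the graph itself. Independent pairs that are not tangent cross oddly, and
    edges with a common end cross according to the order of their radii there. Cut this order into
    blocks of about the average degree D and let the blocks be new vertices. Unless two edges are
    tangent or share a block, their parity is a bilinear form in the blocks at their ends
    ([parity_form]). So any K_{3,3} whose edges are walks, and whose disjoint pairs of walks avoid
    those exceptions, contradicts [K33_parity].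

    Too many edges would yield such walks ([dense_select]). A smallest vertex set above a slightly
    nonlinear density threshold induces an expander ([critical_expand]), random walks on it mix
    within a length l that is a small power of its size, and l^2 times the proportion of exceptional
    pairs is small. Hence nine random walks between random branch vertices avoid them all with
    positive probability ([select_walks]). This is [system_bound] for polygonal systems. [half_cut],
    [thrackle_curves], [curves_middles] and [middles_system] turn a tangled-thrackle into such a
    system, losing a factor 2. *)

Section Parity.
Local Open Scope ring_scope.
Variable R : realFieldType.
Notation pt := (R * R)%type.
Notation seg := (pt * pt)%type.
Implicit Types (p q r z : pt) (s u : seg).

Definition lexlt p q := (p.1 < q.1) || ((p.1 == q.1) && (p.2 < q.2)).

Definition orient p q r := (q.1 - p.1) * (r.2 - p.2) - (q.2 - p.2) * (r.1 - p.1).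

Definition above r s :=
  if lexlt s.1 s.2 then 0 < orient s.1 s.2 r else orient s.1 s.2 r < 0.
Definition below r s :=
  if lexlt s.1 s.2 then orient s.1 s.2 r < 0 else 0 < orient s.1 s.2 r.

(** The vertical strip over [s], with ties of abscissa broken lexicographically. Being a sum of two
    endpoint terms, it telescopes mod 2 along a chain. *)
Definition lexin r s := lexlt s.1 r (+) lexlt s.2 r.
Definition ucr r s := lexin r s && above r s.
Definition dcr r s := lexin r s && below r s.

(** Ends of [u] above [s] plus ends of [s] below [u], mod 2. Each end of the common part of the two
    shadows is an end of [s] or of [u], and it is counted exactly when [u] is above [s] there. The
    sum is thus odd when the two change places. Unlike a geometric crossing, it is defined in all
    degenerate positions and is a sum of endpoint terms. *)
Definition scross s u :=
  ucr u.1 s (+) ucr u.2 s (+) (dcr s.1 u (+) dcr s.2 u).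

Definition on_seg s z := exists2 x : R, 0 <= x <= 1 &
  z = (s.1.1 + x * (s.2.1 - s.1.1), s.1.2 + x * (s.2.2 - s.1.2)).

Definition sdisj s u := forall z, on_seg s z -> ~ on_seg u z.

Lemma sdisjC s u : sdisj s u -> sdisj u s.
Proof. by move=> h z hu hs; exact: (h z). Qed.

Lemma on_seg1 s : on_seg s s.1.
Proof. by exists 0; [lra | rewrite !mul0r !addr0; case: s => [[]]]. Qed.

Lemma on_seg2 s : on_seg s s.2.
Proof. by exists 1; [lra | rewrite !mul1r !subrKC; case: s => [? []]]. Qed.

Lemma lexxx p : lexlt p p = false.
Proof. by rewrite /lexlt !ltxx andbF. Qed.

Lemma lexltN p q : p != q -> lexlt q p = ~~ lexlt p q.
Proof.
case: p q => [a b] [c d]; rewrite xpair_eqE /lexlt /= => h.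
case: (ltgtP a c) h => //= _; by case: (ltgtP b d).
Qed.

(* A small shear turns the lexicographic order into the order of abscissae. *)
Definition shear (e : R) p := p.1 + e * p.2.

Lemma shear_lex1 p q : exists2 e0 : R, 0 < e0 &
  forall e, 0 < e < e0 -> lexlt p q -> shear e p < shear e q.
Proof.
case: p q => [a b] [c d]; rewrite /lexlt /shear /=.
case: (ltP a c) => h /=.
  exists ((c - a) / (`|b - d| + 1)) => [|e /andP[e0 e1] _].
    by rewrite divr_gt0 // ?subr_gt0 // ltr_wpDl.
  have H : e * (`|b - d| + 1) < c - a by rewrite -ltr_pdivlMr // ltr_wpDl.
  have := ler_norm (b - d); nra.
exists 1 => // e /andP[e0 _] /andP[/eqP -> bd]; nra.
Qed.

Lemma shear_lex (l : seq pt) : exists2 e : R, 0 < e &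
  forall p q, p \in l -> q \in l -> lexlt p q = (shear e p < shear e q).
Proof.
have [e0 e0p H] : exists2 e0 : R, 0 < e0 & forall e, 0 < e < e0 ->
    forall pq, pq \in [seq (p, q) | p <- l, q <- l] -> lexlt pq.1 pq.2 ->
    shear e pq.1 < shear e pq.2.
  elim: [seq (p, q) | p <- l, q <- l] => [|[p q] m [e1 e1p IH]]; first by exists 1.
  have [e2 e2p h2] := shear_lex1 p q.
  exists (Num.min e1 e2); first by rewrite lt_min e1p.
  move=> e; rewrite lt_min => /and3P[ep ee1 ee2] pq.
  rewrite inE => /orP[/eqP -> /=|]; first by apply: h2; rewrite ep.
  by apply: IH; rewrite ep.
exists (e0 / 2%:R); first lra.
have e02 : 0 < e0 / 2%:R < e0 by lra.
move=> p q pl ql; apply/idP/idP => [pq|].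
  by apply: (H _ e02 (p, q)) => //; apply/allpairsP; exists (p, q).
apply: contraTT => npq; case: (eqVneq p q) => [->|pq]; first by rewrite ltxx.
rewrite -leNgt ltW //; apply: (H _ e02 (q, p)) => //=.
  by apply/allpairsP; exists (q, p).
by rewrite lexltN.
Qed.

Lemma lexlt_trans p q r : lexlt p q -> lexlt q r -> lexlt p r.
Proof.
have [e _ H] := shear_lex [:: p; q; r].
by rewrite !H ?inE ?eqxx ?orbT //; apply: lt_trans.
Qed.

Lemma orient_rev p q r : orient q p r = - orient p q r.
Proof. rewrite /orient; ring. Qed.

Lemma above_rev r p q : p != q -> above r (q, p) = above r (p, q).
Proof.
by move=> pq; rewrite /above /= lexltN // orient_rev; case: (lexlt p q) => /=;
  rewrite ?oppr_gt0 ?oppr_lt0.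
Qed.

Lemma below_rev r p q : p != q -> below r (q, p) = below r (p, q).
Proof.
by move=> pq; rewrite /below /= lexltN // orient_rev; case: (lexlt p q) => /=;
  rewrite ?oppr_gt0 ?oppr_lt0.
Qed.

Lemma lexin_refl p r : lexin r (p, p) = false.
Proof. by rewrite /lexin addbb. Qed.

Lemma ucr_rev r p q : ucr r (q, p) = ucr r (p, q).
Proof.
have [->//|pq] := eqVneq p q.
by rewrite /ucr above_rev // /lexin /= addbC.
Qed.

Lemma dcr_rev r p q : dcr r (q, p) = dcr r (p, q).
Proof.
have [->//|pq] := eqVneq p q.
by rewrite /dcr below_rev // /lexin /= addbC.
Qed.

Lemma scross_rev1 p q u : scross (q, p) u = scross (p, q) u.
Proof. by rewrite /scross !(ucr_rev _ p q) /= (addbC (dcr q u)). Qed.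

Lemma scross_rev2 s p q : scross s (q, p) = scross s (p, q).
Proof. by rewrite /scross /= !(dcr_rev _ p q) (addbC (ucr q s)). Qed.

Lemma on_seg_rev p q z : on_seg (q, p) z <-> on_seg (p, q) z.
Proof.
by split=> -[x x01 ->]; exists (1 - x);
  [lra | congr pair => /=; ring | lra | congr pair => /=; ring].
Qed.

Lemma sdisj_rev1 p q u : sdisj (p, q) u -> sdisj (q, p) u.
Proof. by move=> h z /on_seg_rev; apply: h. Qed.

Lemma sdisj_rev2 s p q : sdisj s (p, q) -> sdisj s (q, p).
Proof. by move=> h z hs /on_seg_rev; apply: h. Qed.

(** The parameters of the intersection point on the two lines are ratios of orientations, and the
    sign conditions put both ratios in [0, 1]. *)
Lemma seg_meet p q r (s : pt) :
  orient p q r * orient p q s <= 0 -> orient r s p * orient r s q <= 0 ->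
  orient p q r != orient p q s -> ~ sdisj (p, q) (r, s).
Proof.
move=> h1 h2 hne hd.
have E : orient r s p - orient r s q = - (orient p q r - orient p q s)
  by rewrite /orient; ring.
have d0 : orient p q r - orient p q s != 0 by rewrite subr_eq0.
have d1 : orient r s p - orient r s q != 0 by rewrite E oppr_eq0.
have K (a b : R) : a * b <= 0 -> a - b != 0 -> 0 <= a / (a - b) <= 1.
  move=> ab; case: (ltgtP (a - b) 0) => // h _; apply/andP; split.
  - rewrite -mulrNN -invrN; apply: divr_ge0; nra.
  - rewrite ler_ndivrMr // mul1r; nra.
  - apply: divr_ge0; nra.
  - rewrite ler_pdivrMr // mul1r; nra.
pose x := orient r s p / (orient r s p - orient r s q).
pose y := orient p q r / (orient p q r - orient p q s).
apply: (hd (p.1 + x * (q.1 - p.1), p.2 + x * (q.2 - p.2))).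
  by exists x => //; apply: K.
exists y; first exact: K.
move: d0 d1; rewrite /x /y /orient.
by move=> d0 d1; congr pair => /=; field; rewrite ?d0 ?d1.
Qed.

Lemma noz (a b c x y z : R) : 0 < x -> 0 < y -> 0 < z ->
  a * x + b * y + c * z = 0 -> 0 <= a -> 0 <= b -> 0 <= c ->
  [/\ a = 0, b = 0 & c = 0].
Proof.
move=> x0 y0 z0 E a0 b0 c0.
have hx := mulr_ge0 a0 (ltW x0); have hy := mulr_ge0 b0 (ltW y0).
have hz := mulr_ge0 c0 (ltW z0).
have K (u v : R) : 0 < v -> u * v = 0 -> u = 0.
  by move=> v0 /eqP; rewrite mulf_eq0 (gt_eqF v0) orbF => /eqP.
by split; [apply: (K _ x) | apply: (K _ y) | apply: (K _ z)] => //; lra.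
Qed.

Lemma nozN (a b c x y z : R) : 0 < x -> 0 < y -> 0 < z ->
  a * x + b * y + c * z = 0 -> a <= 0 -> b <= 0 -> c <= 0 ->
  [/\ a = 0, b = 0 & c = 0].
Proof.
move=> x0 y0 z0 E a0 b0 c0.
have [] := @noz (- a) (- b) (- c) x y z x0 y0 z0; rewrite ?oppr_ge0 //.
  by rewrite !mulNr; lra.
by split; lra.
Qed.

Lemma noz2 (a b c x y x' y' z z' : R) : x' < x -> y' < y -> z' < z ->
  a * (x - x') + b * (y - y') + c * (z - z') = 0 ->
  (0 <= a -> 0 <= b -> 0 <= c -> [/\ a = 0, b = 0 & c = 0]) /\
  (a <= 0 -> b <= 0 -> c <= 0 -> [/\ a = 0, b = 0 & c = 0]).
Proof.
rewrite -!(subr_gt0 _ x) -!(subr_gt0 _ y) -!(subr_gt0 _ z) => hx hy hz E.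
by split=> *; [apply: noz hx hy hz E _ _ _ | apply: nozN hx hy hz E _ _ _].
Qed.

Local Ltac sgn := match goal with
 | h : is_true (0 < ?x), h' : is_true (?x <= 0) |- _ => by rewrite ltNge h' in h
 | h : is_true (?x < 0), h' : is_true (0 <= ?x) |- _ => by rewrite ltNge h' in h
 | h : is_true (0 < ?x), h' : is_true (?x < 0) |- _ =>
     by have := lt_trans h h'; rewrite ltxx
 | h : is_true (0 < ?x), h' : ?x = 0 |- _ => by rewrite h' ltxx in h
 | h : is_true (?x < 0), h' : ?x = 0 |- _ => by rewrite h' ltxx in h
 end.

Lemma mul_gt0 (a b : R) : 0 < a * b -> (0 < a /\ 0 < b) \/ (a < 0 /\ b < 0).
Proof.
case: (ltgtP a 0) => [a0|a0|->]; last by rewrite mul0r ltxx.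
  by rewrite nmulr_rgt0 //; right.
by rewrite pmulr_rgt0 //; left.
Qed.

(** After a small shear only the abscissas P, Q, X, Y and the four orientations A, B, C, D matter.
    Disjointness enters through [seg_meet]: one segment lies strictly on one side of the line of the
    other, or the two are parallel on one line. *)
Lemma scross_disj_lex p q r (s : pt) : lexlt p q -> lexlt r s ->
  sdisj (p, q) (r, s) -> scross (p, q) (r, s) = false.
Proof.
move=> pq rs hd.
have [e e0 H] := shear_lex [:: p; q; r; s].
have ne (x y : pt) : on_seg (p, q) x -> on_seg (r, s) y -> x != y.
  by move=> hx hy; apply/eqP => xy; apply: (hd x) => //; rewrite xy.
have pr := ne _ _ (on_seg1 (p, q)) (on_seg1 (r, s)).
have ps := ne _ _ (on_seg1 (p, q)) (on_seg2 (r, s)).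
have qr := ne _ _ (on_seg2 (p, q)) (on_seg1 (r, s)).
have qs := ne _ _ (on_seg2 (p, q)) (on_seg2 (r, s)).
have M := seg_meet.
move: (lexltN pr) (lexltN ps) (lexltN qr) (lexltN qs).
rewrite /scross /ucr /dcr /lexin /above /below /= pq rs.
move: pq rs; rewrite !H ?inE ?eqxx ?orbT //.
have := M p q r s.
have E1 : orient p q r - orient p q s + orient r s p - orient r s q = 0
  by rewrite /orient; ring.
have E2 : orient r s q * shear e p + orient p q s * shear e r =
          orient r s p * shear e q + orient p q r * shear e s
  by rewrite /orient /shear; ring.
move: E1 E2.
set A := orient p q r; set B := orient p q s.
set C := orient r s p; set D := orient r s q.
set P := shear e p; set Q := shear e q; set X := shear e r; set Y := shear e s.
move=> E1 E2 hM PQ XY.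
have {}hM : A * B <= 0 -> C * D <= 0 -> A = B.
  by move=> h1 h2; apply/eqP/negPn/negP => h; exact: (hM h1 h2 h).
clearbody A B C D P Q X Y; clear -hM PQ XY E1 E2.
(* [F1] to [F4] each relate three of the four orientations, weighted by differences of abscissas.
   For every overlapping order of the two shadows, two of these relations have only positive
   weights, and then three orientations of one sign must all vanish. *)
have F1 : C * (Q - X) + A * (Y - X) + D * (X - P) = 0.
  transitivity ((C * Q + A * Y) - (D * P + B * X) + (B - C - A + D) * X); first ring.
  have -> : B - C - A + D = 0 by (move: E1; lra).
  by rewrite -E2; ring.
have F2 : C * (Q - Y) + B * (Y - X) + D * (Y - P) = 0.
  by rewrite -F1; (have -> : A = B + D - C by lra); ring.
have F3 : C * (Q - P) + A * (Y - P) + B * (P - X) = 0.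
  by rewrite -F1; (have -> : D = A - B + C by lra); ring.
have F4 : A * (Y - Q) + B * (Q - X) + D * (Q - P) = 0.
  by rewrite -F1; (have -> : C = B + D - A by lra); ring.
have {}hM : (0 < A /\ 0 < B) \/ (A < 0 /\ B < 0) \/ (0 < C /\ 0 < D) \/
    (C < 0 /\ D < 0) \/ [/\ A = 0, B = 0 & C = D].
  have [h1|/mul_gt0] := lerP (A * B) 0; last by case; auto.
  have [h2|/mul_gt0] := lerP (C * D) 0; last by case; auto.
  have AB := hM h1 h2; move: h1; rewrite AB -expr2 => h1.
  have : B ^+ 2 == 0 by rewrite eq_le h1 sqr_ge0.
  rewrite sqrf_eq0 => /eqP B0; do 4 right; split; lra.
case: (ltgtP P X) => PX //=; case: (ltgtP P Y) => PY //=;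
case: (ltgtP Q X) => QX //=; case: (ltgtP Q Y) => QY //= _ _ _ _ //;
 rewrite ?andbF ?addbF //=;
 try by [exfalso; clear hM E1 E2 F1 F2 F3 F4; lra].
- have [f1 f1'] := noz2 QX XY PX F1; have [f4 f4'] := noz2 QY QX PQ F4.
  case: (ltP 0 A) => hA; case: (ltP D 0) => hD //=; exfalso.
    have hB : B < 0.
      by rewrite ltNge; apply/negP => h; have [] := f4 (ltW hA) h hD => *; sgn.
    have hC : C < 0.
      by rewrite ltNge; apply/negP => h; have [] := f1 h (ltW hA) hD => *; sgn.
    by case: hM => [[? ?]|[[? ?]|[[? ?]|[[? ?]|[? ? ?]]]]]; sgn.
  have hB : 0 < B.
    by rewrite ltNge; apply/negP => h; have [] := f4' hA h (ltW hD) => *; sgn.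
  have hC : 0 < C.
    by rewrite ltNge; apply/negP => h; have [] := f1' h hA (ltW hD) => *; sgn.
  by case: hM => [[? ?]|[[? ?]|[[? ?]|[[? ?]|[? ? ?]]]]]; sgn.
- have [f1 f1'] := noz2 QX XY PX F1; have [f2 f2'] := noz2 QY XY PY F2.
  case: (ltP 0 A) => hA; case: (ltP 0 B) => hB //=; exfalso;
   case: hM => [[? ?]|[[? ?]|[[h h']|[[h h']|[? ? ?]]]]]; try sgn.
  + by have [] := f1 (ltW h) (ltW hA) (ltW h') => *; sgn.
  + by have [] := f2' (ltW h) hB (ltW h') => *; sgn.
  + by have [] := f2 (ltW h) (ltW hB) (ltW h') => *; sgn.
  + by have [] := f1' (ltW h) hA (ltW h') => *; sgn.
- have [f3 f3'] := noz2 PQ PY PX F3; have [f4 f4'] := noz2 QY QX PQ F4.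
  case: (ltP C 0) => hC; case: (ltP D 0) => hD //=; exfalso;
   case: hM => [[h h']|[[h h']|[[? ?]|[[? ?]|[? ? CD]]]]]; try sgn;
   try by [rewrite CD in hC; sgn].
  + by have [] := f4 (ltW h) (ltW h') hD => *; sgn.
  + by have [] := f3' (ltW hC) (ltW h) (ltW h') => *; sgn.
  + by have [] := f3 hC (ltW h) (ltW h') => *; sgn.
  + by have [] := f4' (ltW h) (ltW h') (ltW hD) => *; sgn.
- have [f2 f2'] := noz2 QY XY PY F2; have [f3 f3'] := noz2 PQ PY PX F3.
  case: (ltP 0 B) => hB; case: (ltP C 0) => hC //=; exfalso.
    have hD : D < 0.
      by rewrite ltNge; apply/negP => h; have [] := f2 hC (ltW hB) h => *; sgn.
    have hA : A < 0.
      by rewrite ltNge; apply/negP => h; have [] := f3 hC h (ltW hB) => *; sgn.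
    by case: hM => [[? ?]|[[? ?]|[[? ?]|[[? ?]|[? ? ?]]]]]; sgn.
  have hD : 0 < D.
    by rewrite ltNge; apply/negP => h; have [] := f2' (ltW hC) hB h => *; sgn.
  have hA : 0 < A.
    by rewrite ltNge; apply/negP => h; have [] := f3' (ltW hC) h hB => *; sgn.
  by case: hM => [[? ?]|[[? ?]|[[? ?]|[[? ?]|[? ? ?]]]]]; sgn.
Qed.
End Parity.

Lemma addbE a b : a (+) b = xorb a b. Proof. by case: a; case: b. Qed.

(** * Chains mod 2 and the parity obstruction of K_{3,3} *)

Section Chains.
Local Open Scope ring_scope.
Variable R : realFieldType.
Notation pt := (R * R)%type.
Notation seg := (pt * pt)%type.
Implicit Types (p q r z : pt) (s u : seg).

Lemma scross_disj s u : sdisj s u -> scross s u = false.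
Proof.
case: s u => [p q] [r s] hd.
have deg1 (x : pt) v : scross (x, x) v = false.
  by rewrite /scross /ucr /dcr !lexin_refl /= addbb.
have deg2 (x : pt) v : scross v (x, x) = false.
  by rewrite /scross /ucr /dcr !lexin_refl /= addbb.
have [->|pq] := eqVneq p q; first exact: deg1.
have [->|rs] := eqVneq r s; first exact: deg2.
have lx (x y : pt) : x != y -> lexlt x y \/ lexlt y x.
  by move=> xy; rewrite (lexltN xy); case: (lexlt x y); [left|right].
case: (lx _ _ pq) => h1; case: (lx _ _ rs) => h2.
- exact: scross_disj_lex.
- by rewrite -scross_rev2; apply: scross_disj_lex => //; apply: sdisj_rev2.
- by rewrite -scross_rev1; apply: scross_disj_lex => //; apply: sdisj_rev1.
- rewrite -scross_rev1 -scross_rev2; apply: scross_disj_lex => //.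
  by apply: sdisj_rev1; apply: sdisj_rev2.
Qed.

(** The two sides differ only if [r] lies in the strip of the segment and on its line, and such a
    point is on the segment. *)
Lemma updown_off r p q : ~ on_seg (p, q) r ->
  ucr r (p, q) (+) dcr r (p, q) = lexlt p r (+) lexlt q r.
Proof.
move=> off; rewrite /ucr /dcr -[RHS]/(lexin r (p, q)).
case hin: (lexin r (p, q)) => //=.
suff h0 : orient p q r != 0.
  rewrite /above /below /=.
  by case: (lexlt p q) => /=; case: (ltgtP (orient p q r) 0) h0.
apply/eqP => o0; apply: off.
have [e e0 H] := shear_lex [:: p; q; r].
move: hin; rewrite /lexin /= !H ?inE ?eqxx ?orbT // => hin.
have d0 : shear e q - shear e p != 0.
  by rewrite subr_eq0; apply/eqP => E; move: hin; rewrite E addbb.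
(* The sheared abscissa, unlike the plain one, also parametrizes a vertical segment. *)
exists ((shear e r - shear e p) / (shear e q - shear e p)).
  move: (shear e p) (shear e q) (shear e r) hin d0 => P Q X {H}.
  case: (ltP P X) => h1; case: (ltP Q X) => h2 //= _ d0.
    have PQ := lt_le_trans h1 h2.
    by rewrite divr_ge0 ?ler_pdivrMr ?subr_gt0 ?subr_ge0 ?mul1r ?lerD2r // ltW.
  have QP := lt_le_trans h2 h1.
  rewrite -mulrNN -invrN !opprB.
  by rewrite divr_ge0 ?ler_pdivrMr ?subr_gt0 ?subr_ge0 ?mul1r ?lerD2l ?lerN2 // ltW.
move: d0 o0; rewrite /shear /orient => d0 o0.
rewrite [LHS]surjective_pairing; congr pair => /=.
- apply: (addIr (- p.1)); rewrite [RHS]addrC addKr.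
  apply: (mulIf d0); rewrite mulrAC divfK //.
  have -> : (r.1 - p.1) * (q.1 + e * q.2 - (p.1 + e * p.2)) =
    (r.1 + e * r.2 - (p.1 + e * p.2)) * (q.1 - p.1) -
    e * ((q.1 - p.1) * (r.2 - p.2) - (q.2 - p.2) * (r.1 - p.1)) by ring.
  by rewrite o0 mulr0 subr0.
- apply: (addIr (- p.2)); rewrite [RHS]addrC addKr.
  apply: (mulIf d0); rewrite mulrAC divfK //.
  have -> : (r.2 - p.2) * (q.1 + e * q.2 - (p.1 + e * p.2)) =
    (r.1 + e * r.2 - (p.1 + e * p.2)) * (q.2 - p.2) +
    ((q.1 - p.1) * (r.2 - p.2) - (q.2 - p.2) * (r.1 - p.1)) by ring.
  by rewrite o0 addr0.
Qed.

Definition chain := seq seg.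
Implicit Types (c d : chain).

Definition xsum (T : Type) (l : seq T) (g : T -> bool) := \big[addb/false]_(x <- l) g x.

(** The boundary of [c] mod 2 is p + q, tested against all functions on points. Order, orientation
    and repetition of segments do not matter, so walks and reversed pieces can be concatenated
    freely. *)
Definition conn c p q :=
  forall g : pt -> bool, xsum c (fun s => g s.1 (+) g s.2) = g p (+) g q.

Definition UU r c := xsum c (ucr r).
Definition DD r c := xsum c (dcr r).
Definition II c d := xsum c (fun s => xsum d (scross s)).

Lemma xsum_add T (l : seq T) g h : xsum l (fun x => g x (+) h x) = xsum l g (+) xsum l h.
Proof. exact: big_split. Qed.

Lemma xsum_cat T (l l' : seq T) g : xsum (l ++ l') g = xsum l g (+) xsum l' g.
Proof. exact: big_cat. Qed.

Lemma xsum_cons T x (l : seq T) g : xsum (x :: l) g = g x (+) xsum l g.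
Proof. exact: big_cons. Qed.

Lemma xsum_nil T g : xsum (@nil T) g = false.
Proof. exact: big_nil. Qed.

Lemma xsum_exch S T (l : seq S) (m : seq T) g :
  xsum l (fun x => xsum m (g x)) = xsum m (fun y => xsum l (g^~ y)).
Proof. exact: exchange_big. Qed.

Lemma eq_xsum T (l : seq T) g h : g =1 h -> xsum l g = xsum l h.
Proof. by move=> gh; apply: eq_bigr. Qed.

Lemma eq_in_xsum (T : eqType) (l : seq T) g h : {in l, g =1 h} -> xsum l g = xsum l h.
Proof. by move=> gh; apply: eq_big_seq. Qed.

Lemma xsum_false (T : eqType) (l : seq T) g : {in l, forall x, g x = false} -> xsum l g = false.
Proof. by move=> gh; apply: big1_seq => x /andP[_ /gh]. Qed.

Lemma conn_sym c p q : conn c p q -> conn c q p.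
Proof. by move=> h g; rewrite h addbC. Qed.

Lemma conn_cat c d p q r : conn c p q -> conn d q r -> conn (c ++ d) p r.
Proof.
move=> h k g; rewrite xsum_cat h k.
by case: (g p); case: (g q); case: (g r).
Qed.

Lemma conn1 p q : conn [:: (p, q)] p q.
Proof. by move=> g; rewrite xsum_cons xsum_nil addbF. Qed.

(* The crossing parity of two chains only depends on their boundaries, seen *)
(* from the other chain. *)
Lemma II_boundary c d p q p' q' : conn c p q -> conn d p' q' ->
  II c d = UU p' c (+) UU q' c (+) (DD p d (+) DD q d).
Proof.
move=> hc hd; rewrite /II /scross.
under eq_xsum => s do rewrite xsum_add (hd (fun x => ucr x s)).
rewrite !xsum_add [X in _ (+) X]xsum_exch.
by congr (_ (+) _); rewrite -xsum_add; apply: eq_xsum => u; rewrite (hc (fun x => dcr x u)).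
Qed.

Lemma II_cat1 c c' d : II (c ++ c') d = II c d (+) II c' d.
Proof. exact: xsum_cat. Qed.

Lemma II_cat2 c d d' : II c (d ++ d') = II c d (+) II c d'.
Proof. by rewrite /II -xsum_add; apply: eq_xsum => s; rewrite xsum_cat. Qed.

Lemma II_disj c d : (forall s u, s \in c -> u \in d -> sdisj s u) -> II c d = false.
Proof.
move=> h; apply: xsum_false => s sc; apply: xsum_false => u ud.
by apply: scross_disj; apply: h.
Qed.

Lemma updown_chain_off c p q r : conn c p q ->
  (forall s, s \in c -> ~ on_seg s r) -> UU r c (+) DD r c = lexlt p r (+) lexlt q r.
Proof.
move=> hc off; rewrite -xsum_add -(hc (fun x => lexlt x r)); apply: eq_in_xsum => s sc.
by case: s sc => x y sc; rewrite updown_off //; apply: off.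
Qed.

(** By [II_boundary] the two sides differ by [UU] + [DD] summed over the four ends. By
    [updown_chain_off] this compares each end of [c] with each end of [d] in both directions, which
    contributes four ones. *)
Lemma II_sym c d p q p' q' : conn c p q -> conn d p' q' ->
  (forall s, s \in c -> ~ on_seg s p') -> (forall s, s \in c -> ~ on_seg s q') ->
  (forall s, s \in d -> ~ on_seg s p) -> (forall s, s \in d -> ~ on_seg s q) ->
  p != p' -> p != q' -> q != p' -> q != q' ->
  II c d = II d c.
Proof.
move=> hc hd o1 o2 o3 o4 n1 n2 n3 n4.
rewrite (II_boundary hc hd) (II_boundary hd hc).
move: (updown_chain_off hc o1) (updown_chain_off hc o2)
      (updown_chain_off hd o3) (updown_chain_off hd o4).
rewrite (lexltN n1) (lexltN n2) (lexltN n3) (lexltN n4).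
case: (lexlt p p'); case: (lexlt p q'); case: (lexlt q p'); case: (lexlt q q');
case: (UU p' c); case: (UU q' c); case: (UU p d); case: (UU q d);
by case: (DD p' c); case: (DD q' c); case: (DD p d); case: (DD q d).
Qed.

(* For fixed i and k, summing the parities over all ordered pairs j <> l kills *)
(* every term that does not involve b at both places. *)
Lemma K33_pair (ua da kab kba : 'I_3 -> bool) (u d kbb : 'I_3 -> 'I_3 -> bool) kaa :
  (forall j l, kbb j l = kbb l j) ->
  (forall j l, j != l -> ua j (+) u j l (+) (da l (+) d l j) =
     kaa (+) kab l (+) (kba j (+) kbb j l)) ->
  xsum (index_enum 'I_3) (fun j => xsum (index_enum 'I_3) (fun l =>
    (j != l) && (u j l (+) d j l))) = false.
Proof.
move=> ks H.
have solve (a b c e r : bool) : a (+) b (+) (c (+) e) = r -> b = a (+) (c (+) e) (+) r.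
  by move=> <-; case: a; case: b; case: c; case: e.
rewrite /xsum !big_ord_recl !big_ord0 /=.
pose o0 : 'I_3 := ord0; pose o1 : 'I_3 := lift ord0 ord0.
pose o2 : 'I_3 := lift ord0 (lift ord0 ord0).
rewrite -/o0 -/o1 -/o2.
move: (solve _ _ _ _ _ (H o0 o1 isT)) (solve _ _ _ _ _ (H o0 o2 isT))
  (solve _ _ _ _ _ (H o1 o0 isT)) (solve _ _ _ _ _ (H o1 o2 isT))
  (solve _ _ _ _ _ (H o2 o0 isT)) (solve _ _ _ _ _ (H o2 o1 isT)).
rewrite (ks o1 o0) (ks o2 o0) (ks o2 o1) => -> -> -> -> -> ->.
rewrite !addbE; btauto.
Qed.

(** Let U_i and D_i be the sums over j <> l of [UU (b l) (c i j)] and [DD (b l) (c i j)]. By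
    [K33_pair], U_i + D_k = 0 whenever i < k, so U_0 = D_1, U_0 = D_2 and U_1 = D_2, whence U_1 =
    D_1. But U_1 + D_1 = 1: every [h 1 l] occurs twice, and each of the three pairs of points [b] is
    compared in both directions. *)
Theorem K33_parity (a b : 'I_3 -> pt) (c : 'I_3 -> 'I_3 -> chain)
    (Kaa Kab Kba Kbb h : 'I_3 -> 'I_3 -> bool) :
  (forall i j, conn (c i j) (a i) (b j)) ->
  (forall j l, j != l -> b j != b l) ->
  (forall i j l, j != l ->
     UU (b l) (c i j) (+) DD (b l) (c i j) = h i l (+) lexlt (b j) (b l)) ->
  (forall j l, Kbb j l = Kbb l j) ->
  (forall i k j l : 'I_3, (i < k)%N -> j != l ->
     II (c i j) (c k l) = Kaa i k (+) Kab i l (+) (Kba j k (+) Kbb j l)) ->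
  False.
Proof.
move=> hc hb hw ks H.
have P (i k : 'I_3) (ik : (i < k)%N) := @K33_pair
  (fun j => UU (a k) (c i j)) (fun l => DD (a i) (c k l)) (Kab i) (Kba^~ k)
  (fun j l => UU (b l) (c i j)) (fun j l => DD (b l) (c k j)) Kbb (Kaa i k) ks.
pose o0 : 'I_3 := ord0; pose o1 : 'I_3 := lift ord0 ord0.
pose o2 : 'I_3 := lift ord0 (lift ord0 ord0).
have eqs (i k : 'I_3) (ik : (i < k)%N) j l : j != l ->
  UU (a k) (c i j) (+) UU (b l) (c i j) (+) (DD (a i) (c k l) (+) DD (b j) (c k l)) =
  Kaa i k (+) Kab i l (+) (Kba j k (+) Kbb j l).
  by move=> jl; rewrite -H // (II_boundary (hc i j) (hc k l)).
move: (P o0 o1 isT (eqs o0 o1 isT)) (P o0 o2 isT (eqs o0 o2 isT))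
  (P o1 o2 isT (eqs o1 o2 isT)).
have : xsum (index_enum 'I_3) (fun j => xsum (index_enum 'I_3) (fun l =>
    (j != l) && (UU (b l) (c o1 j) (+) DD (b l) (c o1 j)))).
  have -> : xsum (index_enum 'I_3) (fun j => xsum (index_enum 'I_3) (fun l =>
    (j != l) && (UU (b l) (c o1 j) (+) DD (b l) (c o1 j)))) =
    xsum (index_enum 'I_3) (fun j => xsum (index_enum 'I_3) (fun l =>
    (j != l) && (h o1 l (+) lexlt (b j) (b l)))).
    apply: eq_xsum => j; apply: eq_xsum => l.
    by case: (boolP (j != l)) => //= jl; rewrite hw.
  rewrite /xsum !big_ord_recl !big_ord0 /=.
  rewrite -/o0 -/o1 -/o2 (@lexltN _ (b o0) (b o1)) ?hb //.
  rewrite (@lexltN _ (b o0) (b o2)) ?hb // (@lexltN _ (b o1) (b o2)) ?hb //.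
  case: (h o1 o0); case: (h o1 o1); case: (h o1 o2);
  by case: (lexlt (b o0) (b o1)); case: (lexlt (b o0) (b o2)); case: (lexlt (b o1) (b o2)).
have split f g : xsum (index_enum 'I_3) (fun j => xsum (index_enum 'I_3) (fun l =>
    (j != l) && (f j l (+) g j l))) =
  xsum (index_enum 'I_3) (fun j => xsum (index_enum 'I_3) (fun l => (j != l) && f j l)) (+)
  xsum (index_enum 'I_3) (fun j => xsum (index_enum 'I_3) (fun l => (j != l) && g j l)).
  rewrite -xsum_add; apply: eq_xsum => j; rewrite -xsum_add; apply: eq_xsum => l.
  by rewrite andb_addr.
rewrite !split.
by do 4 case: (xsum _ _).
Qed.
End Chains.

(** * Random walks on expanders *)

Section CauchySchwarz.
Local Open Scope ring_scope.
Variable F : realFieldType.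

(** Lagrange's identity: twice the difference is a double sum of squares. *)
Lemma sum_cauchy_schwarz (I : finType) (P : pred I) (a b : I -> F) :
  (\sum_(i | P i) a i * b i) ^+ 2 <=
  (\sum_(i | P i) a i ^+ 2) * (\sum_(i | P i) b i ^+ 2).
Proof.
have H : 0 <= \sum_(i | P i) \sum_(j | P j) (a i * b j - a j * b i) ^+ 2.
  by apply: sumr_ge0 => i _; apply: sumr_ge0 => j _; apply: sqr_ge0.
suff E : \sum_(i | P i) \sum_(j | P j) (a i * b j - a j * b i) ^+ 2 =
  2%:R * ((\sum_(i | P i) a i ^+ 2) * (\sum_(i | P i) b i ^+ 2)) -
  2%:R * (\sum_(i | P i) a i * b i) ^+ 2.
  by move: H; rewrite E subr_ge0 ler_pM2l // ltr0n.
have E1 : \sum_(i | P i) \sum_(j | P j) a i ^+ 2 * b j ^+ 2 =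
  (\sum_(i | P i) a i ^+ 2) * (\sum_(i | P i) b i ^+ 2).
  by rewrite big_distrl /=; apply: eq_bigr => i _; rewrite big_distrr.
have E2 : \sum_(i | P i) \sum_(j | P j) (a i * b i) * (a j * b j) =
  (\sum_(i | P i) a i * b i) ^+ 2.
  by rewrite expr2 big_distrl /=; apply: eq_bigr => i _; rewrite big_distrr.
rewrite -E2 -{1}E1 !mulr_natl 2!mulr2n.
rewrite [X in _ = _ + X - _]exchange_big /=.
rewrite -!big_split -sumrN -big_split /=; apply: eq_bigr => i _.
rewrite -!big_split -sumrN -big_split /=; apply: eq_bigr => j _; ring.
Qed.
End CauchySchwarz.

(** * Cheeger's inequality and the contraction of the lazy walk *)

Section Walk.
Local Open Scope ring_scope.
Variables (F : realFieldType) (V E : finType) (s d : E -> V) (D : nat).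
Hypothesis D0 : (0 < D)%N.
Hypothesis sd : forall e, s e != d e.

Definition inc e x := (s e == x) || (d e == x).
Definition oth e x := if s e == x then d e else s e.
Definition deg x := #|[set e | inc e x]|.
Hypothesis degD : forall x, (deg x <= D)%N.

Let Dr : F := D%:R.
Let Dr0 : 0 < Dr. Proof. by rewrite ltr0n. Qed.

Lemma sum_inc (G : E -> V -> F) :
  \sum_x \sum_(e | inc e x) G e x = \sum_e (G e (s e) + G e (d e)).
Proof.
rewrite (exchange_big_dep predT) //=; apply: eq_bigr => e _.
rewrite (bigD1 (s e)) /=; last by rewrite /inc eqxx.
rewrite (bigD1 (d e)) /=; last by rewrite /inc eqxx orbT eq_sym sd.
rewrite big1 ?addr0 // => x /andP[/andP[]]; rewrite /inc eq_sym => /orP[|] /eqP ->.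
  by rewrite eqxx.
by rewrite eqxx.
Qed.

Definition lap (g : V -> F) x := \sum_(e | inc e x) (g x - g (oth e x)).
(** The transition operator of the lazy walk that crosses each incident edge with probability 1/(2D)
    and otherwise stays. It is symmetric, so the uniform law is stationary although degrees vary. *)
Definition pop (g : V -> F) x := g x - lap g x / (2%:R * Dr).
Definition energy (g : V -> F) := \sum_e (g (s e) - g (d e)) ^+ 2.

Lemma oth_s e : oth e (s e) = d e. Proof. by rewrite /oth eqxx. Qed.
Lemma oth_d e : oth e (d e) = s e.
Proof. by rewrite /oth (negbTE (sd e)). Qed.

Lemma sum_lap g : \sum_x lap g x = 0.
Proof.
rewrite /lap sum_inc big1 // => e _; rewrite oth_s oth_d; ring.
Qed.

Lemma sum_pop g : \sum_x pop g x = \sum_x g x.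
Proof.
rewrite /pop big_split /= sumrN -mulr_suml sum_lap mul0r oppr0 addr0 //.
Qed.

Lemma dot_lap g : \sum_x g x * lap g x = energy g.
Proof.
under eq_bigr => x _ do rewrite /lap big_distrr /=.
rewrite sum_inc; apply: eq_bigr => e _; rewrite oth_s oth_d; ring.
Qed.

Lemma lap_sqr g : \sum_x lap g x ^+ 2 <= 2%:R * Dr * energy g.
Proof.
have -> : 2%:R * Dr * energy g =
    Dr * \sum_x \sum_(e | inc e x) (g x - g (oth e x)) ^+ 2.
  have -> : \sum_x \sum_(e | inc e x) (g x - g (oth e x)) ^+ 2 = 2%:R * energy g.
    rewrite sum_inc /energy big_distrr /=; apply: eq_bigr => e _.
    rewrite oth_s oth_d; ring.
  ring.
rewrite big_distrr /=; apply: ler_sum => x _.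
have := sum_cauchy_schwarz (fun e => inc e x) (fun e => g x - g (oth e x)) (fun=> 1).
rewrite /=; under eq_bigr => e _ do rewrite mulr1.
move/le_trans; apply; rewrite mulrC; apply: ler_wpM2r.
  by apply: sumr_ge0 => e _; apply: sqr_ge0.
under eq_bigr => e _ do rewrite expr1n.
rewrite sumr_const ler_nat; apply: leq_trans (degD x).
by rewrite /deg cardsE.
Qed.

(** Expanding the square subtracts energy/D and adds the squared Laplacian over 4 D^2. By [lap_sqr]
    the latter returns at most half of the loss. *)
Lemma pop_contract g :
  \sum_x pop g x ^+ 2 <= \sum_x g x ^+ 2 - energy g / (2%:R * Dr).
Proof.
have -> : \sum_x pop g x ^+ 2 = \sum_x g x ^+ 2 - energy g / Dr +
    (\sum_x lap g x ^+ 2) / (4%:R * Dr ^+ 2).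
  rewrite -dot_lap !mulr_suml -sumrN -!big_split /=; apply: eq_bigr => x _.
  by rewrite /pop; field; rewrite gt_eqF.
have := lap_sqr g; move: (\sum_x lap g x ^+ 2) (energy g) => L e h.
have : L / (4%:R * Dr ^+ 2) <= (2%:R * Dr * e) / (4%:R * Dr ^+ 2).
  by apply: ler_wpM2r => //; rewrite invr_ge0 mulr_ge0 ?sqr_ge0 // ler0n.
have -> : (2%:R * Dr * e) / (4%:R * Dr ^+ 2) = e / (2%:R * Dr).
  by field; rewrite gt_eqF.
have -> : e / Dr = e / (2%:R * Dr) + e / (2%:R * Dr) by field; rewrite gt_eqF.
lra.
Qed.

Definition cut (Y : {set V}) := [set e | (s e \in Y) != (d e \in Y)].
Variable phi : F.
Hypothesis phi0 : 0 < phi.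
Hypothesis expand : forall Y : {set V}, (2 * #|Y| <= #|V|)%N ->
  phi * Dr * #|Y|%:R <= #|cut Y|%:R.

(** Induction on the support Y of [h]: subtract the least positive value mu of [h] on Y. The left
    side drops by mu phi D |Y| and the right side by mu |cut Y|, so the step is the expansion of
    Y. *)
Lemma coarea (h : V -> F) : (forall x, 0 <= h x) ->
  (2 * #|[set x | (0 < h x)%R]| <= #|V|)%N ->
  phi * Dr * \sum_x h x <= \sum_e `|h (s e) - h (d e)|.
Proof.
elim: {h}#|_| {-2}h (leqnn #|[set x | (0 < h x)%R]|) => [|k IH] h.
  move=> le0 h0 _; rewrite big1 ?mulr0 ?sumr_ge0 // => x _.
  move: le0; rewrite leqn0 cards_eq0 => /eqP/setP/(_ x); rewrite !inE.
  by case: (ltgtP 0 (h x)) (h0 x).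
move=> lek h0 half; set Y := [set x | (0 < h x)%R] in lek half.
have [Y0|[y yY]] := set_0Vmem Y.
  by apply: IH => //; rewrite -/Y Y0 cards0.
pose y0 := [arg min_(x < y in Y) h x]%O.
have [y0Y y0min] : y0 \in Y /\ forall x, x \in Y -> h y0 <= h x.
  by rewrite /y0; case: (@Order.TotalTheory.arg_minP) => //.
pose mu := h y0; have mu0 : 0 < mu by move: y0Y; rewrite inE.
pose h' x := h x - (x \in Y)%:R * mu.
have nY x : x \notin Y -> h x = 0.
  by rewrite inE; case: (ltgtP 0 (h x)) (h0 x).
have h'0 x : 0 <= h' x.
  rewrite /h'; case: (boolP (x \in Y)) => xY; last by rewrite mul0r subr0.
  by rewrite mul1r subr_ge0 y0min.
have sub : [set x | (0 < h' x)%R] \proper Y.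
  apply/properP; split; last first.
    by exists y0 => //; rewrite inE /h' y0Y mul1r subrr ltxx.
  apply/subsetP => x; rewrite inE /h'; apply: contraTT => xY.
  by rewrite (negbTE xY) mul0r subr0 nY // ltxx.
have lt := proper_card sub.
have {}IH := IH h' _ h'0 _.
have {IH} : phi * Dr * \sum_x h' x <= \sum_e `|h' (s e) - h' (d e)|.
  apply: IH; first by rewrite -ltnS (leq_trans lt).
  by apply: leq_trans half; rewrite leq_mul2l (ltnW lt) orbT.
have -> : \sum_x h' x = \sum_x h x - mu * #|Y|%:R.
  rewrite /h' big_split /= sumrN -mulr_suml mulrC -natr_sum; congr (_ - _ * _%:R).
  by rewrite -sum1_card [RHS]big_mkcond /=; apply: eq_bigr => x _; case: (_ \in _).
have -> : \sum_e `|h (s e) - h (d e)| = \sum_e `|h' (s e) - h' (d e)| + mu * #|cut Y|%:R.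
  have -> : #|cut Y| = (\sum_e ((s e \in Y) != (d e \in Y)))%N.
    rewrite -sum1_card big_mkcond /=; apply: eq_bigr => e _; rewrite inE.
    by case: (_ != _).
  rewrite natr_sum big_distrr -big_split /=; apply: eq_bigr => e _; rewrite /h'.
  case: (boolP (s e \in Y)) => a; case: (boolP (d e \in Y)) => b //=;
   rewrite ?mul1r ?mul0r ?subr0 ?mulr1 ?mulr0 ?addr0 ?(nY _ a) ?(nY _ b) ?subr0 ?sub0r ?normrN //.
  - by congr `|_|; ring.
  - by rewrite !ger0_norm ?subr_ge0 ?y0min ?subrK // h0.
  - by rewrite !ger0_norm ?subr_ge0 ?y0min ?subrK // h0.
have := ler_wpM2l (ltW mu0) (expand half).
rewrite mulrBr => h1 h2; rewrite -(subrK (mu * (phi * Dr * #|Y|%:R)) (phi * Dr * _)).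
apply: lerD => //; apply: le_trans h2.
by rewrite [mu * (_ * _)]mulrCA.
Qed.

(** Apply [coarea] to g^2, factor the difference of squares, and use Cauchy-Schwarz; the factor with
    the sums is at most 2 D times the sum of g^2 by the degree bound. *)
Lemma cheeger_half (g : V -> F) : (forall x, 0 <= g x) ->
  (2 * #|[set x | (0 < g x)%R]| <= #|V|)%N ->
  phi ^+ 2 * Dr * \sum_x g x ^+ 2 <= 2%:R * energy g.
Proof.
move=> g0 half; set S := \sum_x g x ^+ 2.
have S0 : 0 <= S by apply: sumr_ge0 => x _; apply: sqr_ge0.
have [->|Sn0] := eqVneq S 0.
  by rewrite mulr0 mulr_ge0 ?ler0n // sumr_ge0 // => e _; apply: sqr_ge0.
have Sp : 0 < S by rewrite lt_neqAle eq_sym Sn0.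
have c1 := @coarea (fun x => g x ^+ 2) (fun x => sqr_ge0 _).
have {c1} := c1 _; rewrite -/S => c1.
have {}c1 : phi * Dr * S <= \sum_e `|g (s e) - g (d e)| * (g (s e) + g (d e)).
  apply: le_trans (c1 _) _.
    rewrite (_ : [set x | _] = [set x | (0 < g x)%R]) //.
    by apply/setP => x; rewrite !inE exprn_even_gt0 //= lt_neqAle eq_sym g0 andbT.
  apply: ler_sum => e _; by rewrite subr_sqr normrM (ger0_norm (addr_ge0 (g0 _) (g0 _))).
have c2 := sum_cauchy_schwarz predT (fun e => `|g (s e) - g (d e)|) (fun e => g (s e) + g (d e)).
have c3 : \sum_e (g (s e) + g (d e)) ^+ 2 <= 2%:R * Dr * S.
  apply: (@le_trans _ _ (2%:R * \sum_e (g (s e) ^+ 2 + g (d e) ^+ 2))).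
    rewrite big_distrr; apply: ler_sum => e _.
    by rewrite -subr_ge0 (_ : _ - _ = (g (s e) - g (d e)) ^+ 2) ?sqr_ge0 //=; ring.
  rewrite -mulrA ler_pM2l ?ltr0n // -(sum_inc (fun _ x => g x ^+ 2)) /S big_distrr /=.
  apply: ler_sum => x _; rewrite sumr_const -mulr_natl ler_wpM2r ?sqr_ge0 //.
  by rewrite ler_nat; apply: leq_trans (degD x); rewrite /deg cardsE.
have E0 : 0 <= energy g by apply: sumr_ge0 => e _; apply: sqr_ge0.
have c4 : (phi * Dr * S) ^+ 2 <= energy g * (2%:R * Dr * S).
  apply: le_trans (_ : (\sum_e `|g (s e) - g (d e)| * (g (s e) + g (d e))) ^+ 2 <= _).
    rewrite ler_pXn2r // nnegrE; first by rewrite !mulr_ge0 // ltW.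
    by apply: sumr_ge0 => e _; rewrite mulr_ge0 ?addr_ge0.
  apply: le_trans c2 _.
  have -> : \sum_e `|g (s e) - g (d e)| ^+ 2 = energy g.
    by apply: eq_bigr => e _; rewrite real_normK ?num_real.
  by apply: ler_wpM2l.
rewrite -(ler_pM2r (mulr_gt0 Dr0 Sp)).
by apply: le_trans (le_trans c4 _); rewrite le_eqVlt; apply/orP; left; apply/eqP; ring.
Qed.

Lemma median (g : V -> F) : (0 < #|V|)%N -> exists m : F,
  (2 * #|[set x | (m < g x)%R]| <= #|V|)%N /\ (2 * #|[set x | (g x < m)%R]| <= #|V|)%N.
Proof.
case/card_gt0P => v0 _.
pose Q x := (2 * #|[set y | (g x < g y)%R]| <= #|V|)%N.
have [xM _ hM] := @Order.TotalTheory.arg_maxP _ F V v0 predT g isT.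
have QM : Q xM.
  rewrite /Q (_ : [set y | _] = set0) ?cards0 ?muln0 //.
  by apply/setP => y; rewrite !inE; apply/negbTE; rewrite -leNgt; exact: hM.
have [x Qx hx] := @Order.TotalTheory.arg_minP _ F V xM Q g QM.
exists (g x); split; first exact: Qx.
set L := [set y | _].
have [L0|[y yL]] := set_0Vmem L; first by rewrite L0 cards0.
have [z zL hz] := @Order.TotalTheory.arg_maxP _ F V y (mem L) g yL.
have {}zL : g z < g x by move: (zL : z \in L); rewrite inE.
have {}hz w : g w < g x -> g w <= g z.
  by move=> wx; apply: (hz w); have : w \in L by rewrite inE.
have nQz : ~~ Q z by apply/negP => /hx; rewrite leNgt zL.
move: nQz; rewrite /Q -ltnNge => nQz.
have : (#|[set y0 | (g z < g y0)%R]| + #|L| = #|V|)%N.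
  rewrite -cardsUI (_ : _ :&: _ = set0) ?cards0 ?addn0; last first.
    apply/setP => w; rewrite !inE; apply/negP => /andP[zw wx].
    by have := hz w wx; rewrite leNgt zw.
  rewrite (_ : _ :|: _ = setT) ?cardsT //; apply/setP => w; rewrite !inE.
  case: (ltP (g w) (g x)) => h; first by rewrite orbT.
  by rewrite (lt_le_trans zL h).
by move: nQz; move: #|_| #|_| #|_| => a b c; lia.
Qed.

(** The positive and negative parts of g - m, with m a median, are each supported on at most half of
    the vertices. Their energies add up to at most that of g, and shifting a function of mean zero
    can only increase its sum of squares. *)
Lemma poincare (g : V -> F) : (0 < #|V|)%N -> \sum_x g x = 0 ->
  phi ^+ 2 * Dr * \sum_x g x ^+ 2 <= 2%:R * energy g.
Proof.
move=> V0 g0; have [m [m1 m2]] := median g V0.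
pose gp x := Num.max 0 (g x - m); pose gn x := Num.max 0 (m - g x).
have hp : phi ^+ 2 * Dr * \sum_x gp x ^+ 2 <= 2%:R * energy gp.
  apply: cheeger_half => [x|]; first by rewrite le_max lexx.
  by rewrite (_ : [set x | _] = [set x | m < g x]) //; apply/setP => x;
    rewrite !inE lt_max ltxx /= subr_gt0.
have hn : phi ^+ 2 * Dr * \sum_x gn x ^+ 2 <= 2%:R * energy gn.
  apply: cheeger_half => [x|]; first by rewrite le_max lexx.
  by rewrite (_ : [set x | _] = [set x | g x < m]) //; apply/setP => x;
    rewrite !inE lt_max ltxx /= subr_gt0.
have E1 : energy gp + energy gn <= energy g.
  rewrite -big_split /=; apply: ler_sum => e _; rewrite /gp /gn.
  move: (g (s e)) (g (d e)) => a b.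
  case: (leP 0 (a - m)) => h1; case: (leP 0 (m - a)) => h2;
  case: (leP 0 (b - m)) => h3; case: (leP 0 (m - b)) => h4; nra.
have E2 : \sum_x g x ^+ 2 <= \sum_x gp x ^+ 2 + \sum_x gn x ^+ 2.
  apply: (@le_trans _ _ (\sum_x (g x - m) ^+ 2)).
    have -> : \sum_x (g x - m) ^+ 2 = \sum_x g x ^+ 2 - 2%:R * m * (\sum_x g x) + \sum_(x : V) m ^+ 2.
      rewrite big_distrr -sumrN -!big_split /=; apply: eq_bigr => x _; ring.
    by rewrite g0 mulr0 subr0 lerDl sumr_ge0 // => x _; apply: sqr_ge0.
  rewrite -big_split /=; apply: ler_sum => x _; rewrite /gp /gn.
  case: (leP 0 (g x - m)) => h1; case: (leP 0 (m - g x)) => h2; nra.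
have c0 : 0 <= phi ^+ 2 * Dr by rewrite mulr_ge0 ?sqr_ge0 // ltW.
apply: le_trans (ler_wpM2l c0 E2) _; rewrite mulrDr.
apply: le_trans (lerD hp hn) _; rewrite -mulrDr.
by apply: ler_wpM2l => //; rewrite ler0n.
Qed.

Lemma pop_mix (g : V -> F) : (0 < #|V|)%N -> \sum_x g x = 0 ->
  \sum_x pop g x ^+ 2 <= (1 - phi ^+ 2 / 4%:R) * \sum_x g x ^+ 2.
Proof.
move=> V0 g0; apply: le_trans (pop_contract g) _.
have h := poincare V0 g0; move: (\sum_x _) (energy g) h => S e h.
have -> : (1 - phi ^+ 2 / 4%:R) * S = S - (phi ^+ 2 * Dr * S) / (4%:R * Dr).
  by field; rewrite gt_eqF.
rewrite lerD2l lerN2.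
have -> : e / (2%:R * Dr) = (2%:R * e) / (4%:R * Dr) by field; rewrite gt_eqF.
by apply: ler_wpM2r => //; rewrite invr_ge0 mulr_ge0 ?ler0n.
Qed.

End Walk.

Section BigTuple.
Local Open Scope ring_scope.
Variable F : realFieldType.

Lemma big_tupleS (T : finType) l (G : seq T -> F) :
  \sum_(w : l.+1.-tuple T) G w = \sum_o \sum_(w : l.-tuple T) G (o :: w).
Proof.
rewrite pair_big /=.
rewrite (reindex (fun ow : T * l.-tuple T => [tuple of ow.1 :: ow.2])) //=.
exists (fun w : l.+1.-tuple T => (thead w, [tuple of behead w])).
  by move=> [o w] _ /=; rewrite theadE; congr pair; apply: val_inj.
by move=> w _; rewrite -tuple_eta.
Qed.

Lemma big_tuple0 (T : finType) (G : seq T -> F) :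
  \sum_(w : 0.-tuple T) G w = G [::].
Proof.
rewrite (bigD1 [tuple]) //= big1 ?addr0 // => w /eqP[].
by rewrite tuple0.
Qed.

Lemma sum_option (T : finType) (G : option T -> F) :
  \sum_o G o = G None + \sum_x G (Some x).
Proof.
rewrite (bigD1 None) //=; congr (_ + _).
rewrite (reindex_omap Some id) => [|[x|]] //=.
by apply: eq_bigl => x; rewrite eqxx.
Qed.
End BigTuple.

(** * Random walks of fixed length: mixing and edge traversals *)

Section Walk.
Local Open Scope ring_scope.
Variables (F : realFieldType) (V E : finType) (s d : E -> V) (D : nat).
Hypothesis D0 : (0 < D)%N.
Hypothesis sd : forall e, s e != d e.
Notation inc := (inc s d).
Notation oth := (oth s d).
Notation deg := (deg s d).
Notation pop := (@pop F V E s d D).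
Hypothesis degD : forall x, (deg x <= D)%N.

Let Dr : F := D%:R.
Let Dr0 : 0 < Dr. Proof. by rewrite ltr0n. Qed.

(** The probability of a walk coded as a word: [None] is a lazy step and [Some e] crosses [e]. Words
    that do not spell a walk from [x] have weight 0, so all sums range over full tuple types. *)
Fixpoint wt x (w : seq (option E)) : F :=
  match w with
  | [::] => 1
  | None :: w' => (1 - (deg x)%:R / (2%:R * Dr)) * wt x w'
  | Some e :: w' => if inc e x then (2%:R * Dr)^-1 * wt (oth e x) w' else 0
  end.

Fixpoint fin x (w : seq (option E)) :=
  match w with
  | [::] => x
  | None :: w' => fin x w'
  | Some e :: w' => fin (oth e x) w'
  end.

Definition wedges (w : seq (option E)) : seq E := pmap id w.

Lemma lazy_ge0 x : 0 <= 1 - (deg x)%:R / (2%:R * Dr).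
Proof.
rewrite subr_ge0 ler_pdivrMr ?mulr_gt0 ?ltr0n // mul1r.
apply: (@le_trans _ _ Dr); first by rewrite ler_nat.
by rewrite ler_pMl // ler1n.
Qed.

Lemma wt_ge0 x w : 0 <= wt x w.
Proof.
elim: w x => [|[e|] w IH] x //=; last by rewrite mulr_ge0 ?lazy_ge0.
by case: ifP => // _; rewrite mulr_ge0 ?invr_ge0 ?mulr_ge0 ?ler0n.
Qed.

Lemma inc_g (g : V -> bool) e x : inc e x -> g (s e) (+) g (d e) = g x (+) g (oth e x).
Proof.
rewrite /inc /oth => /orP[|] /eqP <-; first by rewrite eqxx.
by rewrite (negbTE (sd e)) addbC.
Qed.

Lemma walk_conn x w (g : V -> bool) : wt x w != 0 ->
  \big[addb/false]_(e <- wedges w) (g (s e) (+) g (d e)) = g x (+) g (fin x w).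
Proof.
elim: w x => [|[e|] w IH] x /=; first by rewrite big_nil addbb.
  case: ifP => [ex|]; last by rewrite eqxx.
  rewrite mulf_eq0 negb_or => /andP[_ /IH h].
  by rewrite big_cons h (inc_g _ ex) addbA addbK.
by rewrite mulf_eq0 negb_or => /andP[_ /IH h].
Qed.

Definition walks l (x : V) (G : seq (option E) -> F) : F :=
  \sum_(w : l.-tuple (option E)) wt x w * G w.

Lemma walks0 x G : walks 0 x G = G [::].
Proof.
by rewrite /walks (big_tuple0 (fun w => wt x w * G w)) /= mul1r.
Qed.

Lemma walksS l x G : walks l.+1 x G =
  (1 - (deg x)%:R / (2%:R * Dr)) * walks l x (fun w => G (None :: w)) +
  (2%:R * Dr)^-1 * \sum_(e | inc e x) walks l (oth e x) (fun w => G (Some e :: w)).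
Proof.
rewrite /walks (big_tupleS _ (fun w => wt x w * G w)) sum_option /=; congr (_ + _).
  by rewrite big_distrr; apply: eq_bigr => w _ /=; rewrite mulrA.
rewrite big_distrr [RHS]big_mkcond; apply: eq_bigr => e _ /=.
case: ifP => _; last by apply: big1 => w _; rewrite mul0r.
by rewrite big_distrr; apply: eq_bigr => w _ /=; rewrite mulrA.
Qed.

Lemma popE g x : pop g x =
  (1 - (deg x)%:R / (2%:R * Dr)) * g x + (2%:R * Dr)^-1 * \sum_(e | inc e x) g (oth e x).
Proof.
rewrite /pop /lap big_split /= sumrN sumr_const -mulr_natl.
have -> : #|[pred e | inc e x]| = deg x by rewrite /deg cardsE.
rewrite -/Dr; move: (\sum_(_ | _) _) => S; field; by rewrite gt_eqF.
Qed.

Definition pr l x y := walks l x (fun w => (fin x w == y)%:R).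

Lemma prS l x y : pr l.+1 x y = pop (fun z => pr l z y) x.
Proof. by rewrite popE /pr walksS. Qed.

Lemma pr0 x y : pr 0 x y = (x == y)%:R.
Proof. by rewrite /pr walks0. Qed.

Lemma walks1 l x : walks l x (fun=> 1) = 1.
Proof.
elim: l x => [|l IH] x; first by rewrite walks0.
rewrite walksS IH; under eq_bigr => e _ do rewrite IH.
have := popE (fun=> 1) x => <-.
by rewrite /pop /lap big1 ?mul0r ?subr0 // => e _; rewrite subrr.
Qed.

Lemma sum_pr l y : \sum_x pr l x y = 1.
Proof.
elim: l => [|l IH].
  rewrite (bigD1 y) //= pr0 eqxx big1 ?addr0 // => x /negbTE.
  by rewrite pr0 => ->.
by under eq_bigr => x _ do rewrite prS; rewrite (sum_pop D sd) IH.
Qed.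

(** With one unit of mass at every start, stationarity keeps one unit at every vertex. Each step
    therefore crosses [e] with weight 1/(2D) from each of its two ends. *)
Lemma sum_count l e :
  \sum_x walks l x (fun w => (count_mem e (wedges w))%:R) = l%:R / Dr.
Proof.
elim: l => [|l IH]; first by rewrite mul0r big1 // => x _; rewrite walks0.
transitivity (\sum_x (pop (fun z => walks l z (fun w => (count_mem e (wedges w))%:R)) x +
   (2%:R * Dr)^-1 * \sum_(f | inc f x) (f == e)%:R)).
  apply: eq_bigr => x _; rewrite walksS popE -addrA -mulrDr -big_split /=.
  congr (_ + _ * _); apply: eq_bigr => f _.
  under [X in X = _]eq_bigr => w _ do rewrite /= natrD mulrDr.
  by rewrite big_split /= -mulr_suml -/(walks l _ (fun=> 1)) addrC; congr (_ + _);
    rewrite -[RHS]mul1r -(walks1 l (oth f x)) /walks; congr (_ * _);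
    apply: eq_bigr => w _; rewrite mulr1.
rewrite big_split /= (sum_pop D sd) IH -big_distrr (sum_inc sd (fun f _ => (f == e)%:R)) /=.
rewrite (bigD1 e) //= eqxx big1 => [|f /negbTE ->]; last by rewrite addr0.
rewrite /= -[l.+1%:R]natr1; field; by rewrite gt_eqF.
Qed.

Variable phi : F.
Hypothesis phi0 : 0 < phi.
Hypothesis expand : forall Y : {set V}, (2 * #|Y| <= #|V|)%N ->
  phi * Dr * #|Y|%:R <= #|cut s d Y|%:R.
Variable n : nat.
Hypothesis nV : n = #|V|.
Hypothesis n0 : (0 < n)%N.
Hypothesis phi1 : phi ^+ 2 / 4%:R <= 1.

(** As a function of the start, the deviation from 1/n has mean zero by [sum_pr], and one more step
    applies [pop]. So [pop_mix] contracts the sum of squares, which is 1 - 1/n at length 0. *)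
Lemma pr_var l y :
  \sum_x (pr l x y - n%:R^-1) ^+ 2 <= (1 - phi ^+ 2 / 4%:R) ^+ l.
Proof.
have nn0 : n%:R != 0 :> F by rewrite pnatr_eq0 -lt0n.
elim: l => [|l IH].
  rewrite expr0 (bigD1 y) //= pr0 eqxx.
  have -> : \sum_(i | i != y) (pr 0 i y - n%:R^-1) ^+ 2 = n.-1%:R * n%:R^-1 ^+ 2.
    transitivity (\sum_(i | i != y) (n%:R^-1 : F) ^+ 2).
      by apply: eq_bigr => i /negbTE iy; rewrite pr0 iy sub0r sqrrN.
    by rewrite sumr_const (cardC1 y) -nV mulr_natl.
  have -> : n.-1%:R = n%:R - 1 :> F by rewrite -{2}(prednK n0) -natr1 addrK.
  have -> : (1 - n%:R^-1) ^+ 2 + (n%:R - 1) * n%:R^-1 ^+ 2 = 1 - n%:R^-1 :> F.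
    by field.
  by rewrite gerBl invr_ge0 ler0n.
have g0 : \sum_x (pr l x y - n%:R^-1) = 0.
  rewrite big_split /= sum_pr sumr_const -nV mulNrn -(mulr_natr n%:R^-1 n) mulVf //.
  by rewrite subrr.
have VV : (0 < #|V|)%N by rewrite -nV.
have := pop_mix D0 sd degD phi0 expand VV g0.
have -> : \sum_x pop (fun x => pr l x y - n%:R^-1) x ^+ 2 =
    \sum_x (pr l.+1 x y - n%:R^-1) ^+ 2.
  apply: eq_bigr => x _; congr (_ ^+ 2); rewrite prS /pop addrAC; congr (_ - _ / _ - _).
  by apply: eq_bigr => e _; rewrite opprB addrA subrK.
move/le_trans; apply; rewrite [leRHS]exprS; apply: ler_wpM2l => //.
by rewrite subr_ge0.
Qed.

Lemma ler_sqr_norm (a b : F) : 0 <= b -> (a ^+ 2 <= b ^+ 2) = (`|a| <= b).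
Proof.
move=> b0; rewrite -[a ^+ 2]real_normK ?num_real //.
by rewrite ler_pXn2r ?nnegrE.
Qed.

Lemma pr_lower l x y : 4%:R * n%:R ^+ 2 * (1 - phi ^+ 2 / 4%:R) ^+ l <= 1 ->
  (2%:R * n%:R)^-1 <= pr l x y.
Proof.
move=> hl; have np : 0 < n%:R :> F by rewrite ltr0n.
have nn0 : n%:R != 0 :> F by rewrite gt_eqF.
have := pr_var l y; rewrite (bigD1 x) //= => h.
have {h} : (pr l x y - n%:R^-1) ^+ 2 <= (2%:R * n%:R)^-1 ^+ 2.
  apply: (@le_trans _ _ ((1 - phi ^+ 2 / 4%:R) ^+ l)).
    by apply: le_trans h; rewrite lerDl sumr_ge0 // => z _; apply: sqr_ge0.
  rewrite -[leRHS]mul1r exprVn ler_pdivlMr ?exprn_gt0 ?mulr_gt0 ?ltr0n //.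
  by apply: le_trans hl; rewrite le_eqVlt; apply/orP; left; apply/eqP; ring.
rewrite ler_sqr_norm; last by rewrite invr_ge0 mulr_ge0 ?ler0n.
rewrite ler_norml => /andP[h _].
have : (2%:R * n%:R)^-1 + (2%:R * n%:R)^-1 = n%:R^-1 :> F by field.
move: h; move: (pr l x y) (2%:R * n%:R)^-1 n%:R^-1 => a b c; lra.
Qed.
End Walk.

(** * First-moment arguments on product distributions *)

Section Averaging.
Local Open Scope ring_scope.
Variable F : realFieldType.

Lemma sum_marginal2 (I T : finType) (w : I -> T -> F) (p q : I) (G : T -> T -> F) :
  (forall i, \sum_x w i x = 1) -> p != q ->
  \sum_(f : {ffun I -> T}) (\prod_i w i (f i)) * G (f p) (f q) =
  \sum_x \sum_y w p x * w q y * G x y.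
Proof.
move=> w1 pq.
(* The extra factors pin coordinate p to x and coordinate q to y. The sum over all f of the product
   then factors, and the free coordinates contribute 1. *)
pose m x y i z : F := w i z * ((i == p) ==> (z == x))%:R * ((i == q) ==> (z == y))%:R.
have E x y : \sum_(f : {ffun I -> T}) \prod_i m x y i (f i) = w p x * w q y.
  rewrite -(bigA_distr_bigA (m x y)) (bigD1 p) //= (bigD1 q) 1?eq_sym //= mulrA.
  rewrite [X in _ * X = _]big1 ?mulr1 => [|i /andP[ip iq]]; last first.
    rewrite -(w1 i); apply: eq_bigr => z _.
    by rewrite /m (negbTE ip) (negbTE iq) /= !mulr1.
  congr (_ * _).
    rewrite (bigD1 x) //= big1 => [|z zx].
      by rewrite /m !eqxx (negbTE pq) /= !mulr1 addr0.
    by rewrite /m eqxx (negbTE zx) /= mulr0 mul0r.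
  rewrite (bigD1 y) //= big1 => [|z zy].
    by rewrite /m !eqxx (eq_sym q) (negbTE pq) /= !mulr1 addr0.
  by rewrite /m eqxx (negbTE zy) /= mulr0.
under [RHS]eq_bigr => x _ do under eq_bigr => y _ do rewrite -E big_distrl /=.
under [RHS]eq_bigr => x _ do rewrite exchange_big /=.
rewrite exchange_big /=; apply: eq_bigr => f _.
have M x y : \prod_i m x y i (f i) = (\prod_i w i (f i)) * ((f p == x) && (f q == y))%:R.
  rewrite /m !big_split /= -mulrA; congr (_ * _).
  have H (r : I) z : \prod_i ((i == r) ==> (f i == z))%:R = (f r == z)%:R :> F.
    by rewrite (bigD1 r) //= eqxx big1 ?mulr1 // => i /negbTE ->.
  by rewrite !H -natrM mulnb.
under [RHS]eq_bigr => x _ do under eq_bigr => y _ do rewrite M.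
rewrite pair_big /= (bigD1 (f p, f q)) //= !eqxx mulr1.
rewrite -[LHS]addr0; congr (_ + _); apply/esym/big1 => -[x y].
by rewrite xpair_eqE /= ![_ == f _]eq_sym => /negbTE ->; rewrite mulr0 mul0r.
Qed.

Lemma average_lt1 (T : finType) (w G : T -> F) :
  (forall x, 0 <= w x) -> \sum_x w x = 1 -> \sum_x w x * G x < 1 ->
  exists2 x, 0 < w x & G x < 1.
Proof.
move=> w0 w1 h; have [x /andP[]|H] := pickP (fun x => (0 < w x) && (G x < 1)).
  by exists x.
suff : 1 <= \sum_x w x * G x by rewrite leNgt h.
rewrite -w1; apply: ler_sum => x _.
have := H x; case: (ltgtP 0 (w x)) (w0 x) => //= [wx _|<- _ _]; last by rewrite mul0r.
by case: (ltP (G x) 1) => // g _; rewrite ler_pMr.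
Qed.

Lemma sum_ffun2 (T : finType) (p q : 'I_3) (G : T -> T -> F) : p != q ->
  \sum_(f : {ffun 'I_3 -> T}) G (f p) (f q) = #|T|%:R * \sum_x \sum_y G x y.
Proof.
move=> pq; have [T0|T0] := posnP #|T|.
  rewrite T0 mul0r big1 // => f _.
  by have := card0_eq T0 (f p); rewrite inE.
have n0 : #|T|%:R != 0 :> F by rewrite pnatr_eq0 -lt0n.
have /= := @sum_marginal2 'I_3 T (fun _ _ => #|T|%:R^-1) p q G _ pq.
move=> H; have {}H := H _.
have {H} : \sum_(f : {ffun 'I_3 -> T}) #|T|%:R ^- 3 * G (f p) (f q) =
  \sum_x \sum_y #|T|%:R ^- 2 * G x y.
  transitivity (\sum_(f : {ffun 'I_3 -> T}) (\prod_(i < 3) #|T|%:R^-1) * G (f p) (f q)).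
    by apply: eq_bigr => f _; rewrite prodr_const card_ord exprVn.
  rewrite H => [|_]; last by rewrite sumr_const -[_ *+ #|_|]mulr_natr mulVf.
  apply: eq_bigr => x _; apply: eq_bigr => y _; congr (_ * _).
  by rewrite -expr2 exprVn.
have -> : \sum_x \sum_y #|T|%:R ^- 2 * G x y = #|T|%:R ^- 2 * \sum_x \sum_y G x y.
  by rewrite mulr_sumr; apply: eq_bigr => x _; rewrite mulr_sumr.
rewrite -mulr_sumr => /(congr1 (fun z => #|T|%:R ^+ 3 * z)).
rewrite mulrA mulfV ?expf_neq0 // mul1r => ->.
by rewrite mulrA exprS mulfK // expf_neq0.
Qed.
End Averaging.

(** * Random branch vertices joined by conditioned walks *)

Section Select.
Local Open Scope ring_scope.
Variables (F : realFieldType) (V E : finType) (s d : E -> V) (D : nat).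
Hypothesis D0 : (0 < D)%N.
Hypothesis sd : forall e, s e != d e.
Hypothesis degD : forall x, (deg s d x <= D)%N.
Variable l : nat.
Let Dr : F := D%:R.
Let n := #|V|.
Hypothesis n0 : (0 < n)%N.
Notation wt := (@wt F V E s d D).
Notation fin := (@fin V E s d).
Notation pr := (@pr F V E s d D l).
Notation wk := (l.-tuple (option E)).
Hypothesis prlow : forall x y, (2%:R * n%:R)^-1 <= pr x y.
Variables (bad : rel E) (same : rel V).

Let pr0 x y : 0 < pr x y.
Proof. by apply: lt_le_trans (prlow x y); rewrite invr_gt0 mulr_gt0 ?ltr0n. Qed.

(** The law of the walk from [ab.1] conditioned to end at [ab.2]. *)
Definition cw (ab : V * V) (w : wk) : F :=
  wt ab.1 w * (fin ab.1 w == ab.2)%:R / pr ab.1 ab.2.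

Lemma cw_ge0 ab w : 0 <= cw ab w.
Proof.
rewrite /cw; apply: divr_ge0; last exact: ltW (pr0 _ _).
apply: mulr_ge0; [exact: wt_ge0 | exact: ler0n].
Qed.

Lemma sum_cw ab : \sum_w cw ab w = 1.
Proof. by rewrite -mulr_suml; apply: divff; rewrite gt_eqF ?pr0. Qed.

Definition conf (w w' : seq (option E)) : F :=
  \sum_e \sum_f (bad e f)%:R * ((count_mem e (wedges w))%:R * (count_mem f (wedges w'))%:R).

Lemma conf_ge0 w w' : 0 <= conf w w'.
Proof.
by apply: sumr_ge0 => e _; apply: sumr_ge0 => f _; rewrite !mulr_ge0 ?ler0n.
Qed.

Lemma conf_lt1 w w' : conf w w' < 1 ->
  forall e f, e \in wedges w -> f \in wedges w' -> ~~ bad e f.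
Proof.
move=> h e f ew fw; apply/negP => b; move: h; rewrite ltNge => /negP; apply.
rewrite /conf (bigD1 e) //= (bigD1 f) //= b mul1r -natrM -addrA.
apply: ler_wpDr.
  rewrite addr_ge0 //; first by apply: sumr_ge0 => *; rewrite !mulr_ge0 ?ler0n.
  by apply: sumr_ge0 => *; apply: sumr_ge0 => *; rewrite !mulr_ge0 ?ler0n.
by rewrite ler1n muln_gt0 -!has_count !has_pred1 ew.
Qed.

Definition eps (ab ab' : V * V) := \sum_(w : wk) \sum_(w' : wk) cw ab w * cw ab' w' * conf w w'.

(** By [prlow], conditioning multiplies the weight of a walk by at most 2n. Summing over the ends
    then leaves free walks from all starts, where [sum_count] gives (l/D)^2 for each bad pair. *)
Lemma sum_eps : \sum_a \sum_a' \sum_b \sum_b' eps (a, b) (a', b') <=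
  4%:R * n%:R ^+ 2 * (l%:R / Dr) ^+ 2 * #|[set p : E * E | bad p.1 p.2]|%:R.
Proof.
pose ct e (w : wk) : F := (count_mem e (wedges w))%:R.
have -> : 4%:R * n%:R ^+ 2 * (l%:R / Dr) ^+ 2 * #|[set p : E * E | bad p.1 p.2]|%:R =
  \sum_a \sum_a' \sum_b \sum_b' (\sum_(w : wk) \sum_(w' : wk)
    (2%:R * n%:R * (wt a w * (fin a w == b)%:R)) *
    (2%:R * n%:R * (wt a' w' * (fin a' w' == b')%:R)) * conf w w').
  have c4 : (2%:R * n%:R) ^+ 2 = 4%:R * n%:R ^+ 2 :> F by ring.
  rewrite -c4.
  have -> : #|[set p : E * E | bad p.1 p.2]|%:R = \sum_e \sum_f (bad e f)%:R :> F.
    rewrite pair_big /= -sum1_card natr_sum big_mkcond /=; apply: eq_bigr => p _.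
    by rewrite inE; case: bad.
  transitivity ((2%:R * n%:R) ^+ 2 * (\sum_a \sum_a' \sum_(w : wk) \sum_(w' : wk)
     wt a w * wt a' w' * conf w w')).
    rewrite -mulrA; congr (_ * _).
    transitivity (\sum_e \sum_f (bad e f)%:R *
      ((\sum_a \sum_(w : wk) wt a w * ct e w) * (\sum_a \sum_(w : wk) wt a w * ct f w))).
      rewrite big_distrr /=; apply: eq_bigr => e _.
      rewrite big_distrr /=; apply: eq_bigr => f _.
      rewrite mulrC; congr (_ * _).
      by rewrite expr2 -{1}(sum_count F D0 sd l e) -(sum_count F D0 sd l f).
    transitivity (\sum_e \sum_f \sum_a \sum_a' \sum_(w : wk) \sum_(w' : wk)
      wt a w * wt a' w' * ((bad e f)%:R * (ct e w * ct f w'))).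
      apply: eq_bigr => e _; apply: eq_bigr => f _.
      rewrite big_distrl big_distrr; apply: eq_bigr => a _ /=.
      rewrite !big_distrr; apply: eq_bigr => a' _ /=.
      rewrite big_distrl big_distrr; apply: eq_bigr => w _ /=.
      by rewrite !big_distrr; apply: eq_bigr => w' _ /=; ring.
    under eq_bigr => e _ do rewrite exchange_big /=.
    rewrite exchange_big; apply: eq_bigr => a _ /=.
    under eq_bigr => e _ do rewrite exchange_big /=.
    rewrite exchange_big; apply: eq_bigr => a' _ /=.
    under eq_bigr => e _ do rewrite exchange_big /=.
    rewrite exchange_big; apply: eq_bigr => w _ /=.
    under eq_bigr => e _ do rewrite exchange_big /=.
    rewrite exchange_big; apply: eq_bigr => w' _ /=.
    rewrite /conf big_distrr; apply: eq_bigr => e _ /=.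
    by rewrite big_distrr.
  rewrite big_distrr; apply: eq_bigr => a _ /=.
  rewrite big_distrr; apply: eq_bigr => a' _ /=.
  rewrite big_distrr /=.
  under [RHS]eq_bigr => b _ do rewrite exchange_big /=.
  rewrite [RHS]exchange_big; apply: eq_bigr => w _ /=.
  under [RHS]eq_bigr => b _ do rewrite exchange_big /=.
  rewrite [RHS]exchange_big big_distrr; apply: eq_bigr => w' _ /=.
  rewrite (bigD1 (fin a w)) //= (bigD1 (fin a' w')) //= !eqxx.
  rewrite big1 ?addr0 => [|b /negbTE hb]; last by rewrite eq_sym hb !(mulr0, mul0r).
  rewrite big1 ?addr0 => [|b /negbTE hb]; first by rewrite /=; ring.
  by apply: big1 => b' _; rewrite eq_sym hb !(mulr0, mul0r).
apply: ler_sum => a _; apply: ler_sum => a' _; apply: ler_sum => b _.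
apply: ler_sum => b' _; apply: ler_sum => w _; apply: ler_sum => w' _.
have K x y (v : wk) : cw (x, y) v <= 2%:R * n%:R * (wt x v * (fin x v == y)%:R).
  rewrite /cw /= mulrC; apply: ler_wpM2r; first by apply: mulr_ge0; [exact: wt_ge0 | exact: ler0n].
  by rewrite -[leRHS]invrK lef_pV2 ?posrE ?invr_gt0 ?mulr_gt0 ?ltr0n.
apply: ler_wpM2r; first exact: conf_ge0.
by apply: ler_pM; rewrite ?cw_ge0 ?K.
Qed.

Hypothesis small :
  144%:R * (l%:R / Dr) ^+ 2 / n%:R ^+ 2 * #|[set p : E * E | bad p.1 p.2]|%:R +
  6%:R * #|[set p : V * V | same p.1 p.2]|%:R / n%:R ^+ 2 < 1 :> F.

Definition cost (a b : {ffun 'I_3 -> V}) : F :=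
  \sum_(i < 3) \sum_(k < 3 | i != k) \sum_(j < 3) \sum_(m < 3 | j != m)
    eps (a i, b j) (a k, b m) +
  \sum_(j < 3) \sum_(m < 3 | j != m) (same (b j) (b m))%:R.

Lemma sum_neq3 (x : F) : \sum_(i < 3) \sum_(k < 3 | i != k) x = 6%:R * x.
Proof.
under eq_bigr => i _ do rewrite sumr_const.
have -> : \sum_(i < 3) x *+ #|[pred k | i != k]| = \sum_(i < 3) x *+ 2.
  apply: eq_bigr => i _; congr (_ *+ _).
  by rewrite -[RHS]/(3.-1) -[in RHS](card_ord 3) -(cardC1 i); apply: eq_card => k;
    rewrite !inE eq_sym.
rewrite sumr_const card_ord; ring.
Qed.

(** The average over the n^6 choices is at most the left side of [small]: the 6 * 6 = 36 ordered
    pairs of disjoint edges of K_{3,3} and the 4 of [sum_eps] make 144, and there are 6 ordered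
    pairs of branch vertices [b]. *)
Lemma cheap : exists a b, cost a b < 1.
Proof.
pose N : F := n%:R ^+ 6.
have np : 0 < n%:R :> F by rewrite ltr0n.
have nn0 : n%:R != 0 :> F by rewrite gt_eqF.
have cardf : #|{ffun 'I_3 -> V}|%:R = n%:R ^+ 3 :> F.
  by rewrite card_ffun card_ord natrX.
have T : \sum_a \sum_b cost a b < N.
  have -> : \sum_a \sum_b cost a b =
      36%:R * (n%:R ^+ 2 * \sum_a \sum_a' \sum_b \sum_b' eps (a, b) (a', b')) +
      6%:R * n%:R ^+ 4 * \sum_x \sum_y (same x y)%:R.
    under eq_bigr => a _ do rewrite big_split /=.
    rewrite big_split /=; congr (_ + _); last first.
      rewrite sumr_const -[LHS]mulr_natl cardf exchange_big /=.
      under eq_bigr => j _ do rewrite exchange_big /=.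
      transitivity (n%:R ^+ 3 * (\sum_(i < 3) \sum_(k < 3 | i != k)
         n%:R * \sum_x \sum_y (same x y)%:R) : F).
        congr (_ * _); apply: eq_bigr => i _; apply: eq_bigr => k ik.
        by rewrite (sum_ffun2 (fun x y => (same x y)%:R)).
      by rewrite sum_neq3; ring.
    transitivity (\sum_(i < 3) \sum_(k < 3 | i != k) \sum_(j < 3) \sum_(m < 3 | j != m)
       n%:R ^+ 2 * \sum_a \sum_a' \sum_b \sum_b' eps (a, b) (a', b')); last first.
      by rewrite 2!sum_neq3; ring.
    under eq_bigr => a _ do rewrite exchange_big /=.
    rewrite exchange_big; apply: eq_bigr => i _ /=.
    under eq_bigr => a _ do rewrite exchange_big /=.
    rewrite exchange_big; apply: eq_bigr => k ik /=.
    under eq_bigr => a _ do rewrite exchange_big /=.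
    rewrite exchange_big; apply: eq_bigr => j _ /=.
    under eq_bigr => a _ do rewrite exchange_big /=.
    rewrite exchange_big; apply: eq_bigr => m jm /=.
    under eq_bigr => a _ do
      rewrite (sum_ffun2 (fun y y' => eps (a i, y) (a k, y')) jm).
    rewrite -mulr_sumr.
    rewrite (sum_ffun2 (fun x x' => \sum_y \sum_y' eps (x, y) (x', y')) ik).
    by rewrite mulrA.
  have -> : \sum_x \sum_y (same x y)%:R = #|[set p : V * V | same p.1 p.2]|%:R :> F.
    rewrite pair_big /= -sum1_card natr_sum [RHS]big_mkcond /=; apply: eq_bigr => p _.
    by rewrite inE; case: same.
  have h := sum_eps; move: small.
  rewrite -(ltr_pM2r (exprn_gt0 6 np)) mul1r; apply: le_lt_trans.
  rewrite [leRHS]mulrDl; apply: lerD; last first.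
    by rewrite le_eqVlt; apply/orP; left; apply/eqP; field.
  apply: (@le_trans _ _ (36%:R * (n%:R ^+ 2 * (4%:R * n%:R ^+ 2 * (l%:R / Dr) ^+ 2 *
     #|[set p : E * E | bad p.1 p.2]|%:R)))).
    by rewrite ler_pM2l ?ltr0n // ler_pM2l ?exprn_gt0.
  move: (l%:R / Dr) => z.
  by rewrite le_eqVlt; apply/orP; left; apply/eqP; field.
have [ab hab|H] := pickP (fun ab : {ffun 'I_3 -> V} * {ffun 'I_3 -> V} => cost ab.1 ab.2 < 1).
  by exists ab.1, ab.2.
suff : N <= \sum_a \sum_b cost a b by rewrite leNgt T.
apply: (@le_trans _ _ (\sum_(a : {ffun 'I_3 -> V}) \sum_(b : {ffun 'I_3 -> V}) 1)).
  by rewrite !sumr_const -[leRHS]mulr_natr -[_ *+ _]mulr_natr mul1r cardf /N -exprD.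
apply: ler_sum => a _; apply: ler_sum => b _.
by have := H (a, b); rewrite /= ltNge => /negbFE.
Qed.

(** For branch vertices of cost below 1, nine independent conditioned walks have fewer than one bad
    pair on average. Some outcome of positive weight has none, and positive weight means that its
    words are genuine walks with the prescribed ends. *)
Theorem select_walks : exists (a b : 'I_3 -> V) (p : 'I_3 -> 'I_3 -> seq E),
  [/\ forall j m, j != m -> ~~ same (b j) (b m),
      forall i j (g : V -> bool),
        \big[addb/false]_(e <- p i j) (g (s e) (+) g (d e)) = g (a i) (+) g (b j) &
      forall i k j m e f, i != k -> j != m -> e \in p i j -> f \in p k m -> ~~ bad e f].
Proof.
have [a [b hab]] := cheap.
have eps0 ab ab' : 0 <= eps ab ab'.
  apply: sumr_ge0 => w _; apply: sumr_ge0 => w' _.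
  by apply: mulr_ge0; [apply: mulr_ge0; apply: cw_ge0 | apply: conf_ge0].
pose I := ('I_3 * 'I_3)%type.
pose w (ij : I) := cw (a ij.1, b ij.2).
pose W (f : {ffun I -> wk}) := \prod_ij w ij (f ij).
pose G (f : {ffun I -> wk}) := \sum_(i < 3) \sum_(k < 3 | i != k)
  \sum_(j < 3) \sum_(m < 3 | j != m) conf (f (i, j)) (f (k, m)).
have same0 : 0 <= \sum_(j < 3) \sum_(m < 3 | j != m) (same (b j) (b m))%:R :> F.
  by apply: sumr_ge0 => j _; apply: sumr_ge0 => m _; rewrite ler0n.
have [f Wf Gf] : exists2 f, 0 < W f & G f < 1.
  apply: average_lt1.
  - by move=> f; apply: prodr_ge0 => ij _; apply: cw_ge0.
  - rewrite -(bigA_distr_bigA w) big1 // => ij _; exact: sum_cw.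
  apply: le_lt_trans hab; rewrite /cost -[leLHS]addr0; apply: lerD => //.
  rewrite le_eqVlt; apply/orP; left; apply/eqP.
  under eq_bigr => f _ do rewrite big_distrr /=.
  rewrite exchange_big; apply: eq_bigr => i _ /=.
  under eq_bigr => f _ do rewrite big_distrr /=.
  rewrite exchange_big; apply: eq_bigr => k ik /=.
  under eq_bigr => f _ do rewrite big_distrr /=.
  rewrite exchange_big; apply: eq_bigr => j _ /=.
  under eq_bigr => f _ do rewrite big_distrr /=.
  rewrite exchange_big; apply: eq_bigr => m jm /=.
  rewrite (@sum_marginal2 _ I _ w (i, j) (k, m) (fun x y => conf x y)) //.
    by move=> ij; apply: sum_cw.
  by rewrite xpair_eqE negb_and ik.
exists a, b, (fun i j => wedges (f (i, j))); split.
- move=> j m jm; apply/negP => sjm; move: hab; rewrite ltNge => /negP; apply.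
  rewrite /cost; apply: ler_wpDl.
    do 4 (apply: sumr_ge0 => ? _); exact: eps0.
  rewrite (bigD1 j) //= (bigD1 m) //= sjm -addrA; apply: ler_wpDr => //.
  by apply: addr_ge0; [|apply: sumr_ge0 => ? _]; apply: sumr_ge0 => ? _; rewrite ler0n.
- move=> i j g; have : w (i, j) (f (i, j)) != 0.
    apply/eqP => w0; move: Wf; rewrite /W (bigD1 (i, j)) //= w0 mul0r ltxx //.
  rewrite /w /cw /= !mulf_eq0 !negb_or => /andP[/andP[wn0 hf] _].
  rewrite (walk_conn sd g wn0); congr (_ (+) g _).
  by apply/eqP; case: (fin _ _ == b j) hf => //=; rewrite eqxx.
- move=> i k j m e e' ik jm; apply: conf_lt1; apply: le_lt_trans Gf.
  rewrite /G (bigD1 i) //= (bigD1 k) //= (bigD1 j) //= (bigD1 m) //= -!addrA.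
  apply: ler_wpDr => //.
  by repeat first [exact: conf_ge0 | apply: addr_ge0 | apply: sumr_ge0 => ? _].
Qed.
End Select.

(** * Biclique-free graphs *)

Section KST.
Local Open Scope nat_scope.

Lemma cross_power_le a b t : a * b ^ t + b * a ^ t <= a ^ t.+1 + b ^ t.+1.
Proof.
wlog ab : a b / a <= b => [H|].
  case: (leqP a b) => [/H //|/ltnW /H]; by rewrite addnC [X in _ <= X]addnC.
have h : a ^ t <= b ^ t by case: t => // t; rewrite leq_exp2r.
rewrite !expnS; move: (a ^ t) (b ^ t) h => x y h.
rewrite -(subnKC ab) -(subnKC h); move: (b - a) (y - x) => c e; nia.
Qed.

(** The inductive step is Chebyshev's sum inequality, symmetrized into [cross_power_le]. *)
Lemma power_mean (I : finType) (d : I -> nat) t :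
  (\sum_i d i) ^ t.+1 <= #|I| ^ t * \sum_i d i ^ t.+1.
Proof.
elim: t => [|t IH].
  by rewrite expn1 mul1n; under [X in _ <= X]eq_bigr => i _ do rewrite expn1.
rewrite expnS; apply: leq_trans (leq_mul (leqnn _) IH) _.
rewrite mulnCA expnSr -mulnA leq_mul2l; apply/orP; right.
rewrite -(leq_pmul2l (isT : 0 < 2)) mul2n -addnn.
apply: (@leq_trans (\sum_i \sum_j (d i ^ t.+2 + d j ^ t.+2))); last first.
  rewrite eq_leq // mul2n -addnn.
  under eq_bigr => i _ do rewrite big_split /= sum_nat_const.
  by rewrite big_split /= sum_nat_const -big_distrr /=.
apply: (@leq_trans (\sum_i \sum_j (d i * d j ^ t.+1 + d j * d i ^ t.+1))); last first.
  by apply: leq_sum => i _; apply: leq_sum => j _; apply: cross_power_le.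
rewrite eq_leq //; under [RHS]eq_bigr => i _ do rewrite big_split /=.
rewrite big_split /= [X in _ = _ + X]exchange_big /=.
have -> : \sum_i \sum_j d i * d j ^ t.+1 = (\sum_i d i) * \sum_i d i ^ t.+1.
  by rewrite big_distrl; apply: eq_bigr => i _; rewrite big_distrr.
by [].
Qed.

Lemma expn_ffact M t : M ^ t <= M ^_ t + t ^ 2 * M ^ t.-1.
Proof.
elim: t => [|t IH]; first by rewrite ffactn0.
have h : M * M ^_ t <= M ^_ t.+1 + t * M ^ t.
  rewrite ffactnSr [M ^_ t * _]mulnC.
  have : M ^_ t <= M ^ t.
    elim: t {IH} => [|t IH]; first by rewrite ffactn0.
    by rewrite ffactnSr expnSr; apply: leq_mul IH (leq_subr _ _).
  move: (M ^_ t) (M ^ t) => x y xy.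
  case: (leqP t M) => tM; last by nia.
  rewrite -{1}(subnK tM); nia.
rewrite expnS; apply: leq_trans (leq_mul (leqnn M) IH) _; rewrite mulnDr.
case: t h {IH} => [|t] h; first by rewrite mul0n muln0 addn0 (leq_trans h) // addnC leq_addr.
have -> : M * (t.+1 ^ 2 * M ^ t.+1.-1) = t.+1 ^ 2 * M ^ t.+1 by rewrite [M ^ t.+1]expnS /=; lia.
apply: leq_trans (leq_add h (leqnn _)) _.
rewrite [t.+2.-1]/=; move: (M ^_ t.+2) (M ^ t.+1) => y z; nia.
Qed.

(** The Kovari-Sos-Turan count of pairs of a t-tuple and a common neighbour. An injective tuple has
    at most t common neighbours, and by [expn_ffact] there are at most t^2 |E|^(t-1) other tuples.
    [power_mean] passes from degrees to their powers. *)
Lemma biclique_free_count (E : finType) (T : rel E) t : 0 < t ->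
  (forall A B : 'I_t -> E, injective A -> injective B -> exists i j, ~~ T (A i) (B j)) ->
  #|[set p : E * E | T p.1 p.2]| ^ t <= (t + t ^ 2) * #|E| ^ (2 * t).-1.
Proof.
move=> t0 H; pose d f := #|[set e | T e f]|.
have -> : #|[set p : E * E | T p.1 p.2]| = \sum_f d f.
  transitivity (\sum_e \sum_f nat_of_bool (T e f)).
    rewrite pair_big /= -sum1_card big_mkcond; apply: eq_bigr => p _.
    by rewrite inE; case: (T _ _).
  rewrite exchange_big /=; apply: eq_bigr => f _.
  rewrite /d -sum1_card [RHS]big_mkcond /=; apply: eq_bigr => e _.
  by rewrite inE; case: (T _ _).
case: t t0 H => // t _ H; apply: leq_trans (power_mean _ _) _.
have -> : (2 * t.+1).-1 = t + t.+1 by lia.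
rewrite expnD [_ * (_ * _)]mulnCA leq_mul2l; apply/orP; right.
pose S (u : {ffun 'I_t.+1 -> E}) := [set f | [forall i, T (u i) f]].
have -> : \sum_f d f ^ t.+1 = \sum_u #|S u|.
  transitivity (\sum_f \sum_(u : {ffun 'I_t.+1 -> E}) (f \in S u)).
    apply: eq_bigr => f _; rewrite -{1}(card_ord t.+1) /d -card_ffun_on -sum1_card big_mkcond.
    apply: eq_bigr => u _; rewrite [f \in S u]inE.
    rewrite [X in if X then _ else _](_ : _ = [forall i, T (u i) f]).
      by case: [forall i, T (u i) f].
    by apply/ffun_onP/forallP => h i; have := h i; rewrite ?inE.
  rewrite exchange_big; apply: eq_bigr => u _ /=.
  by rewrite -sum1_card [RHS]big_mkcond; apply: eq_bigr => f _; case: (_ \in _).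
have cF : #|{ffun 'I_t.+1 -> E}| = #|E| ^ t.+1 by rewrite card_ffun card_ord.
rewrite (bigID (fun u : {ffun 'I_t.+1 -> E} => injectiveb u)) /= mulnDl; apply: leq_add.
  apply: (@leq_trans (\sum_(u : {ffun 'I_t.+1 -> E} | injectiveb u) t.+1)).
    apply: leq_sum => u /injectiveP inj; rewrite leqNgt; apply/negP => lt.
    have [B [injB hB]] : exists B : 'I_t.+1 -> E, injective B /\ forall i, B i \in S u.
      exists (fun i => enum_val (widen_ord (ltnW lt) i)); split => [i j|i].
        by move/enum_val_inj => /(congr1 val) /= /val_inj.
      exact: enum_valP.
    have [i [j]] := H u B inj injB.
    by have := hB j; rewrite inE => /forallP /(_ i) ->.
  rewrite sum_nat_const mulnC leq_mul2l; apply/orP; right.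
  by rewrite -cF; apply: max_card.
apply: (@leq_trans (\sum_(u : {ffun 'I_t.+1 -> E} | ~~ injectiveb u) #|E|)).
  by apply: leq_sum => u _; apply: max_card.
rewrite sum_nat_const.
have c1 : #|[pred u : {ffun 'I_t.+1 -> E} | injectiveb u]| = #|E| ^_ t.+1.
  by rewrite -cardsE card_inj_ffuns card_ord.
have := cardC [pred u : {ffun 'I_t.+1 -> E} | injectiveb u].
rewrite c1 cF => h.
have := expn_ffact #|E| t.+1; rewrite -h leq_add2l => /(leq_mul (leqnn #|E|)).
rewrite mulnC => /leq_trans; apply; rewrite mulnCA -expnS. by rewrite h.
Qed.
End KST.

(** * Choice of the expansion rate and of the walk length *)

Section Growth.
Local Open Scope ring_scope.
Variable F : archiRealFieldType.
Implicit Types x y : F.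

Lemma bernoulli_le x n : -1 <= x -> 1 + n%:R * x <= (1 + x) ^+ n.
Proof.
move=> x1; elim: n => [|n IH]; first by rewrite mul0r addr0.
have h : 0 <= 1 + x by lra.
rewrite exprS; apply: le_trans (ler_wpM2l h IH).
have : 0 <= n%:R * x ^+ 2 by rewrite mulr_ge0 ?sqr_ge0 ?ler0n.
by rewrite -natr1; move: (n%:R : F) => m; nra.
Qed.

Lemma exp_dominates_poly (A : F) s : exists k0, forall k, (k0 <= k)%N ->
  A * (k.+2)%:R ^+ s < (4%:R / 3%:R) ^+ k.
Proof.
(* The plan is 4/3 = (7/6)(8/7). This x gives (1 + x)^s <= 7/6 while k + 2 is at most a constant
   times (1 + x)^k, so the polynomial stays below a constant times (7/6)^k and (8/7)^k beats the
   constant. *)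
pose x : F := (7 * s + 7)%:R^-1.
have x0 : 0 < x by rewrite invr_gt0 ltr0n; lia.
have x1 : x <= 1 by rewrite invf_le1 ?ler1n ?ltr0n; lia.
have sx : s%:R * x <= 7%:R^-1.
  rewrite /x ler_pdivrMr ?ltr0n; last lia.
  rewrite natrD natrM mulrDr mulKf ?pnatr_eq0 // lerDl; lra.
have y1 : (1 + x) ^+ s <= 7%:R / 6%:R.
  have h1 : 6%:R / 7%:R <= (1 - x) ^+ s.
    have := @bernoulli_le (- x) s; rewrite mulrN; lra.
  have h2 : (1 + x) ^+ s * (1 - x) ^+ s <= 1.
    by rewrite -exprMn; apply: exprn_ile1; nra.
  have h3 : 0 <= (1 + x) ^+ s by apply: exprn_ge0; lra.
  nra.
pose C : F := 2%:R / x.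
have kC k : (k.+2)%:R <= C * (1 + x) ^+ k.
  have h : 1 + k%:R * x <= (1 + x) ^+ k by apply: bernoulli_le; lra.
  apply: le_trans (ler_wpM2l _ h); last by rewrite /C divr_ge0 ?ltW ?ltr0n.
  have -> : C * (1 + k%:R * x) = 2%:R / x + 2%:R * k%:R.
    by rewrite /C; field; rewrite gt_eqF.
  have : 2%:R <= 2%:R / x by rewrite ler_pdivlMr //; nra.
  have : 0 <= k%:R :> F by rewrite ler0n.
  by rewrite -[k.+2]addn2 [(k + 2)%:R]natrD; move: (k%:R : F) (2%:R / x) => m z; lra.
have C0 : 0 <= C by rewrite /C divr_ge0 ?ltW ?ltr0n.
pose B := `|A| * C ^+ s.
have B0 : 0 <= B by rewrite mulr_ge0 ?exprn_ge0.
exists (Num.truncn (7%:R * B)).+1 => k hk.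
apply: (@le_lt_trans _ _ (B * (7%:R / 6%:R) ^+ k)).
  apply: (@le_trans _ _ (`|A| * (k.+2)%:R ^+ s)).
    by apply: ler_wpM2r; rewrite ?exprn_ge0 ?ler0n ?ler_norm.
  rewrite /B -mulrA; apply: ler_wpM2l => //.
  apply: (@le_trans _ _ ((C * (1 + x) ^+ k) ^+ s)).
    apply: lerXn2r (kC k); rewrite nnegrE ?ler0n //.
    by apply: mulr_ge0 => //; apply: exprn_ge0; lra.
  rewrite exprMn; apply: ler_wpM2l; first exact: exprn_ge0.
  rewrite exprAC; apply: lerXn2r y1; rewrite nnegrE; last lra.
  by apply: exprn_ge0; lra.
have -> : 4%:R / 3%:R = (7%:R / 6%:R) * (8%:R / 7%:R) :> F by lra.
rewrite [ltRHS]exprMn [ltLHS]mulrC ltr_pM2l ?exprn_gt0 //; last lra.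
have h : 1 + k%:R * 7%:R^-1 <= (1 + 7%:R^-1 : F) ^+ k by apply: bernoulli_le; lra.
have -> : 8%:R / 7%:R = 1 + 7%:R^-1 :> F by lra.
apply: lt_le_trans h.
have : 7%:R * B < k%:R.
  by apply: (@lt_le_trans _ _ (Num.truncn (7%:R * B)).+1%:R); rewrite ?ler_nat ?truncnS_gt.
clear hk; clearbody B; move: (k%:R : F) => m; lra.
Qed.

(** Mixing on about 2^k vertices takes a length l of order k / phi^2. A large Q lets phi decay so
    slowly in k that l^(2t) still grows more slowly than 2^k. *)
Lemma parameters t : (0 < t)%N -> exists Q k0 : nat, (1 < Q)%N /\
  forall k, (k0 <= k)%N -> exists l : nat,
    let phi := (1 - Q%:R^-1) ^+ k / (16 * Q)%:R : F in
    4%:R * (2 ^ k.+1)%:R ^+ 2 * (1 - phi ^+ 2 / 4%:R) ^+ l <= 1 /\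
    ((1152 * l ^ 2) ^ t * (t + t ^ 2) < 2 ^ k)%N.
Proof.
move=> t0.
have e1 j : (2 * j + 4 = 2 + (j.+1 * 2))%N by lia.
have e2 j : (2 * j + 4 = 2 * j.+2)%N by lia.
have e3 j : (4 * t * j = j * 2 * 2 * t)%N by lia.
have e4 : (12 * t = 3 * (4 * t))%N by lia.
(* Then th^(4t) >= 1 - 4t/Q = 2/3, which leaves 2 * 2/3 = 4/3 as the base to be compared with a
   polynomial in k. *)
pose Q := (12 * t)%N.
have Q0 : (0 < Q)%N by rewrite muln_gt0.
pose W : F := (16 * Q)%:R.
pose A : F := (1152%:R * (16%:R * W ^+ 2) ^+ 2) ^+ t * (t + t ^ 2)%:R.
have [k0 hk0] := exp_dominates_poly A (2 * t).
exists Q, k0; split; first by rewrite /Q; lia.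
move=> k /hk0 hk; clear k0 hk0.
set th : F := 1 - Q%:R^-1.
have Qi : 0 < Q%:R^-1 :> F by rewrite invr_gt0 ltr0n.
have Qi1 : Q%:R^-1 <= 12%:R^-1 :> F.
  by rewrite lef_pV2 ?posrE ?ltr0n // ler_nat /Q; lia.
have th0 : 0 < th by rewrite /th; lra.
have th1 : th < 1 by rewrite /th; lra.
set phi : F := th ^+ k / (16 * Q)%:R.
have Qr : 0 < (16 * Q)%:R :> F by rewrite ltr0n; lia.
have phi0 : 0 < phi by rewrite divr_gt0 ?exprn_gt0.
have phi1 : phi <= 1.
  rewrite ler_pdivrMr // mul1r; apply: (@le_trans _ _ 1).
    by apply: exprn_ile1; rewrite ltW.
  by rewrite ler1n; lia.
set x := phi ^+ 2 / 4%:R.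
have x0 : 0 < x by rewrite divr_gt0 ?exprn_gt0 ?ltr0n.
have x1 : x <= 1 by rewrite /x; nra.
pose q := (Num.truncn x^-1).+1.
have q1 : x^-1 < q%:R by apply: truncnS_gt.
have q2 : q%:R <= 2%:R / x.
  have xi : 1 <= x^-1 by rewrite invf_ge1.
  have : (Num.truncn x^-1)%:R <= x^-1 by rewrite truncn_le // ltW // invr_gt0.
  by rewrite /q -natr1; lra.
have half : (1 - x) ^+ q <= 2%:R^-1.
  have h1 : 2%:R <= (1 + x) ^+ q.
    apply: le_trans (bernoulli_le q _); last lra.
    have : 1 <= q%:R * x by rewrite -ler_pdivrMr // mul1r ltW.
    lra.
  have h2 : (1 - x) ^+ q * (1 + x) ^+ q <= 1.
    by rewrite -exprMn; apply: exprn_ile1; nra.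
  have h3 : 0 <= (1 - x) ^+ q by apply: exprn_ge0; lra.
  nra.
(* Every q steps at least halve the deviation, and 2k + 4 halvings absorb the factor 4 (2^(k+1))^2 =
   2^(2k+4). *)
exists (q * (2 * k + 4))%N => /=; rewrite -/phi -/x; split.
  have -> : 4%:R * (2 ^ k.+1)%:R ^+ 2 = 2%:R ^+ (2 * k + 4) :> F.
    by rewrite e1 natrX -exprM exprD; congr (_ * _); ring.
  rewrite exprM -exprMn; apply: exprn_ile1.
    by rewrite mulr_ge0 ?ler0n ?exprn_ge0 //; lra.
  lra.
rewrite -(ltr_nat F).
set l := (q * _)%N.
pose L : F := 16%:R * W ^+ 2 * (k.+2)%:R * (th ^+ k) ^- 2.
have hl : l%:R <= L.
  have -> : L = (2%:R / x) * (2 * k + 4)%:R.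
    rewrite e2 natrM /L /x /phi -/W.
    move: (k.+2%:R : F) => m; field.
    have ? : 0 < th ^+ k by apply: exprn_gt0.
    by rewrite pnatr_eq0 -lt0n Q0 gt_eqF.
  by rewrite /l natrM; apply: ler_wpM2r.
have L0 : 0 <= L.
  by rewrite /L !mulr_ge0 ?invr_ge0 ?sqr_ge0 ?ler0n.
apply: (@le_lt_trans _ _ ((1152%:R * L ^+ 2) ^+ t * (t + t ^ 2)%:R)).
  have -> : ((1152 * l ^ 2) ^ t * (t + t ^ 2))%:R =
      (1152%:R * l%:R ^+ 2) ^+ t * (t + t ^ 2)%:R :> F.
    rewrite natrM; congr (_ * _); rewrite natrX; congr (_ ^+ _).
    by rewrite natrM; congr (_ * _); rewrite natrX.
  apply: ler_wpM2r; first exact: ler0n.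
  have nn (y : F) : 1152%:R * y ^+ 2 \is Num.nneg.
    by rewrite nnegrE; apply: mulr_ge0; [exact: ler0n | exact: sqr_ge0].
  apply: lerXn2r (nn _) (nn _) _; rewrite ler_pM2l ?ltr0n //.
  by apply: lerXn2r hl; rewrite nnegrE ?ler0n.
have -> : (1152%:R * L ^+ 2) ^+ t * (t + t ^ 2)%:R =
    A * (k.+2)%:R ^+ (2 * t) * (th ^+ (4 * t)) ^- k.
  have -> : (th ^+ (4 * t)) ^- k = (((th ^+ k) ^- 2) ^+ 2) ^+ t.
    by rewrite -exprM e3 !exprM !exprVn.
  have R4 (a b c m : F) : a ^+ t * m * b ^+ t * c ^+ t = (a * b * c) ^+ t * m.
    by rewrite !exprMn; ring.
  rewrite [k.+2%:R ^+ _]exprM /A R4; congr (_ ^+ _ * _).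
  rewrite /L; move: (1152%:R : F) (k.+2%:R : F) ((th ^+ k) ^- 2) => c m z; ring.
have h4 : 2%:R / 3%:R <= th ^+ (4 * t).
  have h0 : -1 <= - Q%:R^-1 :> F by clear -Qi1; lra.
  have := bernoulli_le (4 * t) h0; rewrite -/th mulrN; apply: le_trans.
  have -> : (4 * t)%:R * Q%:R^-1 = 3%:R^-1 :> F.
    by rewrite /Q e4 [(3 * _)%:R]natrM invfM mulrCA mulfV ?mulr1 // pnatr_eq0 -lt0n muln_gt0.
  lra.
have h5 : 0 < th ^+ (4 * t) by apply: exprn_gt0.
rewrite ltr_pdivrMr ?exprn_gt0 //.
apply: (lt_le_trans hk).
rewrite natrX -exprMn; apply: lerXn2r; rewrite ?nnegrE; lra.
Qed.
End Growth.

(** * Dense graphs contain subdivisions with few clashes *)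

Definition biclique_free (E : finType) (T : rel E) (t : nat) :=
  forall A B : 'I_t -> E, injective A -> injective B -> exists i j, ~~ T (A i) (B j).

Definition inside (V E : finType) (s d : E -> V) (Y : {set V}) :=
  [set e | (s e \in Y) && (d e \in Y)].

Lemma clash_arith c z b tt e n D : (b <= tt + 2 * (e * D) -> e <= n * D ->
  2 * (c * z) * tt < (n * D) ^ 2 -> 4 * (c * z) < n -> 0 < D ->
  2 * (c * z * b) < 2 * (n * D) ^ 2)%N.
Proof.
move: (c * z)%N => y h1 h2 h3 h4 D0.
have h5 : (2 * (y * b) <= 2 * y * tt + 2 * y * (2 * (e * D)))%N.
  by rewrite -mulnDr -mulnA !leq_mul2l h1 !orbT.
apply: (leq_ltn_trans h5); rewrite [leqRHS]mul2n -addnn -addSn; apply: leq_add => //.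
apply: (@leq_trans (4 * y * (n * D * D))).
  have : (e * D <= n * D * D)%N by rewrite leq_mul2r h2 orbT.
  by move=> uv; rewrite mulnACA -[4 * y * _]mulnA; do 2 apply: leq_mul => //.
have -> : ((n * D) ^ 2 = n * (n * D * D))%N by rewrite -mulnn; nia.
by rewrite leq_mul2r ltnW ?orbT.
Qed.

Lemma clash_cast (F : realFieldType) (c l b n D : nat) : (0 < n)%N -> (0 < D)%N ->
  (2 * (c * l ^ 2 * b) < (n * D) ^ 2)%N ->
  (c%:R * (l%:R / D%:R) ^+ 2 / n%:R ^+ 2 * b%:R < 2%:R^-1 :> F)%R.
Proof.
move=> n0 D0; rewrite -(ltr_nat F).
have -> : ((2 * (c * l ^ 2 * b))%:R = 2%:R * (c%:R * l%:R ^+ 2 * b%:R) :> F)%R.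
  by rewrite natrM; congr (_ * _)%R; rewrite natrM; congr (_ * _)%R; rewrite natrM natrX.
rewrite [((n * D) ^ 2)%:R%R]natrX natrM => h.
have n0' : (0 < n%:R :> F)%R by rewrite ltr0n.
have D0' : (0 < D%:R :> F)%R by rewrite ltr0n.
have -> : (c%:R * (l%:R / D%:R) ^+ 2 / n%:R ^+ 2 * b%:R =
  (c%:R * l%:R ^+ 2 * b%:R) / (n%:R * D%:R) ^+ 2 :> F)%R.
  by field; rewrite !gt_eqF.
rewrite ltr_pdivrMr ?exprn_gt0 ?mulr_gt0 //.
by move: h; move: (_ * b%:R)%R ((n%:R * D%:R) ^+ 2)%R => u v; lra.
Qed.

Lemma half_arith (F : realFieldType) (a b c : F) :
  (a <= 2%:R * b -> 24%:R * c < a -> 6%:R * c < 2%:R^-1 * b)%R.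
Proof. lra. Qed.

Lemma card_sum_bool (I : finType) (P : pred I) : #|[set i | P i]| = \sum_i P i.
Proof. by rewrite -sum1_card big_mkcond; apply: eq_bigr => i _; rewrite inE; case: (P i). Qed.

Section Critical.
Local Open Scope ring_scope.
Variables (F : archiRealFieldType) (V E : finType) (s d : E -> V) (D : nat) (Q : nat).
Hypothesis D0 : (0 < D)%N.
Hypothesis Q1 : (1 < Q)%N.
Hypothesis sd : forall e, s e != d e.
Hypothesis degD : forall x, (deg s d x <= D)%N.
Let Dr : F := D%:R.
Let th : F := 1 - Q%:R^-1.

(* Linear in [m], with a slowly decaying correction that makes splitting costly. *)
Definition threshold (m : nat) : F :=
  Dr / 8%:R * m%:R - Dr / 16%:R * m%:R * th ^+ (trunc_log 2 m).

Let n := #|V|.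
Let k := trunc_log 2 n.
Hypothesis n0 : (0 < n)%N.
Hypothesis dense : threshold n <= #|E|%:R.
Hypothesis critical : forall Y : {set V}, Y != set0 -> Y != setT ->
  #|inside s d Y|%:R < threshold #|Y|.

Let Dr0 : 0 < Dr. Proof. by rewrite ltr0n. Qed.
Let Qi : 0 < Q%:R^-1 :> F. Proof. by rewrite invr_gt0 ltr0n (ltn_trans _ Q1). Qed.
Let th0 : 0 < th.
Proof. by rewrite subr_gt0 invf_lt1 ?ltr1n // ltr0n (ltn_trans _ Q1). Qed.
Let th1 : th <= 1. Proof. by rewrite gerBl ltW. Qed.

Lemma inside_split (Y : {set V}) :
  (#|E| = #|inside s d Y| + #|inside s d (~: Y)| + #|cut s d Y|)%N.
Proof.
rewrite /inside /cut !card_sum_bool -!big_split /= -sum1_card big_mkcond /=.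
apply: eq_bigr => e _; rewrite !inE.
by case: (s e \in Y); case: (d e \in Y).
Qed.

Lemma trunc_log_le a b : (a <= b)%N -> (trunc_log 2 a <= trunc_log 2 b)%N.
Proof. exact: leq_trunc_log. Qed.

Lemma th_le i j : (i <= j)%N -> th ^+ j <= th ^+ i.
Proof. by move=> ij; apply: ler_wiXn2l => //; rewrite ltW. Qed.

(** The smaller part has at most half of the vertices, so its logarithm is below k and its
    correction factor exceeds th^k by at least th^k / Q. The larger part loses nothing. *)
Lemma threshold_split a b : (0 < a)%N -> (a <= b)%N -> (a + b = n)%N ->
  th ^+ k / (16 * Q)%:R * Dr * a%:R <= threshold n - threshold a - threshold b.
Proof.
move=> a0 ab abn.
have la : (trunc_log 2 a < k)%N.
  rewrite /k -(@trunc_log2_double a) //; apply: trunc_log_le; lia.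
have lb : th ^+ k <= th ^+ trunc_log 2 b by apply: th_le; apply: trunc_log_le; lia.
have {la} la : th ^+ k.-1 <= th ^+ trunc_log 2 a by apply: th_le; lia.
have lk : th ^+ k + Q%:R^-1 * th ^+ k <= th ^+ k.-1.
  have [k1|k1] : (k = 0%N \/ exists k', k = k'.+1) by case: (k) => [|k']; [left | right; exists k'].
    exfalso; move: abn; have := trunc_log_ltn n (isT : (1 < 2)%N); rewrite -/k k1; lia.
  case: k1 => k' ->; rewrite [k'.+1.-1]/= exprS.
  have : 0 <= th ^+ k' by apply: exprn_ge0; rewrite ltW.
  have -> : Q%:R^-1 = 1 - th by rewrite /th opprB addrC subrK.
  move=> x0; rewrite -subr_ge0.
  have -> : th ^+ k' - (th * th ^+ k' + (1 - th) * (th * th ^+ k')) =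
    th ^+ k' * (1 - th) ^+ 2 by ring.
  by rewrite mulr_ge0 ?sqr_ge0.
have -> : th ^+ k / (16 * Q)%:R * Dr * a%:R = Dr / 16%:R * a%:R * (Q%:R^-1 * th ^+ k).
  by rewrite natrM; field; rewrite pnatr_eq0; lia.
rewrite /threshold -/k -abn natrD.
have a0' : 0 <= a%:R :> F by rewrite ler0n.
have b0' : 0 <= b%:R :> F by rewrite ler0n.
have h1 : Dr / 16%:R * b%:R * th ^+ k <= Dr / 16%:R * b%:R * th ^+ trunc_log 2 b.
  by apply: ler_wpM2l => //; rewrite mulr_ge0 // divr_ge0 ?ler0n // ltW.
have h2 : Dr / 16%:R * a%:R * (th ^+ k + Q%:R^-1 * th ^+ k) <=
          Dr / 16%:R * a%:R * th ^+ trunc_log 2 a.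
  by apply: ler_wpM2l (le_trans lk la); rewrite mulr_ge0 // divr_ge0 ?ler0n // ltW.
move: h1 h2; rewrite mulrDr.
move: (th ^+ k) (th ^+ _) (th ^+ _) (Q%:R^-1 * _) (Dr / 16%:R) (a%:R : F) (b%:R : F).
have -> : Dr / 8%:R = Dr / 16%:R + Dr / 16%:R by field.
by move=> x y z w c u v h1 h2; nra.
Qed.

(** Y and its complement both span fewer edges than their thresholds while the whole graph reaches
    its own. The cut has to make up the difference computed in [threshold_split]. *)
Lemma critical_expand (Y : {set V}) : (2 * #|Y| <= #|V|)%N ->
  th ^+ k / (16 * Q)%:R * Dr * #|Y|%:R <= #|cut s d Y|%:R.
Proof.
move=> hY; have [->|Y0] := eqVneq Y set0; first by rewrite cards0 mulr0 ler0n.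
have a0 : (0 < #|Y|)%N by rewrite card_gt0.
have cY : (#|Y| + #|~: Y| = n)%N by rewrite cardsC.
have ab : (#|Y| <= #|~: Y|)%N by move: cY hY; rewrite -/n; lia.
have YT : Y != setT by apply/eqP => E1; move: hY; rewrite E1 cardsT -/n; lia.
have CT : ~: Y != setT by apply: contra Y0 => /eqP E1; rewrite -[Y]setCK E1 setCT.
have C0 : ~: Y != set0 by apply: contra YT => /eqP E1; rewrite -[Y]setCK E1 setC0.
apply: le_trans (threshold_split a0 ab cY) _.
have c1 := critical Y0 YT; have c2 := critical C0 CT.
have := dense; rewrite (inside_split Y) !natrD.
move: (threshold n) (threshold #|Y|) (threshold #|~: Y|) c1 c2.
move: (#|inside s d Y|%:R : F) (#|inside s d (~: Y)|%:R : F) (#|cut s d Y|%:R : F).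
by move=> *; lra.
Qed.

(** Deleting [x] lowers the threshold by at least D/16, and the rest must fall below it. *)
Lemma critical_deg x : Dr / 16%:R <= (deg s d x)%:R.
Proof.
have E1 : (#|E| <= #|inside s d (~: [set x])| + deg s d x)%N.
  rewrite /deg; apply: leq_trans (leq_card_setU _ _).
  rewrite -cardsT; apply: subset_leq_card; apply/subsetP => e _.
  by rewrite !inE /inc; case: (s e == x); case: (d e == x).
have cx : #|~: [set x]| = n.-1 by rewrite cardsC1.
have [n1|n1] : n = 1%N \/ (1 < n)%N by move: n0; case: (n) => [|[|?]]; [|left|right].
  have E0 : #|E| = 0%N.
    apply/eqP; rewrite -leqn0 leqNgt; apply/negP => /card_gt0P[e _].
    have : (#|[set s e; d e]| <= n)%N by apply: max_card.
    by rewrite cards2 sd n1.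
  move: dense; rewrite E0 /threshold n1 (_ : trunc_log 2 1 = 0%N) //.
  rewrite expr0 !mulr1 => h; exfalso; move: Dr0 h; lra.
have C0 : ~: [set x] != set0 by rewrite -card_gt0 cx; lia.
have CT : ~: [set x] != setT.
  by apply/eqP => /setP/(_ x); rewrite !inE eqxx.
have := critical C0 CT; rewrite cx => c.
have h : Dr / 16%:R <= threshold n - threshold n.-1.
  rewrite /threshold -/k.
  have lb : th ^+ k <= th ^+ trunc_log 2 n.-1 by apply: th_le; apply: trunc_log_le; lia.
  have tk : th ^+ k <= 1 by apply: exprn_ile1; rewrite // ltW.
  have n1' : 0 <= n.-1%:R :> F by rewrite ler0n.
  have -> : n%:R = n.-1%:R + 1 :> F by rewrite natr1 prednK.
  have h1 : Dr / 16%:R * n.-1%:R * th ^+ k <= Dr / 16%:R * n.-1%:R * th ^+ trunc_log 2 n.-1.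
    by apply: ler_wpM2l => //; rewrite mulr_ge0 // divr_ge0 ?ler0n // ltW.
  have h2 : Dr / 16%:R * th ^+ k <= Dr / 16%:R * 1.
    by apply: ler_wpM2l => //; rewrite divr_ge0 ?ler0n // ltW.
  move: h1 h2; have -> : Dr / 8%:R = Dr / 16%:R + Dr / 16%:R by field.
  move: (th ^+ k) (th ^+ _) (Dr / 16%:R) (n.-1%:R : F) => x1 y1 c1 u1 h1 h2; nra.
have := dense; move: E1; rewrite -(ler_nat F) natrD => E1.
move: h c E1; move: (threshold n) (threshold n.-1) (Dr / 16%:R) => x1 y1 z1.
move: (#|E|%:R : F) (#|inside _ _ _|%:R : F) ((deg s d x)%:R : F) => *; lra.
Qed.

Variables (O : eqType) (orig : V -> O).
Hypothesis orig_s : forall e f, orig (s e) = orig (s f) -> d e = d f -> e = f.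
Hypothesis orig_d : forall e f, orig (d e) = orig (d f) -> s e = s f -> e = f.

(** Each copy has degree at least D/16, whereas an edge at a copy is determined by its other end and
    by which of its two ends is the copy. So the copies of one vertex carry at most 2n edges. *)
Lemma copies_bound x : D%:R / 16%:R * #|[set y | orig y == orig x]|%:R <= 2%:R * n%:R :> F.
Proof.
set S := [set y | _].
have hs : (#|[set e | orig (s e) == orig x]| <= n)%N.
  rewrite -(@card_in_imset _ _ d) ?max_card // => e f; rewrite !inE => /eqP he /eqP hf.
  by apply: orig_s; rewrite he.
have hd : (#|[set e | orig (d e) == orig x]| <= n)%N.
  rewrite -(@card_in_imset _ _ s) ?max_card // => e f; rewrite !inE => /eqP he /eqP hf.
  by apply: orig_d; rewrite he.
have <- : \sum_(y in S) Dr / 16%:R = Dr / 16%:R * #|S|%:R.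
  by rewrite sumr_const mulr_natr.
apply: (@le_trans _ _ (\sum_(y in S) (deg s d y)%:R)).
  by apply: ler_sum => y _; apply: critical_deg.
have -> : \sum_(y in S) (deg s d y)%:R = \sum_y \sum_(e | inc s d e y) (y \in S)%:R :> F.
  rewrite big_mkcond /=; apply: eq_bigr => y _; rewrite sumr_const /deg cardsE.
  by case: (y \in S); rewrite ?mul0rn.
rewrite (sum_inc sd (fun _ y => (y \in S)%:R)) big_split /= -!natr_sum.
have -> : (\sum_e (s e \in S) = #|[set e | orig (s e) == orig x]|)%N.
  by rewrite card_sum_bool; apply: eq_bigr => e _; rewrite inE.
have -> : (\sum_e (d e \in S) = #|[set e | orig (d e) == orig x]|)%N.
  by rewrite card_sum_bool; apply: eq_bigr => e _; rewrite inE.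
by rewrite mulr_natl mulr2n; apply: lerD; rewrite ler_nat.
Qed.

Variables (T : rel E) (t : nat).
Hypothesis t0 : (0 < t)%N.
Hypothesis Tfree : biclique_free T t.
Variable k0 : nat.
Hypothesis params : forall k, (k0 <= k)%N -> exists l : nat,
    let phi := th ^+ k / (16 * Q)%:R : F in
    4%:R * (2 ^ k.+1)%:R ^+ 2 * (1 - phi ^+ 2 / 4%:R) ^+ l <= 1 /\
    ((1152 * l ^ 2) ^ t * (t + t ^ 2) < 2 ^ k)%N.
Hypothesis Dbig : (384 + 32 * 2 ^ k0 < D)%N.

Definition clash : rel E := fun e f => [|| T e f, s e == s f | d e == d f].

Lemma same_end_count (u : E -> V) : (forall x, #|[set e | u e == x]| <= D)%N ->
  (#|[set p : E * E | u p.1 == u p.2]| <= #|E| * D)%N.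
Proof.
move=> h; apply: (@leq_trans (\sum_(e : E) D)); last by rewrite sum_nat_const.
have -> : #|[set p : E * E | u p.1 == u p.2]| = (\sum_e #|[set f | u f == u e]|)%N.
  transitivity (\sum_e \sum_f (u e == u f))%N.
    rewrite pair_big /= -sum1_card big_mkcond; apply: eq_bigr => p _.
    by rewrite inE; case: (_ == _).
  apply: eq_bigr => e _; rewrite -sum1_card [RHS]big_mkcond; apply: eq_bigr => f _.
  by rewrite inE eq_sym; case: (_ == _).
by apply: leq_sum => e _.
Qed.

Lemma edges_le : (#|E| <= n * D)%N.
Proof.
apply: (@leq_trans (\sum_x deg s d x)); last first.
  by rewrite -sum_nat_const; apply: leq_sum => x _.
have -> : (\sum_x deg s d x = \sum_x \sum_(e | inc s d e x) 1)%N.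
  by apply: eq_bigr => y _; rewrite /deg -sum1_card; apply: eq_bigl => e; rewrite inE.
rewrite (exchange_big_dep predT) //= -sum1_card; apply: leq_sum => e _.
by rewrite (bigD1 (s e)) //= /inc eqxx.
Qed.

Lemma clash_count :
  (#|[set p : E * E | clash p.1 p.2]| <=
   #|[set p : E * E | T p.1 p.2]| + 2 * (#|E| * D))%N.
Proof.
have hs x : (#|[set e | s e == x]| <= D)%N.
  apply: leq_trans (degD x); apply: subset_leq_card; apply/subsetP => e.
  by rewrite !inE /inc => ->.
have hd x : (#|[set e | d e == x]| <= D)%N.
  apply: leq_trans (degD x); apply: subset_leq_card; apply/subsetP => e.
  by rewrite !inE /inc => ->; rewrite orbT.
rewrite mul2n -addnn; apply: leq_trans (leq_add (leqnn _)
  (leq_add (same_end_count hs) (same_end_count hd))).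
apply: leq_trans (leq_add (leqnn _) (leq_card_setU _ _)).
apply: leq_trans (leq_card_setU _ _); apply: subset_leq_card.
by apply/subsetP => p; rewrite !inE.
Qed.

(** Expansion and the length from [params] make the walks mix. It remains to see that both terms of
    the hypothesis [small] of [select_walks] are below 1/2. *)
Theorem critical_select : exists (a b : 'I_3 -> V) (p : 'I_3 -> 'I_3 -> seq E),
  [/\ forall j m, j != m -> orig (b j) != orig (b m),
      forall i j (g : V -> bool),
        \big[addb/false]_(e <- p i j) (g (s e) (+) g (d e)) = g (a i) (+) g (b j) &
      forall i k j m e f, i != k -> j != m -> e \in p i j -> f \in p k m -> ~~ clash e f].
Proof.
have [x0 _] : exists x : V, x \in V by case/card_gt0P: n0 => x; exists x.
(* One copy in [copies_bound] already gives D/16 <= 2n, so a large D forces n, and with it k, to be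
   large. *)
have nD : (D <= 32 * n)%N.
  have := copies_bound x0; set S := [set y | _].
  have S1 : (1 <= #|S|)%N by rewrite card_gt0; apply/set0Pn; exists x0; rewrite inE.
  move=> h; rewrite -(ler_nat F) natrM.
  have : Dr / 16%:R <= Dr / 16%:R * #|S|%:R.
    by rewrite ler_peMr ?divr_ge0 ?ler0n ?ler1n // ltW.
  move: h; rewrite -/Dr; move: (Dr / 16%:R * #|S|%:R) => z; lra.
have k0k : (k0 <= k)%N.
  by apply: trunc_log_max => //; move: nD Dbig; move: (2 ^ k0)%N => *; lia.
have [l [hl1 hl2]] := params k0k.
have [k1 k2] : (2 ^ k <= n)%N /\ (n < 2 ^ k.+1)%N.
  by split; [apply: trunc_logP | apply: trunc_log_ltn].
set phi : F := th ^+ k / (16 * Q)%:R in hl1.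
have Qr : 1 <= (16 * Q)%:R :> F by rewrite ler1n; lia.
have phi0 : 0 < phi by rewrite divr_gt0 ?exprn_gt0 // (lt_le_trans _ Qr).
have phi1 : phi <= 1.
  rewrite ler_pdivrMr ?(lt_le_trans _ Qr) // mul1r; apply: le_trans Qr.
  by apply: exprn_ile1; rewrite // ltW.
have p4 : phi ^+ 2 / 4%:R <= 1.
  have : phi ^+ 2 <= 1 by apply: exprn_ile1; rewrite // ltW.
  lra.
have np : 0 < n%:R :> F by rewrite ltr0n.
have low x y : (2%:R * n%:R)^-1 <= @pr F V E s d D l x y.
  apply: (pr_lower D0 sd degD phi0 critical_expand (erefl n) n0 p4).
  apply: le_trans hl1; apply: ler_wpM2r; first by apply: exprn_ge0; rewrite subr_ge0.
  rewrite ler_pM2l ?ltr0n //; apply: lerXn2r; rewrite ?nnegrE ?ler0n //.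
  by rewrite ler_nat ltnW.
have small : 144%:R * (l%:R / D%:R) ^+ 2 / n%:R ^+ 2 * #|[set p : E * E | clash p.1 p.2]|%:R +
  6%:R * #|[set p : V * V | orig p.1 == orig p.2]|%:R / n%:R ^+ 2 < 1 :> F.
  have l2n : (1152 * l ^ 2 < n)%N.
    apply: leq_trans k1; apply: leq_ltn_trans hl2.
    have [->|l0] := posnP l; first by rewrite exp0n // muln0.
    have X0 : (0 < 1152 * l ^ 2)%N by rewrite muln_gt0 expn_gt0 l0.
    apply: (@leq_trans ((1152 * l ^ 2) ^ t)); first by rewrite -{1}[(_ * _)%N]expn1 leq_pexp2l.
    by apply: leq_pmulr; rewrite addn_gt0 t0.
  (* Otherwise [biclique_free_count] and |E| <= n D would give n D <= (1152 l^2)^t (t + t^2) < 2^k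
     <= n. *)
  have hT : (2 * (288 * l ^ 2) * #|[set p : E * E | T p.1 p.2]| < (n * D) ^ 2)%N.
    rewrite ltnNge; apply/negP => h.
    have nD0 : (0 < n * D)%N by rewrite muln_gt0 n0.
    have := leq_trans k1 (leq_pmulr n D0); apply/negP; rewrite -ltnNge.
    apply: leq_ltn_trans hl2.
    rewrite -(@leq_pmul2r ((n * D) ^ (2 * t).-1)) ?expn_gt0 ?nD0 //.
    rewrite -expnS prednK ?muln_gt0 // expnM.
    apply: (@leq_trans ((2 * (288 * l ^ 2) * #|[set p : E * E | T p.1 p.2]|) ^ t)).
      by rewrite leq_exp2r.
    rewrite expnMn -mulnA; apply: leq_mul.
      by rewrite leq_exp2r // mulnA; apply: leq_mul.
    apply: leq_trans (biclique_free_count t0 Tfree) _.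
    rewrite leq_mul2l; apply/orP; right.
    have [->|t1] := posnP (2 * t).-1; first by [].
    by rewrite leq_exp2r // edges_le.
  have l2n' : (4 * (288 * l ^ 2) < n)%N by apply: leq_ltn_trans l2n; rewrite mulnA; apply: leq_mul.
  have hB := clash_arith clash_count edges_le hT l2n' D0.
  have hB' : (2 * (144 * l ^ 2 * #|[set p : E * E | clash p.1 p.2]|) < (n * D) ^ 2)%N.
    rewrite -(ltn_pmul2l (isT : 0 < 2)%N); apply: leq_ltn_trans hB.
    rewrite -!mulnA leq_mul2l; apply/orP; right.
    by rewrite !mulnA; do 2 (apply: leq_mul => //).
  have hC := @clash_cast F _ _ _ _ _ n0 D0 hB'.
  have hS : 6%:R * #|[set p : V * V | orig p.1 == orig p.2]|%:R / n%:R ^+ 2 < 2%:R^-1 :> F.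
    set nu := (#|_|%:R : F).
    have hnu : D%:R / 16%:R * nu <= n%:R * (2%:R * n%:R) :> F.
      have -> : nu = \sum_x #|[set y | orig y == orig x]|%:R.
        rewrite /nu card_sum_bool natr_sum -(pair_big xpredT xpredT
          (fun x y => (orig x == orig y)%:R)) /=; apply: eq_bigr => x _.
        by rewrite card_sum_bool natr_sum; apply: eq_bigr => y _; rewrite eq_sym.
      rewrite big_distrr /=; apply: (@le_trans _ _ (\sum_(x : V) 2%:R * n%:R)).
        by apply: ler_sum => x _; apply: copies_bound.
      by rewrite sumr_const [leRHS]mulr_natl.
    have Db : 384%:R < D%:R :> F by rewrite ltr_nat (leq_ltn_trans _ Dbig) // leq_addr.
    rewrite ltr_pdivrMr ?exprn_gt0 //.
    have nu0 : 0 <= nu by rewrite ler0n.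
    have n2 : 0 < n%:R ^+ 2 :> F by rewrite exprn_gt0.
    have n22 : n%:R * (2%:R * n%:R) = 2%:R * n%:R ^+ 2 :> F by ring.
    rewrite n22 in hnu.
    have [->|nup] := eqVneq nu 0; first by rewrite mulr0 mulr_gt0 // invr_gt0 ltr0n.
    have {}nu0 : 0 < nu by rewrite lt_neqAle eq_sym nup.
    have D24 : 24%:R < D%:R / 16%:R :> F.
      by rewrite ltr_pdivlMr ?ltr0n // -natrM.
    have : 24%:R * nu < D%:R / 16%:R * nu by rewrite ltr_pM2r.
    exact: half_arith hnu.
  move: hC hS; rewrite -!mulrA; move: (144%:R * _) (6%:R * _) => u v; lra.
have [a [b [p [h1 h2 h3]]]] :=
  @select_walks F V E s d D D0 sd degD l n0 low clash (fun x y => orig x == orig y) small.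
by exists a, b, p.
Qed.

End Critical.

(** The whole vertex set reaches the threshold because of D |V| <= 8 |E|. A smallest nonempty set
    that does is critical, and [critical_select] applies to the subgraph it induces. *)
Theorem dense_select t : 0 < t -> exists c0 : nat,
  forall (V E : finType) (s d : E -> V) (D : nat) (O : eqType) (orig : V -> O) (T : rel E),
  (forall x, deg s d x <= D) ->
  (forall e f, orig (s e) != orig (d f)) ->
  (forall e f, orig (s e) = orig (s f) -> d e = d f -> e = f) ->
  (forall e f, orig (d e) = orig (d f) -> s e = s f -> e = f) ->
  biclique_free T t -> c0 <= D -> 0 < #|V| -> D * #|V| <= 8 * #|E| ->
  exists (a b : 'I_3 -> V) (p : 'I_3 -> 'I_3 -> seq E),
  [/\ forall j m, j != m -> orig (b j) != orig (b m),
      forall i j (g : V -> bool),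
        \big[addb/false]_(e <- p i j) (g (s e) (+) g (d e)) = g (a i) (+) g (b j) &
      forall i k j m e f, i != k -> j != m -> e \in p i j -> f \in p k m ->
        ~~ clash s d T e f].
Proof.
move=> t0; have [Q [k0 [Q1 params]]] := @parameters rat t t0.
exists (385 + 32 * 2 ^ k0) => V E s d D O orig T degD origE orig_s orig_d Tfree c0D V0 dens.
have D0 : 0 < D by apply: leq_trans c0D; rewrite addn_gt0.
have sd e : s e != d e by apply: contraNneq (origE e e) => ->.
pose thr := @threshold rat D Q.
pose P X := (X != set0) && (thr #|X| <= #|inside s d X|%:R)%R.
have PT : P setT.
  rewrite /P -card_gt0 cardsT V0 /=.
  have -> : #|inside s d setT| = #|E|.
    by rewrite -cardsT; apply: eq_card => e; rewrite !inE.
  apply: (@le_trans _ _ (D%:R / 8%:R * #|V|%:R)%R).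
    rewrite /thr /threshold gerBl; apply: mulr_ge0.
      by apply: mulr_ge0; [apply: divr_ge0|]; apply: ler0n.
    by apply: exprn_ge0; rewrite subr_ge0 invf_le1 ?ler1n ?ltr0n // ltnW // ltnW.
  rewrite mulrAC ler_pdivrMr ?ltr0n // -!natrM ler_nat [X in _ <= X]mulnC //.
case: (arg_minnP (fun X : {set V} => #|X|) PT) => X /andP[X0 denseX] minX.
pose V' : finType := {x : V | x \in X}; pose E' : finType := {e : E | e \in inside s d X}.
have sX (e : E') : s (val e) \in X by have := valP e; rewrite inE => /andP[].
have dX (e : E') : d (val e) \in X by have := valP e; rewrite inE => /andP[].
pose s' (e : E') : V' := Sub (s (val e)) (sX e).
pose d' (e : E') : V' := Sub (d (val e)) (dX e).
pose orig' (x : V') := orig (val x).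
have cV : #|V'| = #|X| by rewrite card_sig; apply: eq_card => x; rewrite !inE.
have cE : #|E'| = #|inside s d X| by rewrite card_sig; apply: eq_card => x; rewrite !inE.
have n0 : 0 < #|V'| by rewrite cV card_gt0.
have sd' e : s' e != d' e by rewrite -val_eqE /= sd.
have degD' x : deg s' d' x <= D.
  apply: leq_trans (degD (val x)); rewrite /deg -(card_imset _ val_inj).
  apply: subset_leq_card; apply/subsetP => e /imsetP[e' He ->].
  by move: He; rewrite !inE /inc -!val_eqE /=.
have dense' : (threshold rat D Q #|V'| <= #|E'|%:R)%R by rewrite cV cE.
have crit' (Y : {set V'}) : Y != set0 -> Y != setT ->
    (#|inside s' d' Y|%:R < threshold rat D Q #|Y|)%R.
  move=> Y0 YT; pose Z := [set val y | y in Y].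
  have cZ : #|Z| = #|Y| by rewrite card_imset //; apply: val_inj.
  have iZ : #|inside s d Z| = #|inside s' d' Y|.
    rewrite -(card_imset _ val_inj); apply: eq_card => e; apply/idP/imsetP.
      rewrite inE => /andP[/imsetP[y yY sy] /imsetP[z zY dz]].
      have eX : e \in inside s d X by rewrite inE sy dz (valP y) (valP z).
      exists (Sub e eX : E') => //; rewrite inE.
      have -> : s' (Sub e eX) = y by apply: val_inj.
      have -> : d' (Sub e eX) = z by apply: val_inj.
      by rewrite yY.
    case=> e'; rewrite !inE => /andP[h1 h2] ->.
    apply/andP; split; first by apply/imsetP; exists (s' e').
    by apply/imsetP; exists (d' e').
  rewrite ltNge; apply/negP => h; have : P Z.
    by rewrite /P -card_gt0 iZ cZ card_gt0 Y0.
  move/minX; rewrite cZ leqNgt => /negP; apply.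
  by rewrite -cV -cardsT proper_card // properE subsetT /= subTset.
have orig_s' e f : orig' (s' e) = orig' (s' f) -> d' e = d' f -> e = f.
  by move=> h /(congr1 val) /= k; apply: val_inj; apply: orig_s.
have orig_d' e f : orig' (d' e) = orig' (d' f) -> s' e = s' f -> e = f.
  by move=> h /(congr1 val) /= k; apply: val_inj; apply: orig_d.
pose T' : rel E' := fun e f => T (val e) (val f).
have Tfree' : biclique_free T' t.
  move=> A B iA iB.
  by apply: (Tfree (val \o A) (val \o B)); apply: inj_comp => //; apply: val_inj.
have Dbig : 384 + 32 * 2 ^ k0 < D by [].
have [a [b [p [h1 h2 h3]]]] := critical_select D0 Q1 sd' degD' n0 dense' crit'
  orig_s' orig_d' t0 Tfree' params Dbig.
exists (fun i => val (a i)), (fun j => val (b j)), (fun i j => [seq val e | e <- p i j]).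
split=> [j m /h1 //|i j g|i k j m _ _ ik jm /mapP[e ep ->] /mapP[f fp ->]].
  by rewrite big_map; have := h2 i j (fun x => g (val x)).
by have := h3 i k j m e f ik jm ep fp; rewrite /clash /T' -!val_eqE /=.
Qed.

(** * Polygonal systems *)

Lemma pigeonhole3 (t : nat) (C : finType) (f : 'I_t -> C) : 2 * #|C| < t ->
  exists j : 'I_3 -> 'I_t, injective j /\ forall x y, f (j x) = f (j y).
Proof.
move=> h; have [c hc] : exists c, 2 < #|[set i | f i == c]|.
  apply/existsP; apply: contraLR h => /existsPn h; rewrite -leqNgt.
  rewrite -{1}(card_ord t) -sum1_card (partition_big f predT) //=.
  rewrite mulnC -sum_nat_const; apply: leq_sum => c _.
  have := h c; rewrite -leqNgt; apply: leq_trans; rewrite sum1_card.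
  by apply: subset_leq_card; apply/subsetP => i; rewrite !inE.
exists (fun x => enum_val (widen_ord hc x)); split.
  by move=> x y /enum_val_inj /(congr1 val) /= /val_inj.
have H x : f (enum_val (widen_ord hc x)) = c.
  by have := enum_valP (widen_ord hc x); rewrite inE => /eqP.
by move=> x y; rewrite !H.
Qed.

Section Discrete.
Local Open Scope ring_scope.
Variables (R : realFieldType) (V E : finType).
Notation pt := (R * R)%type.
Variables (al be : E -> V) (pos : V -> pt) (N W : nat) (q : E -> nat -> pt)
  (kk : E -> E -> nat).

Definition ra e := (pos (al e), q e 0%N).
Definition rb e := (q e N, pos (be e)).
Definition sg e k := (q e k, q e k.+1).
(** The ends may come in either order, as orientation is irrelevant mod 2. *)
Definition piece e k l := [seq sg e i | i <- iota (minn k l) (maxn k l - minn k l)].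
Definition chn e : chain R := ra e :: rb e :: piece e 0 N.
Definition jump e f := (q e (kk e f), q f (kk f e)).
Definition indep e f := (al e != al f) && (be e != be f).
Definition near (k m : nat) := (k <= m + W)%N && (m <= k + W)%N.

(** What remains of the arcs after sampling. Two middle polygons come together only if the edges are
    independent, and then only within [W] samples of [kk e f] on one and of [kk f e] on the other.
    These windows are far apart along each edge and far from its ends. A [jump] bridges the two
    windows of a pair and meets no third edge. Radii at a common vertex and on the same side of it
    are not collinear. *)
Record system := System {
  sysW : (0 < W)%N;
  sys_pos : injective pos;
  sys_bip : forall e f, al e != be f;
  sys_inj : forall e f, al e = al f -> be e = be f -> e = f;
  sys_mid : forall e f k l, e != f -> (k < N)%N -> (l < N)%N ->
    ~~ [&& indep e f, near k (kk e f) & near l (kk f e)] -> sdisj (sg e k) (sg f l);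
  sys_ra : forall e f l, e != f -> (l < N)%N -> sdisj (ra e) (sg f l);
  sys_rb : forall e f l, e != f -> (l < N)%N -> sdisj (rb e) (sg f l);
  sys_raa : forall e f, al e != al f -> sdisj (ra e) (ra f);
  sys_rbb : forall e f, be e != be f -> sdisj (rb e) (rb f);
  sys_rab : forall e f, e != f -> sdisj (ra e) (rb f);
  sys_pos_mid : forall e k v, (k < N)%N -> ~ on_seg (sg e k) (pos v);
  sys_pos_ra : forall e v, on_seg (ra e) (pos v) -> v = al e;
  sys_pos_rb : forall e v, on_seg (rb e) (pos v) -> v = be e;
  sys_gap : forall e f g, indep e f -> indep e g -> f != g ->
    (kk e f + 6 * W < kk e g)%N \/ (kk e g + 6 * W < kk e f)%N;
  sys_lo : forall e f, indep e f -> (3 * W < kk e f)%N;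
  sys_hi : forall e f, indep e f -> (kk e f + 3 * W < N)%N;
  sys_jump : forall e f g l, indep e f -> g != e -> g != f -> (l < N)%N ->
    sdisj (jump e f) (sg g l);
  sys_jumps : forall e f g h, indep e f -> indep g h -> g != e -> g != f -> h != e -> h != f ->
    sdisj (jump e f) (jump g h);
  sys_al : forall e f, e != f -> al e = al f ->
    lexlt (pos (al e)) (q e 0%N) = lexlt (pos (al f)) (q f 0%N) ->
    orient (pos (al e)) (q e 0%N) (q f 0%N) != 0;
  sys_be : forall e f, e != f -> be e = be f ->
    lexlt (pos (be e)) (q e N) = lexlt (pos (be f)) (q f N) ->
    orient (pos (be e)) (q e N) (q f N) != 0;
  sys_al0 : forall e, q e 0%N != pos (al e);
  sys_be0 : forall e, q e N != pos (be e) }.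

Hypothesis S : system.

Lemma indepC e f : indep e f = indep f e.
Proof. by rewrite /indep ![al e == _]eq_sym ![be e == _]eq_sym. Qed.

Lemma indep_neq e f : indep e f -> e != f.
Proof. by move=> /andP[h _]; apply: contraNneq h => ->. Qed.

Lemma conn_nil (p : pt) : conn [::] p p.
Proof. by move=> g; rewrite xsum_nil addbb. Qed.

Lemma conn_iota e m n : conn [seq sg e i | i <- iota m n] (q e m) (q e (m + n)).
Proof.
elim: n m => [|n IH] m; first by rewrite addn0; apply: conn_nil.
by rewrite addnS -addSn; apply: (conn_cat (conn1 _ _) (IH m.+1)).
Qed.

Lemma conn_piece e k l : conn (piece e k l) (q e k) (q e l).
Proof.
rewrite /piece; case: (leqP k l) => [kl|/ltnW kl].
  by rewrite -{2}(subnKC kl); apply: conn_iota.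
by apply: conn_sym; rewrite -{2}(subnKC kl); apply: conn_iota.
Qed.

Lemma mem_piece e k l s : s \in piece e k l ->
  exists2 i, (minn k l <= i < maxn k l)%N & s = sg e i.
Proof.
case/mapP => i; rewrite mem_iota subnKC; last by rewrite geq_min leq_max leqnn.
by exists i.
Qed.

Lemma conn_chn e : conn (chn e) (pos (al e)) (pos (be e)).
Proof.
move=> g; rewrite /chn !xsum_cons (conn_piece e 0 N) /=.
by case: (g (pos (al e))); case: (g (q e 0%N)); case: (g (q e N)); case: (g (pos (be e))).
Qed.

Lemma xsum_iota_sub m n (g : nat -> bool) : (m <= n)%N -> (n <= N)%N ->
  xsum (iota m (n - m)) g = xsum (iota 0 N) (fun i => (m <= i < n)%N && g i).
Proof.
move=> mn nN.
have -> : iota 0 N = iota 0 m ++ iota m (n - m) ++ iota n (N - n).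
  by rewrite -{2}(subnKC mn) -iotaD -{2}[m]add0n -iotaD; congr iota; lia.
rewrite !xsum_cat [X in X (+) _]xsum_false => [|i]; last first.
  by rewrite mem_iota; move=> h; rewrite (_ : (m <= i)%N = false) //; lia.
rewrite [X in _ = _ (+) (_ (+) X)]xsum_false => [|i]; last first.
  by rewrite mem_iota; move=> h; rewrite (_ : (i < n)%N = false) ?andbF //; lia.
rewrite addbF; apply: eq_in_xsum => i; rewrite mem_iota => h.
by rewrite (_ : (m <= i < n)%N) //; lia.
Qed.

Lemma xsum_piece e k l (g : (pt * pt) -> bool) : (k <= N)%N -> (l <= N)%N ->
  xsum (piece e k l) g =
  xsum (iota 0 N) (fun i => (minn k l <= i < maxn k l)%N && g (sg e i)).
Proof.
move=> kN lN; rewrite /piece -xsum_iota_sub; first by rewrite /xsum big_map.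
  by rewrite geq_min leq_max leqnn.
by rewrite geq_max kN.
Qed.

Definition inb (k l m : nat) := (minn k l <= m < maxn k l)%N.
Definition away (x m : nat) := (x + W < m)%N || (m + W < x)%N.

Lemma away_inb k l m i : away k m -> away l m -> near i m -> inb k l i = inb k l m.
Proof. rewrite /away /near /inb; lia. Qed.

(* Two pieces whose ends stay away from the meeting place either contain it both, *)
(* and then have the crossing parity of the whole edges, or do not cross. *)
Lemma II_piece e f k l k' l' : e != f -> (k <= N)%N -> (l <= N)%N -> (k' <= N)%N -> (l' <= N)%N ->
  (indep e f -> [&& away k (kk e f), away l (kk e f), away k' (kk f e) & away l' (kk f e)]) ->
  II (piece e k l) (piece f k' l') =
  [&& indep e f, inb k l (kk e f), inb k' l' (kk f e) & II (piece e 0 N) (piece f 0 N)].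
Proof.
move=> ef kN lN kN' lN' aw; rewrite /II !xsum_piece // min0n max0n.
have ->: [&& indep e f, inb k l (kk e f), inb k' l' (kk f e) &
   xsum (iota 0 N) (fun i => (0 <= i < N)%N && xsum (piece f 0 N) (scross (sg e i)))] =
  xsum (iota 0 N) (fun i => xsum (iota 0 N) (fun j =>
    [&& indep e f, inb k l (kk e f), inb k' l' (kk f e) & scross (sg e i) (sg f j)])).
  case: (indep e f) => /=; last by rewrite xsum_false // => i _; apply: xsum_false.
  case: (inb _ _ _) => /=; last by rewrite xsum_false // => i _; apply: xsum_false.
  case: (inb _ _ _) => /=; last by rewrite xsum_false // => i _; apply: xsum_false.
  apply: eq_in_xsum => i; rewrite mem_iota add0n /= => -> /=.
  rewrite xsum_piece // min0n max0n; apply: eq_in_xsum => j.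
  by rewrite mem_iota add0n /= => ->.
apply: eq_in_xsum => i; rewrite mem_iota add0n /= => iN.
rewrite -/(inb k l i) xsum_piece //.
transitivity (xsum (iota 0 N) (fun j => inb k l i && (inb k' l' j && scross (sg e i) (sg f j)))).
  case: (inb k l i) => //=; by rewrite xsum_false.
apply: eq_in_xsum => j; rewrite mem_iota add0n /= => jN.
have [/and3P[ief ni nj]|h] := boolP [&& indep e f, near i (kk e f) & near j (kk f e)].
  rewrite ief /=; have /and4P[a1 a2 a3 a4] := aw ief.
  by rewrite (away_inb a1 a2 ni) (away_inb a3 a4 nj).
by rewrite (scross_disj (sys_mid S ef iN jN h)) !andbF.
Qed.

Lemma mem_piece0 e s : s \in piece e 0 N -> exists2 i, (i < N)%N & s = sg e i.
Proof. by case/mem_piece => i; rewrite min0n max0n /= => iN ->; exists i. Qed.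

Lemma II_chn e f : indep e f -> II (chn e) (chn f) = II (piece e 0 N) (piece f 0 N).
Proof.
move=> ief; have ef := indep_neq ief; have fe : f != e by rewrite eq_sym.
have /andP[ale bee] := ief.
have Z s d : (forall u, u \in d -> sdisj s u) -> II [:: s] d = false.
  by move=> h; apply: II_disj => x u; rewrite inE => /eqP ->; apply: h.
rewrite -[chn e]/([:: ra e] ++ [:: rb e] ++ piece e 0 N) !II_cat1.
rewrite [II [:: ra e] _]Z ?[II [:: rb e] _]Z => [|u|u]; last first.
- rewrite !inE => /orP[/eqP ->|/orP[/eqP ->|/mem_piece0[i iN ->]]].
  + exact: sys_raa S _ _ ale.
  + exact: sys_rab S _ _ ef.
  + exact: sys_ra S _ _ _ ef iN.
- rewrite !inE => /orP[/eqP ->|/orP[/eqP ->|/mem_piece0[i iN ->]]].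
  + by apply: sdisjC; apply: sys_rab S _ _ fe.
  + exact: sys_rbb S _ _ bee.
  + exact: sys_rb S _ _ _ ef iN.
rewrite /= -[chn f]/([:: ra f; rb f] ++ piece f 0 N) II_cat2.
rewrite [X in X (+) _]II_disj // => s u /mem_piece0[i iN ->].
rewrite !inE => /orP[|] /eqP ->; apply: sdisjC.
  exact: sys_ra S _ _ _ fe iN.
exact: sys_rb S _ _ _ fe iN.
Qed.

Lemma pos_off e v s : v != al e -> v != be e -> s \in chn e -> ~ on_seg s (pos v).
Proof.
move=> va vb; rewrite !inE => /orP[/eqP ->|/orP[/eqP ->|/mem_piece0[i iN ->]]].
- by move/(sys_pos_ra S) => h; rewrite h eqxx in va.
- by move/(sys_pos_rb S) => h; rewrite h eqxx in vb.
- exact: sys_pos_mid S _ _ _ iN.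
Qed.

Lemma II_chnC e f : indep e f -> II (chn e) (chn f) = II (chn f) (chn e).
Proof.
move=> /andP[ae bf]; have B := sys_bip S; have P := sys_pos S.
apply: (II_sym (conn_chn e) (conn_chn f)); rewrite ?(inj_eq P) //.
- by move=> s; apply: pos_off; rewrite // eq_sym.
- by move=> s; apply: pos_off; rewrite // eq_sym.
- by move=> s; apply: pos_off.
- by move=> s; apply: pos_off => //; rewrite eq_sym.
- by rewrite eq_sym.
Qed.

(** Parity replaces the geometric notion: an even pair of independent edges counts as tangent. *)
Definition tangent : rel E := fun e f => indep e f && ~~ II (chn e) (chn f).

(** * Drawing K_{3,3} along three plus three mutually even edges *)

Section ThreeByThree.
Variables (a b : 'I_3 -> E).
Hypothesis ia : injective a.
Hypothesis ib : injective b.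
Hypothesis Tab : forall i j, tangent (a i) (b j).
Hypothesis side_a : forall i i' j j', indep (a i) (a i') ->
  (kk (a i) (a i') < kk (a i) (b j))%N = (kk (a i) (a i') < kk (a i) (b j'))%N.
Hypothesis side_b : forall j j' i i', indep (b j) (b j') ->
  (kk (b j) (b j') < kk (b j) (a i))%N = (kk (b j) (b j') < kk (b j) (a i'))%N.

Let iab i j : indep (a i) (b j). Proof. by have /andP[] := Tab i j. Qed.
Let iba i j : indep (b j) (a i). Proof. by rewrite indepC. Qed.
Let nab i j : a i != b j. Proof. exact: indep_neq (iab i j). Qed.
Let nba i j : b j != a i. Proof. by rewrite eq_sym. Qed.

Definition kmin (e : E) (f : 'I_3 -> E) := kk e (f [arg min_(j < ord0) kk e (f j)]).

Lemma kmin_le e f j : (kmin e f <= kk e (f j))%N.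
Proof. by rewrite /kmin; case: arg_minnP => // i _; apply. Qed.

Lemma kmin_ex e f : exists j, kmin e f = kk e (f j).
Proof. by rewrite /kmin; eexists. Qed.

(** Just before the first meeting with the family [f]: outside the window of that meeting and, by
    the gap of 6W, of every other one. The subtraction does not truncate, by [sys_lo]. *)
Definition start e f := (kmin e f - 2 * W)%N.

Lemma start_away e f g : (forall j, indep e (f j)) -> indep e g -> (forall j, g != f j) ->
  away (start e f) (kk e g).
Proof.
move=> ief ieg gf; have [j ej] := kmin_ex e f.
have := sys_gap S ieg (ief j) (gf j); have := sys_lo S (ief j); have := sysW S.
rewrite /start ej /away; lia.
Qed.

Lemma start_away_self e f j : (forall j, indep e (f j)) -> injective f ->
  away (start e f) (kk e (f j)).
Proof.
move=> ief injf; have := kmin_le e f j; have := sysW S; have := sys_lo S (ief j).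
have [j' ej] := kmin_ex e f; have := sys_lo S (ief j').
rewrite /start /away ej; lia.
Qed.

Lemma kk_away e f g : indep e f -> indep e g -> f != g -> away (kk e f) (kk e g).
Proof. move=> h h' fg; have := sys_gap S h h' fg; have := sysW S; rewrite /away; lia. Qed.

Lemma kk_le e f : indep e f -> (kk e f <= N)%N.
Proof. by move=> h; have := sys_hi S h; lia. Qed.

Lemma start_lt e f : (forall j, indep e (f j)) -> (start e f < N)%N.
Proof.
move=> ief; have [j ej] := kmin_ex e f; have := sys_hi S (ief j); have := sysW S.
rewrite /start ej; lia.
Qed.

(* The three meeting places lie on one side of [m], so no piece reaches [m]. *)
Lemma start_out e f g j : (forall j, indep e (f j)) -> indep e g -> (forall j, g != f j) ->
  (forall j j', (kk e g < kk e (f j))%N = (kk e g < kk e (f j'))%N) ->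
  inb (start e f) (kk e (f j)) (kk e g) = false.
Proof.
move=> ief ieg gf side; have [j' ej] := kmin_ex e f.
have := sys_gap S ieg (ief j') (gf j'); have := sys_gap S ieg (ief j) (gf j).
have := side j j'; have := kmin_le e f j; have := sysW S.
rewrite /start /inb ej; case: ltnP; case: ltnP => //; lia.
Qed.

Definition pa i := start (a i) b.
Definition pb j := start (b j) a.
Definition ch i j : chain R :=
  piece (a i) (pa i) (kk (a i) (b j)) ++ [:: jump (a i) (b j)] ++
  piece (b j) (kk (b j) (a i)) (pb j).

Lemma II_single2 (c : chain R) u : (forall s, s \in c -> sdisj s u) -> II c [:: u] = false.
Proof. by move=> h; apply: II_disj => s v sc; rewrite inE => /eqP ->; apply: h. Qed.

Lemma II_single1 (c : chain R) u : (forall s, s \in c -> sdisj u s) -> II [:: u] c = false.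
Proof. by move=> h; apply: II_disj => s v; rewrite inE => /eqP -> sc; apply: h. Qed.

Lemma piece_lt e k l s : (k <= N)%N -> (l <= N)%N -> s \in piece e k l ->
  exists2 i, (i < N)%N & s = sg e i.
Proof.
move=> kN lN /mem_piece[i /andP[_ h] ->]; exists i => //.
by apply: leq_trans h _; rewrite geq_max kN.
Qed.

(** Two pieces in the same family miss their mutual window by [start_out]. Pieces from different
    families may contain the common window, but there the whole pair is even. Jumps meet nothing
    else. *)
Lemma ch_meet i k j l : i != k -> j != l -> II (ch i j) (ch k l) = false.
Proof.
move=> ik jl.
have aik : a i != a k by rewrite (inj_eq ia).
have bjl : b j != b l by rewrite (inj_eq ib).
have paN i' : (pa i' <= N)%N by apply/ltnW/start_lt.
have pbN j' : (pb j' <= N)%N by apply/ltnW/start_lt.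
have Na i' j' : (kk (a i') (b j') <= N)%N by apply: kk_le.
have Nb i' j' : (kk (b j') (a i') <= N)%N by apply: kk_le.
have even i' j' : II (piece (a i') 0 N) (piece (b j') 0 N) = false.
  by rewrite -II_chn //; have /andP[_ /negbTE] := Tab i' j'.
have even' i' j' : II (piece (b j') 0 N) (piece (a i') 0 N) = false.
  by rewrite -II_chn // II_chnC //; have /andP[_ /negbTE] := Tab i' j'.
have F1 : II (piece (a i) (pa i) (kk (a i) (b j))) (piece (a k) (pa k) (kk (a k) (b l))) = false.
  rewrite (II_piece aik) //; last first.
    by move=> iaik; rewrite !start_away ?kk_away // 1?indepC.
  have [iaik|] //= := boolP (indep _ _).
  by rewrite start_out // => *; apply: side_a.
have F2 : II (piece (b j) (kk (b j) (a i)) (pb j)) (piece (b l) (kk (b l) (a k)) (pb l)) = false.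
  rewrite (II_piece bjl) //; last first.
    by move=> ibjl; rewrite !start_away ?kk_away // 1?indepC.
  have [ibjl|] //= := boolP (indep _ _).
  by rewrite /inb minnC maxnC -/(inb _ _ _) start_out // => *; apply: side_b.
have F3 : II (piece (a i) (pa i) (kk (a i) (b j))) (piece (b l) (kk (b l) (a k)) (pb l)) = false.
  rewrite (II_piece (nab i l)) ?even ?andbF // => _.
  by rewrite !start_away_self ?kk_away // eq_sym.
have F4 : II (piece (b j) (kk (b j) (a i)) (pb j)) (piece (a k) (pa k) (kk (a k) (b l))) = false.
  rewrite (II_piece (nba k j)) ?even' ?andbF // => _.
  by rewrite !start_away_self ?kk_away // eq_sym.
rewrite /ch !II_cat1 !II_cat2 F1 F2 F3 F4.
rewrite !II_single2 ?II_single1 //.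
- by move=> s /(piece_lt (Nb k l) (pbN l))[x xN ->]; apply: (sys_jump S); rewrite // eq_sym.
- by move=> s /(piece_lt (paN k) (Na k l))[x xN ->]; apply: (sys_jump S); rewrite // eq_sym.
- move=> s /(piece_lt (Nb i j) (pbN j))[x xN ->]; apply: sdisjC.
  by apply: (sys_jump S); rewrite // eq_sym.
- move=> s; rewrite inE => /eqP ->; apply: (sys_jumps S); rewrite // eq_sym //.
- move=> s /(piece_lt (paN i) (Na i j))[x xN ->]; apply: sdisjC.
  by apply: (sys_jump S); rewrite // eq_sym.
Qed.

Lemma three_by_three : False.
Proof.
have W0 := sysW S.
have paN i' : (pa i' <= N)%N by apply/ltnW/start_lt.
have pbN j' : (pb j' < N)%N by apply/start_lt.
have Na i' j' : (kk (a i') (b j') <= N)%N by apply: kk_le.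
have Nb i' j' : (kk (b j') (a i') <= N)%N by apply: kk_le.
have nfar x m : away x m -> near x m = false by rewrite /away /near; lia.
have bmid j l : j != l -> forall x, (x < N)%N -> sdisj (sg (b j) x) (sg (b l) (pb l)).
  move=> jl x xN; apply: (sys_mid S); rewrite ?(inj_eq ib) //.
  have [ijl|] //= := boolP (indep _ _).
  by rewrite (nfar (pb l)) ?andbF // start_away // 1?indepC.
have bpt l : on_seg (sg (b l) (pb l)) (q (b l) (pb l)) by apply: on_seg1.
apply: (@K33_parity R (fun i => q (a i) (pa i)) (fun j => q (b j) (pb j)) ch
  (fun _ _ => false) (fun _ _ => false) (fun _ _ => false) (fun _ _ => false)
  (fun i l => lexlt (q (a i) (pa i)) (q (b l) (pb l)))).
- move=> i j; apply: conn_cat (conn_piece _ _ _) _.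
  exact: conn_cat (conn1 _ _) (conn_piece _ _ _).
- move=> j l jl; apply/eqP => E1; apply: (bmid j l jl (pb j) (pbN j) (q (b j) (pb j))) => //.
  by rewrite E1.
- move=> i j l jl; apply: updown_chain_off.
    apply: conn_cat (conn_piece _ _ _) _.
    exact: conn_cat (conn1 _ _) (conn_piece _ _ _).
  have off s : sdisj s (sg (b l) (pb l)) -> ~ on_seg s (q (b l) (pb l)).
    by move=> h hs; apply: (h _ hs).
  move=> s; rewrite !mem_cat inE => /or3P[/(piece_lt (paN i) (Na i j))[x xN ->]|/eqP ->|].
  + apply: off; apply: (sys_mid S) => //.
    by rewrite (nfar (pb l)) ?andbF // start_away_self.
  + by apply: off; apply: (sys_jump S); rewrite // 1?eq_sym // (inj_eq ib).
  + by case/(piece_lt (Nb i j) (ltnW (pbN j))) => x xN ->; apply: off; apply: bmid.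
- by [].
- by move=> i k j l ik jl; rewrite ch_meet //; apply: contraTneq ik => ->; rewrite ltnn.
Qed.
End ThreeByThree.

End Discrete.

(* Large bicliques of even pairs are cut down to 3 x 3 by recording, for each *)
(* curve of one side, on which side of every mutual meeting point it is touched. *)
Theorem tangent_biclique_free : exists2 t, 0 < t &
  forall (R : realFieldType) (V E : finType) (al be : E -> V) (pos : V -> R * R)
    (N W : nat) (q : E -> nat -> R * R) (kk : E -> E -> nat),
  system al be pos N W q kk -> biclique_free (tangent al be pos N q) t.
Proof.
have [s hs] : exists s, 2 * #|{ffun 'I_3 * 'I_3 -> bool}| < s by eexists; apply: leqnn.
have [t st ht] : exists2 t, s <= t & 2 * #|{ffun 'I_s * 'I_s -> bool}| < t.
  exists (s + (2 * #|{ffun 'I_s * 'I_s -> bool}|).+1); first exact: leq_addr.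
  exact: leq_addl.
exists t; first exact: leq_ltn_trans ht.
move=> R V E al be pos N W q kk S A B iA iB.
have [/existsP[i /existsP[j ij]]|H] :=
  boolP [exists i, exists j, ~~ tangent al be pos N q (A i) (B j)].
  by exists i, j.
have {}H i j : tangent al be pos N q (A i) (B j).
  apply: contraNT H => h; apply/existsP; exists i; apply/existsP; by exists j.
pose A' (x : 'I_s) := A (widen_ord st x).
have iA' : injective A' by move=> x y /iA /(congr1 val) /= /val_inj.
(* Three curves [B] are chosen that lie alike with respect to all mutual meetings of the s curves
   [A']. Only then are three of the [A'] chosen, alike with respect to the three [B']; the first
   agreement survives this restriction. *)
have [j [ij hj]] := @pigeonhole3 t _ (fun j => [ffun ii : 'I_s * 'I_s =>
  kk (A' ii.1) (A' ii.2) < kk (A' ii.1) (B j)]) ht.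
pose B' x := B (j x); have iB' : injective B' by apply: inj_comp.
have [i [ii hi]] := @pigeonhole3 s _ (fun i => [ffun jj : 'I_3 * 'I_3 =>
  kk (B' jj.1) (B' jj.2) < kk (B' jj.1) (A' i)]) hs.
exfalso; apply: (three_by_three S (a := fun x => A' (i x)) (b := B')).
- exact: inj_comp.
- exact: iB'.
- by move=> x y; apply: H.
- move=> x x' y y' _; have /ffunP/(_ (i x, i x')) := hj y y'.
  by rewrite !ffunE.
- move=> y y' x x' _; have /ffunP/(_ (y, y')) := hi x x'.
  by rewrite !ffunE.
Qed.

(** * Crossing parity of radii at a common vertex *)

Section Radii.
Local Open Scope ring_scope.
Variable R : realFieldType.
Notation pt := (R * R)%type.
Implicit Types o x y z : pt.

Lemma orient_xyx x y : orient x y x = 0.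
Proof. rewrite /orient; ring. Qed.

Lemma ucr_end o x : ucr o (o, x) = false.
Proof. by rewrite /ucr /above /= orient_xyx ltxx if_same andbF. Qed.

Lemma dcr_end o x : dcr o (o, x) = false.
Proof. by rewrite /dcr /below /= orient_xyx ltxx if_same andbF. Qed.

Lemma scross_radii o x y :
  scross (o, x) (o, y) = ucr y (o, x) (+) dcr x (o, y).
Proof. by rewrite /scross /= ucr_end dcr_end. Qed.

Lemma lexlt_asym x y : lexlt x y -> lexlt y x = false.
Proof.
move=> xy; have := lexltN (_ : x != y); rewrite xy => -> //.
by apply: contraTneq xy => ->; rewrite lexxx.
Qed.

Lemma orient_swap o x y : orient o y x = - orient o x y.
Proof. rewrite /orient; ring. Qed.

Lemma scross_sides o x y : x != o -> y != o -> lexlt x o != lexlt y o ->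
  scross (o, x) (o, y) = false.
Proof.
move=> xo yo; rewrite scross_radii /ucr /dcr /lexin /= (lexltN xo) (lexltN yo).
case h1 : (lexlt x o); case h2 : (lexlt y o) => //= _.
  have -> : lexlt x y by apply: lexlt_trans h1 _; rewrite (lexltN yo) h2.
  by rewrite (lexlt_asym (x := x)) //; apply: lexlt_trans h1 _; rewrite (lexltN yo) h2.
have -> : lexlt y x by apply: lexlt_trans h2 _; rewrite (lexltN xo) h1.
by rewrite (lexlt_asym (x := y)) //; apply: lexlt_trans h2 _; rewrite (lexltN xo) h1.
Qed.

(** On one side of [o] the parity compares slopes. It is therefore a strict linear order on the
    radii there, as [scross_anti] and [scross_trans] record. *)
Lemma scross_same o x y : x != o -> y != o -> lexlt x o = lexlt y o -> orient o x y != 0 ->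
  scross (o, x) (o, y) = if lexlt x o then orient o x y < 0 else 0 < orient o x y.
Proof.
move=> xo yo; rewrite scross_radii /ucr /dcr /lexin /above /below /=.
rewrite (lexltN xo) (lexltN yo) (orient_swap o x y) oppr_lt0 oppr_gt0 => <- w0.
have xy : x != y by apply: contraNneq w0 => ->; rewrite /orient; apply/eqP; ring.
rewrite (lexltN xy).
by case: (lexlt x o); case: (lexlt x y); case: (ltgtP (orient o x y) 0) w0.
Qed.

Lemma scross_anti o x y : x != o -> y != o -> lexlt x o = lexlt y o -> orient o x y != 0 ->
  scross (o, y) (o, x) = ~~ scross (o, x) (o, y).
Proof.
move=> xo yo s w0; have w1 : orient o y x != 0 by rewrite orient_swap oppr_eq0.
rewrite (scross_same yo xo (esym s) w1) (scross_same xo yo s w0).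
rewrite -s (orient_swap o x y) oppr_lt0 oppr_gt0.
by case: ifP => _; case: (ltgtP (orient o x y) 0) w0.
Qed.

Lemma scross_trans o x y z : x != o -> y != o -> z != o ->
  lexlt x o = lexlt y o -> lexlt y o = lexlt z o ->
  orient o x y != 0 -> orient o y z != 0 -> orient o x z != 0 ->
  scross (o, x) (o, y) -> scross (o, y) (o, z) -> scross (o, x) (o, z).
Proof.
move=> xo yo zo sxy syz wxy wyz wxz.
rewrite (scross_same xo yo) // (scross_same yo zo) // (scross_same xo zo) //; last by rewrite sxy.
rewrite -sxy.
have [e e0 H] := shear_lex [:: o; x; y; z].
have K : orient o x z * (shear e y - shear e o) =
  orient o x y * (shear e z - shear e o) + orient o y z * (shear e x - shear e o).
  by rewrite /orient /shear; ring.
case hx : (lexlt x o).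
  have hy : lexlt y o by rewrite -sxy.
  have hz : lexlt z o by rewrite -syz.
  move: hx hy hz; rewrite !H ?inE ?eqxx ?orbT // -!(subr_lt0 (shear e o)) => hx hy hz h1 h2.
  rewrite -(nmulr_lgt0 _ hy) K; apply: addr_gt0; by rewrite nmulr_lgt0.
have P u : u != o -> lexlt u o = false -> lexlt o u by move=> uo; rewrite (lexltN uo) => ->.
have hy : lexlt o y by apply: P; rewrite // -sxy.
have hz : lexlt o z by apply: P; rewrite // -syz -sxy.
have {}hx : lexlt o x by apply: P.
move: hx hy hz; rewrite !H ?inE ?eqxx ?orbT // -!(subr_gt0 (shear e o)) => hx hy hz h1 h2.
rewrite -(pmulr_lgt0 _ hy) K; apply: addr_gt0; by rewrite pmulr_lgt0.
Qed.
End Radii.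

(** * Splitting a vertex into blocks of at most D edges *)

Section Groups.
Variables (E V : finType) (v : E -> V) (side : E -> bool) (c : rel E) (D : nat).
Hypothesis D0 : 0 < D.
Definition mates e f := [&& v e == v f, side e == side f & e != f].
Hypothesis c_sides : forall e f, e != f -> v e = v f -> side e != side f -> c e f = false.
Hypothesis c_anti : forall e f, mates e f -> c f e = ~~ c e f.
Hypothesis c_trans : forall e f g, mates e f -> mates f g -> mates e g ->
  c e f -> c f g -> c e g.

Definition rank e := #|[set f | mates f e && c f e]|.

Lemma rank_ltn e : rank e < #|[set f | (v f == v e) && (side f == side e)]|.
Proof.
apply: proper_card; apply/properP; split.
  by apply/subsetP => f; rewrite !inE => /andP[/and3P[-> ->]].
by exists e; rewrite !inE ?eqxx // /mates !eqxx andbF.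
Qed.

Lemma rank_le e : rank e < #|E|.+1.
Proof. by rewrite ltnS; apply: max_card. Qed.

Lemma rank_lt e f : mates e f -> c e f -> rank e < rank f.
Proof.
move=> ef cef; apply: proper_card; apply/properP; split; last first.
  by exists e; rewrite !inE ?ef ?cef // /mates !eqxx.
apply/subsetP => g; rewrite !inE => /andP[ge cge].
have ge' := ge; move: ge ef => /and3P[/eqP h1 /eqP h2 h3] ef.
have /and3P[/eqP k1 /eqP k2 k3] := ef.
have gf : mates g f.
  rewrite /mates h1 h2 k1 k2 !eqxx /=; apply: contraTneq cge => ->.
  by rewrite (c_anti ef) cef.
by rewrite gf (c_trans ge' ef gf).
Qed.

Lemma mates_sym e f : mates e f = mates f e.
Proof. by rewrite /mates (eq_sym (v e)) (eq_sym (side e)) (eq_sym e). Qed.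

Lemma rank_neq e f : mates e f -> rank e != rank f.
Proof.
move=> ef; have fe : mates f e by rewrite mates_sym.
case h: (c e f); first by rewrite neq_ltn (rank_lt ef h).
by rewrite neq_ltn (rank_lt fe) ?orbT // (c_anti ef) h.
Qed.

(** At each vertex and side, the blocks of D consecutive ranks in the order [c]. The bound |E| + 1
    only makes the type finite. *)
Definition group e : V * bool * 'I_#|E|.+1 :=
  (v e, side e, Ordinal (leq_ltn_trans (leq_div (rank e) D) (rank_le e))).

Definition before (x y : V * bool * 'I_#|E|.+1) := (x.1.2 == y.1.2) && (x.2 < y.2).

(** Blocks consist of consecutive ranks, so distinct blocks on one side are comparable as wholes,
    and edges on opposite sides do not cross. *)
Lemma group_cross e f : v e = v f -> group e != group f -> c e f = before (group e) (group f).
Proof.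
move=> vef gef; have ef : e != f by apply: contraNneq gef => ->.
rewrite /before /=; case: (eqVneq (side e) (side f)) => [s|s]; last exact: c_sides.
have m : mates e f by rewrite /mates vef s !eqxx.
have ne : rank e %/ D != rank f %/ D.
  apply: contraNneq gef => h; rewrite /group vef s; apply/eqP; congr (_, _, _).
  exact: val_inj.
rewrite /= ltn_neqAle ne /=; case h: (c e f).
  by rewrite leq_div2r // ltnW // (rank_lt m h).
have m' : mates f e by rewrite mates_sym.
apply/esym/negbTE; rewrite -ltnNge ltn_neqAle eq_sym ne leq_div2r //.
by apply/ltnW/(rank_lt m'); rewrite (c_anti m) h.
Qed.

Lemma group_size x : #|[set e | group e == x]| <= D.
Proof.
have [e0 he0|h] := pickP [pred e | group e == x]; last first.
  by rewrite (_ : [set e | _] = set0) ?cards0 //; apply/setP => e; rewrite !inE; apply: h.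
pose r e := inord (rank e %% D) : 'I_D.-1.+1.
have rE e : r e = rank e %% D :> nat by rewrite inordK // prednK // ltn_mod.
rewrite -(@card_in_imset _ _ r) => [|e f].
  by apply: leq_trans (max_card _) _; rewrite card_ord prednK.
rewrite !inE => /eqP ge /eqP gf /(congr1 val); rewrite /= !rE => h.
apply/eqP/negPn/negP => ef; move: ge; rewrite -gf => -[h1 h2 h3].
have : mates e f by rewrite /mates h1 h2 !eqxx.
by move/rank_neq; rewrite (divn_eq (rank e) D) h h3 -divn_eq eqxx.
Qed.

(** A vertex and side with n edges has at most n/D + 1 blocks, and there are 2 |V| such pairs. *)
Lemma group_count : D * #|[set group e | e in E]| <= #|E| + 2 * (D * #|V|).
Proof.
pose n (vs : V * bool) := #|[set f | (v f == vs.1) && (side f == vs.2)]|.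
apply: (@leq_trans (D * \sum_vs (n vs %/ D).+1)).
  rewrite leq_mul2l; apply/orP; right.
  apply: (@leq_trans #|[set x : V * bool * 'I_#|E|.+1 | x.2 < (n x.1 %/ D).+1]|).
    apply: subset_leq_card; apply/subsetP => x /imsetP[e _ ->]; rewrite inE /= ltnS.
    by apply: leq_div2r; apply: ltnW (rank_ltn e).
  rewrite card_sum_bool -(pair_big xpredT xpredT
    (fun (vs : V * bool) (i : 'I_#|E|.+1) => (i < (n vs %/ D).+1 : nat))) /=.
  apply: leq_sum => vs _; rewrite -card_sum_bool.
  set k := (_ %/ _).+1.
  have inj : {in [set i : 'I_#|E|.+1 | i < k] &, injective (fun i : 'I_#|E|.+1 => inord i : 'I_k.-1.+1)}.
    move=> i j; rewrite !inE => hi hj /(congr1 val).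
    by rewrite /= !inordK // => /val_inj.
  by rewrite -(card_in_imset inj); apply: leq_trans (max_card _) _; rewrite card_ord.
have -> : #|E| = \sum_vs n vs.
  rewrite -sum1_card (partition_big (fun e => (v e, side e)) predT) //=.
  apply: eq_bigr => -[x b] _; rewrite sum1_card; apply: eq_card => e.
  by rewrite !inE.
rewrite big_distrr /=.
apply: (@leq_trans (\sum_vs (n vs + D))).
  by apply: leq_sum => vs _; rewrite mulnS addnC leq_add2r mulnC leq_divM.
rewrite big_split /= sum_nat_const card_prod card_bool leq_add2l.
rewrite eq_leq //; ring.
Qed.
End Groups.

(** * Crossing parity as a bilinear form in the blocks *)

Section Assembly.
Local Open Scope ring_scope.
Variables (R : realFieldType) (V E : finType).
Notation pt := (R * R)%type.
Variables (al be : E -> V) (pos : V -> pt) (N W : nat) (q : E -> nat -> pt)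
  (kk : E -> E -> nat).
Hypothesis S : system al be pos N W q kk.
Notation indep := (indep al be).
Notation ra := (ra al pos q).
Notation rb := (rb be pos N q).
Notation chn := (chn al be pos N q).
Notation sg := (sg q).

Definition cross_al e f := scross (ra e) (ra f).
Definition cross_be e f := scross (pos (be e), q e N) (pos (be f), q f N).
Definition left_al e := lexlt (q e 0%N) (pos (al e)).
Definition left_be e := lexlt (q e N) (pos (be e)).

Lemma II_1 (s u : pt * pt) : II [:: s] [:: u] = scross s u.
Proof. by rewrite /II !xsum_cons !xsum_nil !addbF. Qed.

Lemma sdisj_mids e f s u : e != f -> ~~ indep e f ->
  s \in piece q e 0 N -> u \in piece q f 0 N -> sdisj s u.
Proof.
move=> ef nief /mem_piece0[i iN ->] /mem_piece0[j jN ->].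
by apply: (sys_mid S) => //; rewrite (negbTE nief).
Qed.

Lemma II_common e f : e != f -> ~~ indep e f ->
  II (chn e) (chn f) = scross (ra e) (ra f) (+) scross (rb e) (rb f).
Proof.
move=> ef nief; have fe : f != e by rewrite eq_sym.
rewrite -[chn e]/([:: ra e] ++ [:: rb e] ++ piece q e 0 N).
rewrite -[chn f]/([:: ra f] ++ [:: rb f] ++ piece q f 0 N).
rewrite !II_cat1 !II_cat2 !II_1.
rewrite (scross_disj (sys_rab S ef)) (scross_disj (sdisjC (sys_rab S fe))).
have Z1 s : (forall j, (j < N)%N -> sdisj s (sg f j)) -> II [:: s] (piece q f 0 N) = false.
  by move=> h; apply: II_single1 => u /mem_piece0[j jN ->]; apply: h.
have Z2 u : (forall j, (j < N)%N -> sdisj u (sg e j)) -> II (piece q e 0 N) [:: u] = false.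
  by move=> h; apply: II_single2 => s /mem_piece0[j jN ->]; apply: sdisjC; apply: h.
rewrite (Z1 (ra e)) => [|j jN]; last exact: (sys_ra S).
rewrite (Z1 (rb e)) => [|j jN]; last exact: (sys_rb S).
rewrite (Z2 (ra f)) => [|j jN]; last exact: (sys_ra S).
rewrite (Z2 (rb f)) => [|j jN]; last exact: (sys_rb S).
rewrite [II (piece q e 0 N) (piece q f 0 N)]II_disj => [|s u]; last exact: sdisj_mids.
by rewrite !addbF.
Qed.

Lemma II_al e f : e != f -> al e = al f -> II (chn e) (chn f) = cross_al e f.
Proof.
move=> ef a; rewrite II_common // /indep ?a ?eqxx //.
rewrite [X in _ (+) X]scross_disj ?addbF //; apply: (sys_rbb S).
by apply: contraNneq ef => b; apply/eqP; apply: (sys_inj S).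
Qed.

Lemma II_be e f : e != f -> be e = be f -> II (chn e) (chn f) = cross_be e f.
Proof.
move=> ef b; rewrite II_common // /indep ?b ?eqxx ?andbF //.
rewrite [X in X (+) _]scross_disj ?addFb; last first.
  by apply: (sys_raa S); apply: contraNneq ef => a; apply/eqP; apply: (sys_inj S).
by rewrite /cross_be /rb scross_rev1 scross_rev2.
Qed.

(** At an end [w] of [e], the radius there is neither above nor below [w]. Dropping it leaves a
    chain that avoids [w] and ends at the sample next to it, whose side replaces the comparison of
    [w] with itself. *)
Lemma updown_ends e w : UU (pos w) (chn e) (+) DD (pos w) (chn e) =
  (lexlt (pos (al e)) (pos w) (+) ((al e == w) && left_al e)) (+)
  (lexlt (pos (be e)) (pos w) (+) ((be e == w) && left_be e)).
Proof.
have ab := sys_bip S e e.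
have [aw|aw] := eqVneq (al e) w.
  have bw : (be e == w) = false by apply/negbTE; rewrite -aw eq_sym.
  rewrite bw /= addbF -aw lexxx /= /UU /DD !xsum_cons.
  rewrite ucr_end dcr_end /= -!xsum_cons -/(UU _ _) -/(DD _ _) /left_al.
  have hc : conn (rb e :: piece q e 0 N) (q e 0%N) (pos (be e)).
    rewrite -cat1s; apply: conn_sym; apply: conn_cat (conn_sym (conn1 _ _)) _.
    by apply: conn_sym; apply: conn_piece.
  apply: (updown_chain_off hc) => s; rewrite inE => /orP[/eqP ->|/mem_piece0[i iN ->]].
    by move/(sys_pos_rb S) => h; rewrite h eqxx in ab.
  exact: (sys_pos_mid S).
rewrite /= addbF.
have [bw|bw] := eqVneq (be e) w.
  rewrite -bw lexxx /=.
  rewrite -[chn e]/([:: ra e] ++ [:: rb e] ++ piece q e 0 N).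
  rewrite /UU /DD !xsum_cat.
  have -> : xsum [:: rb e] (ucr (pos (be e))) = false.
    by rewrite xsum_cons xsum_nil /rb ucr_rev ucr_end.
  have -> : xsum [:: rb e] (dcr (pos (be e))) = false.
    by rewrite xsum_cons xsum_nil /rb dcr_rev dcr_end.
  rewrite !addFb -!xsum_cat -/(UU _ _) -/(DD _ _) /left_be.
  have hc : conn ([:: ra e] ++ piece q e 0 N) (pos (al e)) (q e N).
    exact: conn_cat (conn1 _ _) (conn_piece _ _ _ _).
  apply: (updown_chain_off hc) => s; rewrite inE => /orP[/eqP ->|/mem_piece0[i iN ->]].
    by move/(sys_pos_ra S) => h; rewrite h eqxx in ab.
  exact: (sys_pos_mid S).
rewrite addbF; apply: (updown_chain_off (conn_chn al be pos N q e)) => s.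
by apply: (pos_off S); rewrite eq_sym.
Qed.

Lemma orient_al e f : mates al left_al e f -> orient (pos (al e)) (q e 0%N) (q f 0%N) != 0.
Proof.
case/and3P=> /eqP a /eqP s ef; apply: (sys_al S) => //.
by move: s; rewrite /left_al !(lexltN (sys_al0 S _)) => ->.
Qed.

Lemma orient_be e f : mates be left_be e f -> orient (pos (be e)) (q e N) (q f N) != 0.
Proof.
case/and3P=> /eqP b /eqP s ef; apply: (sys_be S) => //.
by move: s; rewrite /left_be !(lexltN (sys_be0 S _)) => ->.
Qed.

Lemma al_sides e f : e != f -> al e = al f -> left_al e != left_al f -> cross_al e f = false.
Proof.
move=> _ a; rewrite /left_al /cross_al /ra -a => h.
by apply: scross_sides => //; rewrite ?(sys_al0 S) // a (sys_al0 S).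
Qed.

Lemma be_sides e f : e != f -> be e = be f -> left_be e != left_be f -> cross_be e f = false.
Proof.
move=> _ b; rewrite /left_be /cross_be -b => h.
by apply: scross_sides => //; rewrite ?(sys_be0 S) // b (sys_be0 S).
Qed.

Lemma al_anti e f : mates al left_al e f -> cross_al f e = ~~ cross_al e f.
Proof.
move=> m; have w := orient_al m; case/and3P: m => /eqP a /eqP s _.
move: s; rewrite /left_al /cross_al /ra -a => s.
by apply: scross_anti; rewrite ?(sys_al0 S) // a (sys_al0 S).
Qed.

Lemma be_anti e f : mates be left_be e f -> cross_be f e = ~~ cross_be e f.
Proof.
move=> m; have w := orient_be m; case/and3P: m => /eqP b /eqP s _.
move: s; rewrite /left_be /cross_be -b => s.
by apply: scross_anti; rewrite ?(sys_be0 S) // b (sys_be0 S).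
Qed.

Lemma al_trans e f g : mates al left_al e f -> mates al left_al f g -> mates al left_al e g ->
  cross_al e f -> cross_al f g -> cross_al e g.
Proof.
move=> m1 m2 m3; have w1 := orient_al m1; have w2 := orient_al m2; have w3 := orient_al m3.
case/and3P: m1 => /eqP a1 /eqP s1 _; case/and3P: m3 => /eqP a3 /eqP s3 _.
move: w2 s1 s3; rewrite /left_al /cross_al /ra -a1 -a3 => w2 s1 s3.
apply: scross_trans; rewrite ?(sys_al0 S) // -?s1 //.
  by rewrite a1 (sys_al0 S).
by rewrite a3 (sys_al0 S).
Qed.

Lemma be_trans e f g : mates be left_be e f -> mates be left_be f g -> mates be left_be e g ->
  cross_be e f -> cross_be f g -> cross_be e g.
Proof.
move=> m1 m2 m3; have w1 := orient_be m1; have w2 := orient_be m2; have w3 := orient_be m3.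
case/and3P: m1 => /eqP a1 /eqP s1 _; case/and3P: m3 => /eqP a3 /eqP s3 _.
move: w2 s1 s3; rewrite /left_be /cross_be -a1 -a3 => w2 s1 s3.
apply: scross_trans; rewrite ?(sys_be0 S) // -?s1 //.
  by rewrite a1 (sys_be0 S).
by rewrite a3 (sys_be0 S).
Qed.

Variable D : nat.
Hypothesis D0 : (0 < D)%N.
Notation gal := (group al left_al cross_al D).
Notation gbe := (group be left_be cross_be D).
Notation gT := (V * bool * 'I_#|E|.+1)%type.

Definition gset := [set gal e | e in E] :|: [set gbe e | e in E].
Lemma gal_in e : gal e \in gset. Proof. by rewrite inE imset_f. Qed.
Lemma gbe_in e : gbe e \in gset. Proof. by rewrite inE imset_f ?orbT. Qed.
Definition halves : finType := {x : gT | x \in gset}.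
Definition sal e : halves := Sub (gal e) (gal_in e).
Definition sbe e : halves := Sub (gbe e) (gbe_in e).
Definition orig (x : halves) : V := (val x).1.1.

Lemma halves_count : (D * #|halves| <= 2 * #|E| + 4 * (D * #|V|))%N.
Proof.
have -> : #|halves| = #|gset| by rewrite card_sig; apply: eq_card => x; rewrite !inE.
apply: (@leq_trans (D * (#|[set gal e | e in E]| + #|[set gbe e | e in E]|))).
  by rewrite leq_mul2l leq_card_setU orbT.
have h1 := group_count al left_al cross_al D; have h2 := group_count be left_be cross_be D.
lia.
Qed.

Lemma halves_deg x : (deg sal sbe x <= D)%N.
Proof.
have A e f : sal e == x -> sbe f != x.
  move=> /eqP <-; apply/eqP => /(congr1 orig) h.
  by move/eqP: (sys_bip S e f); apply; exact: esym h.
have [e0 he|h] := pickP (fun e => sal e == x).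
  apply: leq_trans (group_size D0 al_anti al_trans (val x)).
  apply: subset_leq_card; apply/subsetP => e; rewrite !inE /inc => /orP[/eqP <- //|].
  by rewrite (negbTE (A e0 e he)).
apply: leq_trans (group_size D0 be_anti be_trans (val x)).
apply: subset_leq_card; apply/subsetP => e; rewrite !inE /inc h /=.
by move=> /eqP <-.
Qed.

(* The bilinear form describing crossing parities of distinct edges through the *)
(* pieces of vertices at which they end. *)
Definition isal (x : halves) := [exists e, al e == orig x].
Definition form (x y : halves) : bool :=
  (isal x && isal y) (+) ((orig x == orig y) && ~~ before (val x) (val y)).

Lemma isal_al e : isal (sal e). Proof. by apply/existsP; exists e. Qed.
Lemma isal_be e : isal (sbe e) = false.
Proof. by apply/existsP => -[f]; apply/negP; exact: (sys_bip S). Qed.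

(** The two [al] ends always contribute a constant 1. For independent edges it is the whole sum, and
    the pair is odd since it is not tangent. At a common end it cancels the negation in front of
    [before], which is the parity by [group_cross]. *)
Lemma parity_form e f : ~~ clash sal sbe (tangent al be pos N q) e f ->
  II (chn e) (chn f) = form (sal e) (sal f) (+) form (sal e) (sbe f) (+)
    (form (sbe e) (sal f) (+) form (sbe e) (sbe f)).
Proof.
rewrite /clash !negb_or => /and3P[nT na nb].
have ef : e != f by apply: contraNneq na => ->.
have B := sys_bip S.
rewrite /form !isal_al !isal_be /orig /= (negbTE (B e f)) (eq_sym (be e)) (negbTE (B f e)) /=.
rewrite addbF.
have na' : gal e != gal f by rewrite -val_eqE in na.
have nb' : gbe e != gbe f by rewrite -val_eqE in nb.
have [a|a] := eqVneq (al e) (al f).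
  have b : be e == be f = false.
    by apply: contraNF ef => /eqP b; apply/eqP; apply: (sys_inj S).
  rewrite b /= (II_al ef a) (group_cross al_sides al_anti al_trans a na') negbK.
  by rewrite addbF.
have [b|b] := eqVneq (be e) (be f).
  by rewrite (II_be ef b) (group_cross be_sides be_anti be_trans b nb') /= negbK.
by move: nT; rewrite /tangent /indep a b negbK => ->.
Qed.
End Assembly.

(** The walks from [dense_select] are drawn as chains by concatenating polygons. [parity_form] is
    additive along walks, so the parities of these chains depend only on the branch blocks, as
    [K33_parity] forbids. *)
Theorem system_bound : exists C, forall (R : realFieldType) (V E : finType) (al be : E -> V)
    (pos : V -> R * R) (N W : nat) (q : E -> nat -> R * R) (kk : E -> E -> nat),
  system al be pos N W q kk -> #|E| <= C * #|V|.
Proof.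
have [t t0 bf] := tangent_biclique_free; have [c0 dense] := dense_select t0.
exists (c0.+1) => R V E al be pos N W q kk S; rewrite leqNgt; apply/negP => big.
have E0 : 0 < #|E| by apply: leq_ltn_trans big.
have V0 : 0 < #|V| by have /card_gt0P[e _] := E0; apply/card_gt0P; exists (al e).
(* With D the average |E|/|V|, [halves_count] gives D times the number of blocks at most 6 |E|, so
   the split graph is still dense relative to its maximum degree. *)
pose D := #|E| %/ #|V|.
have cD : c0 < D by rewrite leq_divRL // ltnW.
have D0 : 0 < D by apply: leq_ltn_trans cD.
have DV : D * #|V| <= #|E| by apply: leq_divM.
pose T := tangent al be pos N q.
have origE e f : orig (sal al be pos N q D e) != orig (sbe al be pos N q D f) :=
  sys_bip S e f.
have h1 e f : orig (sal al be pos N q D e) = orig (sal al be pos N q D f) ->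
   sbe al be pos N q D e = sbe al be pos N q D f -> e = f.
  by move=> a /(congr1 (@orig _ _ _ _ _ _ _ _ _)) b; apply: (sys_inj S).
have h2 e f : orig (sbe al be pos N q D e) = orig (sbe al be pos N q D f) ->
   sal al be pos N q D e = sal al be pos N q D f -> e = f.
  by move=> b /(congr1 (@orig _ _ _ _ _ _ _ _ _)) a; apply: (sys_inj S).
have H0 : 0 < #|halves al be pos N q D|.
  by have /card_gt0P[e _] := E0; apply/card_gt0P; exists (sal al be pos N q D e).
have dens : D * #|halves al be pos N q D| <= 8 * #|E|.
  by have := halves_count al be pos N q D0; lia.
have [a [b [p [p1 p2 p3]]]] := dense _ _ _ _ D _ _ T (halves_deg S D0) origE h1 h2
  (bf _ _ _ _ _ _ _ _ _ _ S) (ltnW cD) H0 dens.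
pose ch e := chn al be pos N q e; pose c i j := flatten [seq ch e | e <- p i j].
pose sa := sal al be pos N q D; pose sb := sbe al be pos N q D.
pose fm := @form R V E al be pos N q D.
have xs i j (g : _ -> bool) : xsum (c i j) g = xsum (p i j) (fun e => xsum (ch e) g).
  by rewrite /c /xsum big_flatten big_map.
have p2' i j (g : halves al be pos N q D -> bool) :
    xsum (p i j) (fun e => g (sa e) (+) g (sb e)) = g (a i) (+) g (b j) by exact: p2.
apply: (@K33_parity R (fun i => pos (orig (a i))) (fun j => pos (orig (b j))) c
  (fun i k => fm (a i) (a k)) (fun i l => fm (a i) (b l))
  (fun j k => fm (b j) (a k)) (fun j l => fm (b j) (b l))
  (fun i l => lexlt (pos (orig (a i))) (pos (orig (b l))) (+)
     ((orig (a i) == orig (b l)) && (val (a i)).1.2))).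
- move=> i j g; rewrite xs -(p2' i j (fun x => g (pos (orig x)))).
  by apply: eq_xsum => e; rewrite (conn_chn al be pos N q e).
- by move=> j l jl; rewrite (inj_eq (sys_pos S)); apply: p1.
- move=> i j l jl; rewrite /UU /DD !xs -xsum_add.
  pose g (x : halves al be pos N q D) := lexlt (pos (orig x)) (pos (orig (b l))) (+)
     ((orig x == orig (b l)) && (val x).1.2).
  transitivity (xsum (p i j) (fun e => g (sa e) (+) g (sb e))).
    by apply: eq_xsum => e; apply: (updown_ends S).
  by rewrite p2' /g (negbTE (p1 _ _ jl)) /= addbF.
(* [before] can break the symmetry of the form only between blocks of one vertex, and the branch
   blocks [b] come from distinct vertices. *)
- move=> j l; have [->//|jl] := eqVneq j l.
  by rewrite /fm /form (eq_sym (orig (b j))) eq_sym (negbTE (p1 _ _ jl)) andbC.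
- move=> i k j l ik jl; have nik : i != k by apply: contraTneq ik => ->; rewrite ltnn.
  rewrite /II xs.
  transitivity (xsum (p i j) (fun e => xsum (p k l) (fun f =>
    fm (sa e) (sa f) (+) fm (sa e) (sb f) (+) (fm (sb e) (sa f) (+) fm (sb e) (sb f))))).
    apply: eq_in_xsum => e ep.
    transitivity (xsum (p k l) (fun f => II (ch e) (ch f))).
      rewrite /II xsum_exch xs; apply: eq_xsum => f; exact: xsum_exch.
    apply: eq_in_xsum => f fp; apply: (parity_form S); exact: p3 nik jl ep fp.
  transitivity (xsum (p i j) (fun e => (fm (sa e) (a k) (+) fm (sa e) (b l)) (+)
     (fm (sb e) (a k) (+) fm (sb e) (b l)))).
    by apply: eq_xsum => e; rewrite xsum_add !p2'.
  by rewrite (p2' i j (fun x => fm x (a k) (+) fm x (b l))).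
Qed.

From mathcomp Require Import all_classical all_reals all_analysis.
Import numFieldNormedType.Exports.

(** * From arcs to polygonal systems *)

Section Plane.
Local Open Scope classical_set_scope.
Local Open Scope ring_scope.
Variable R : realType.
Notation pt := (R * R)%type.
Implicit Types (p q z o : pt) (r : R) (a b : R -> pt).

Definition dst p q : R := Num.max `|p.1 - q.1| `|p.2 - q.2|.

Lemma dst_ltP p q e : reflect (`|p.1 - q.1| < e /\ `|p.2 - q.2| < e) (dst p q < e).
Proof. by rewrite gt_max; apply: andP. Qed.

Lemma dst_leP p q e : reflect (`|p.1 - q.1| <= e /\ `|p.2 - q.2| <= e) (dst p q <= e).
Proof. by rewrite ge_max; apply: andP. Qed.

Lemma dstC p q : dst p q = dst q p.
Proof. by rewrite /dst distrC [X in Num.max _ X]distrC. Qed.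

Lemma dst_ge0 p q : 0 <= dst p q.
Proof. by rewrite le_max normr_ge0. Qed.

Lemma dst_tri p q z : dst p z <= dst p q + dst q z.
Proof.
have [h1 h2] := dst_leP _ _ _ (lexx (dst p q)).
have [h3 h4] := dst_leP _ _ _ (lexx (dst q z)).
by apply/dst_leP; split; [apply: (le_trans (ler_distD q.1 _ _)) |
  apply: (le_trans (ler_distD q.2 _ _))]; apply: lerD.
Qed.

Lemma dst_eq0 p q : (dst p q == 0) = (p == q).
Proof.
apply/eqP/eqP => [h|->]; last by rewrite /dst !subrr normr0 maxxx.
have /dst_leP[] : dst p q <= 0 by rewrite h.
by rewrite !normr_le0 !subr_eq0; case: p q {h} => [a b] [c d] /= /eqP -> /eqP ->.
Qed.

Lemma dst_gt0 p q : (0 < dst p q) = (p != q).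
Proof. by rewrite lt_def dst_ge0 andbT dst_eq0. Qed.

Lemma on_seg_dst p q z o e : on_seg (p, q) z -> dst o p < e -> dst o q < e -> dst o z < e.
Proof.
have K (x u v w : R) : 0 <= x <= 1 -> `|u - v| < e -> `|u - w| < e ->
    `|u - (v + x * (w - v))| < e.
  move=> /andP[x0 x1]; rewrite !ltr_norml => /andP[h1 h2] /andP[h3 h4].
  have [vw|/ltW vw] := leP v w.
    have : 0 <= x * (w - v) <= w - v by rewrite mulr_ge0 ?ler_piMl ?subr_ge0.
    by move: (x * _) => y /andP[? ?]; apply/andP; split; lra.
  have : 0 <= x * (v - w) <= v - w by rewrite mulr_ge0 ?ler_piMl ?subr_ge0.
  by rewrite -[w - v]opprB mulrN; move: (x * _) => y /andP[? ?]; apply/andP; split; lra.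
move=> [x x01 ->] /dst_ltP[h1 h2] /dst_ltP[h3 h4].
by apply/dst_ltP; split; apply: K.
Qed.

Lemma on_seg_dst_start p q z : on_seg (p, q) z -> dst p z <= dst p q.
Proof.
have K (x v w : R) : 0 <= x <= 1 -> `|v - (v + x * (w - v))| <= `|v - w|.
  move=> /andP[x0 x1]; rewrite (_ : v - _ = x * (v - w)); last ring.
  by rewrite normrM ger0_norm // ler_piMl.
move=> [x x01 ->]; have [h1 h2] := dst_leP _ _ _ (lexx (dst p q)).
by apply/dst_leP; split => /=; apply: le_trans (K _ _ _ x01) _.
Qed.

Definition cont01 a := forall t, 0 <= t <= 1 -> forall e : R, 0 < e ->
  exists2 d : R, 0 < d & forall u, 0 <= u <= 1 -> `|t - u| < d -> dst (a t) (a u) < e.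

Lemma within_cont01 a : {within `[0, 1], continuous a} -> cont01 a.
Proof.
move/subspace_continuousP => h t t01 e e0.
have : nbhs (a @ within `[0, 1] (nbhs t)) (ball (a t) e).
  apply: h; [by rewrite /= in_itv | exact: nbhsx_ballx].
rewrite /= => /nbhs_ballP[d d0 hd]; exists d => // u u01 tu.
by have [h1 h2] := hd u tu ltac:(by rewrite /= in_itv); apply/dst_ltP.
Qed.

(** Compactness of the parameter square. Near a coincidence of the curves [Good] holds by
    hypothesis; near any other pair of parameters the curves, and hence their short chords, stay a
    positive distance apart. *)
Lemma sep a b (Good : R -> R -> Prop) : cont01 a -> cont01 b ->
  (forall (s t : R), 0 <= s <= 1 -> 0 <= t <= 1 -> a s = b t -> exists2 d : R, 0 < d &
     forall (s' t' : R), 0 <= s' <= 1 -> 0 <= t' <= 1 -> `|s - s'| < d -> `|t - t'| < d ->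
     Good s' t') ->
  exists2 d : R, 0 < d & forall (s s' t t' : R), 0 <= s <= 1 -> 0 <= s' <= 1 ->
    0 <= t <= 1 -> 0 <= t' <= 1 -> `|s - s'| < d -> `|t - t'| < d ->
    forall z z', on_seg (a s, a s') z -> on_seg (b t, b t') z' -> dst z z' < d -> Good s t.
Proof.
move=> ca cb hG.
pose P (d : R) (x : R * R) := forall (s' t' : R), 0 <= x.1 <= 1 -> 0 <= s' <= 1 ->
    0 <= x.2 <= 1 -> 0 <= t' <= 1 -> `|x.1 - s'| < d -> `|x.2 - t'| < d ->
    forall z z', on_seg (a x.1, a s') z -> on_seg (b x.2, b t') z' -> dst z z' < d -> Good x.1 x.2.
have cK : compact (`[0, 1] `*` `[0, 1] : set (R * R)).
  by apply: compact_setX; apply: segment_compact.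
have : \forall d \near (0 : R)^'+, `[0, 1] `*` `[0, 1] `<=` P d.
  apply: ((compact_near_coveringP _).1 cK).
  move=> [s0 t0] [/=]; rewrite !in_itv /= => s01 t01.
  have [e] : exists2 e : R, 0 < e & forall (s t : R), `|s0 - s| < e -> `|t0 - t| < e ->
      forall d, 0 < d < e -> P d (s, t).
    have [E|/eqP] := eqVneq (a s0) (b t0).
      have [d d0 hd] := hG _ _ s01 t01 E.
      by exists d => // s t hs ht i /andP[i0 id] s' t' /= ? _ ? _ _ _ z z' _ _ _; apply: hd.
    move/eqP; rewrite -dst_gt0; set D := dst _ _ => D0.
    have D8 : 0 < D / 8%:R by rewrite divr_gt0.
    have [d1 d10 h1] := ca _ s01 _ D8; have [d2 d20 h2] := cb _ t01 _ D8.
    pose e := Num.min (D / 8%:R) (Num.min (d1 / 2%:R) (d2 / 2%:R)).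
    have [e1 e2 e3] : [/\ e <= D / 8%:R, e <= d1 / 2%:R & e <= d2 / 2%:R].
      by rewrite /e !ge_min !lexx ?orbT.
    have e0 : 0 < e by rewrite !lt_min D8 !divr_gt0.
    exists e => // s t hs ht i /andP[i0 ie] s' t' /= S S' T T' ss tt z z' hz hz' zz; exfalso.
    have ss' := ler_distD s s0 s'; have tt' := ler_distD t t0 t'.
    have k1 : dst (a s0) (a s) < D / 8%:R by apply: h1 => //; lra.
    have k2 : dst (a s0) (a s') < D / 8%:R by apply: h1 => //; lra.
    have k3 : dst (b t0) (b t) < D / 8%:R by apply: h2 => //; lra.
    have k4 : dst (b t0) (b t') < D / 8%:R by apply: h2 => //; lra.
    have := on_seg_dst hz k1 k2; have := on_seg_dst hz' k3 k4.
    have := dst_tri (a s0) z (b t0); have := dst_tri z z' (b t0).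
    rewrite -/D (dstC z' (b t0)); lra.
  move=> e0 he.
  exists (ball ((s0, t0) : R * R) e, [set d : R | 0 < d < e]) => /=.
    split; first exact: nbhsx_ballx.
    by exists e => //= d /=; rewrite sub0r normrN => h d0; rewrite d0 -(gtr0_norm d0).
  by move=> [[s t] d] [[/= hs ht] hd]; apply: he.
move=> [d /= d0 hd]; exists (d / 2%:R); first by rewrite divr_gt0.
move=> s s' t t' S S' T T' ss tt z z' hz hz' zz.
have d2 : 0 < d / 2%:R by rewrite divr_gt0.
apply: (hd (d / 2%:R) _ d2 (s, t) _ s' t' _ _ _ _ _ _ z z') => //=.
by rewrite sub0r normrN gtr0_norm; lra.
Qed.

Lemma fin_small (I : finType) (P : I -> R -> Prop) :
  (forall i, exists2 r, 0 < r & forall r', 0 < r' <= r -> P i r') ->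
  exists2 r, 0 < r & forall r', 0 < r' <= r -> forall i, P i r'.
Proof.
move=> H; suff [r r0 hr] : exists2 r, 0 < r &
    forall r', 0 < r' <= r -> forall i, i \in enum I -> P i r'.
  by exists r => // r' hr' i; apply: hr; rewrite ?mem_enum.
elim: (enum I) => [|i s [r r0 hr]]; first by exists 1.
have [r1 r10 h1] := H i; exists (Num.min r r1); first by rewrite lt_min r0.
move=> r'; rewrite le_min => /and3P[r'0 r'r r'1] j; rewrite inE => /orP[/eqP ->|].
  by apply: h1; rewrite r'0.
by apply: hr; rewrite r'0.
Qed.

(** The time is the supremum of those spent in the closed square of radius [r] around [o];
    continuity forces distance exactly [r] there. *)
Lemma last_time a o (r : R) : cont01 a -> dst (a 0) o <= r -> r < dst (a 1) o ->
  exists x : R, [/\ 0 <= x < 1, dst (a x) o = r &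
    forall t, x < t -> t <= 1 -> r < dst (a t) o].
Proof.
move=> ca h0 h1; pose B := [set t | 0 <= t <= 1 /\ dst (a t) o <= r].
have B0 : B 0 by split; rewrite // lexx ler01.
have Bub : ubound B 1 by move=> t [/andP[]].
have Bs : has_sup B by split; [exists 0 | exists 1].
have S0 : 0 <= sup B by apply: ub_le_sup => //; exists 1.
have S1 : sup B <= 1 by apply: ge_sup => //; exists 0.
have S01 : 0 <= sup B <= 1 by rewrite S0.
have after t : sup B < t -> t <= 1 -> r < dst (a t) o.
  move=> st t1; rewrite ltNge; apply/negP => h.
  have : t <= sup B by apply: ub_le_sup; [exists 1 | split => //; rewrite t1 andbT; lra].
  lra.
have E : dst (a (sup B)) o <= r.
  rewrite leNgt; apply/negP => h.
  have [d d0 hd] := ca _ S01 (dst (a (sup B)) o - r) ltac:(lra).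
  have [t [t01 tr] tS] := sup_adherent d0 Bs.
  have tS' : t <= sup B by apply: ub_le_sup; [exists 1|].
  have := hd t t01; rewrite ger0_norm ?subr_ge0 // => /(_ ltac:(lra)).
  have := dst_tri (a (sup B)) (a t) o; lra.
have S1' : sup B < 1.
  by rewrite lt_neqAle S1 andbT; apply/eqP => e1; move: E; rewrite e1; lra.
exists (sup B); split; rewrite ?S0 //; apply/eqP; rewrite eq_le E /= leNgt; apply/negP => h.
have [d d0 hd] := ca _ S01 (r - dst (a (sup B)) o) ltac:(lra).
pose t := Num.min 1 (sup B + d / 2%:R).
have t1 : t <= 1 by rewrite /t ge_min lexx.
have t2 : t <= sup B + d / 2%:R by rewrite /t ge_min lexx orbT.
have St : sup B < t by rewrite /t lt_min S1'; lra.
have := after t St t1; have := hd t ltac:(lra).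
rewrite ler0_norm ?subr_le0 ?ltW // => /(_ ltac:(lra)).
by have := dst_tri (a t) (a (sup B)) o; rewrite (dstC (a t) (a _)); lra.
Qed.

Lemma cont01_rev a : cont01 a -> cont01 (fun t => a (1 - t)).
Proof.
move=> ca t t01 e e0; have [d d0 h] := ca (1 - t) ltac:(lra) e e0.
exists d => // u u01 tu; apply: h; first lra.
by rewrite (_ : 1 - t - (1 - u) = u - t) 1?distrC //; ring.
Qed.

Lemma convex01 (x y s : R) : 0 <= x <= 1 -> 0 <= y <= 1 -> 0 <= s <= 1 ->
  0 <= x + s * (y - x) <= 1.
Proof.
move=> /andP[x0 x1] /andP[y0 y1] /andP[s0 s1].
have s1' : 0 <= 1 - s by rewrite subr_ge0.
have := mulr_ge0 s0 y0; have := mulr_ge0 s1' x0.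
have := mulr_ge0 s0 (_ : 0 <= 1 - y); rewrite subr_ge0 => /(_ y1).
have := mulr_ge0 s1' (_ : 0 <= 1 - x); rewrite subr_ge0 => /(_ x1).
by move=> *; apply/andP; split; nra.
Qed.

Lemma cont01_affine a (x y : R) : cont01 a -> 0 <= x <= 1 -> 0 <= y <= 1 ->
  cont01 (fun t => a (x + t * (y - x))).
Proof.
move=> ca x01 y01 t t01 e e0.
have [d d0 h] := ca _ (convex01 x01 y01 t01) e e0.
exists d => // u u01 tu; apply: h; first exact: convex01.
move: x01 y01 => /andP[x0 x1] /andP[y0 y1].
rewrite (_ : _ - _ = (t - u) * (y - x)); last ring.
rewrite normrM; apply: le_lt_trans tu; rewrite ler_piMr // ler_norml; lra.
Qed.

Lemma cont01_cst o : cont01 (fun=> o).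
Proof. by move=> t _ e e0; exists 1 => // u _ _; rewrite /dst !subrr normr0 maxxx. Qed.

Lemma cont01_line p q : cont01 (fun t => (p.1 + t * (q.1 - p.1), p.2 + t * (q.2 - p.2))).
Proof.
move=> t t01 e e0; pose D := dst p q + 1.
have D0 : 0 < D by rewrite ltr_wpDl ?dst_ge0.
exists (e / D) => [|u u01]; first by rewrite divr_gt0.
rewrite ltr_pdivlMr // => h.
have [h1 h2] := dst_leP _ _ _ (lexx (dst p q)).
have K (v w : R) : `|v - w| <= dst p q -> `|v + t * (w - v) - (v + u * (w - v))| < e.
  move=> vw; rewrite (_ : _ - _ = (t - u) * (w - v)); last ring.
  rewrite normrM (distrC w); apply: le_lt_trans h.
  by rewrite ler_wpM2l // (le_trans vw) // lerDl.
by apply/dst_ltP; split; apply: K.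
Qed.

End Plane.

(** * Cutting off small squares around the vertices *)

Section Curves.
Local Open Scope ring_scope.
Variables (R : realType) (V E : finType).
Notation pt := (R * R)%type.
Variables (al be : E -> V) (pos : V -> pt).
Notation indep := (indep al be).

Record curves (ga : E -> R -> pt) (si : E -> E -> R) := Curves {
  cv_pos : injective pos;
  cv_bip : forall e f, al e != be f;
  cv_cont : forall e, cont01 (ga e);
  cv_0 : forall e, ga e 0 = pos (al e);
  cv_1 : forall e, ga e 1 = pos (be e);
  cv_vertex : forall e v t, 0 <= t <= 1 -> ga e t = pos v ->
    (v = al e /\ t = 0) \/ (v = be e /\ t = 1);
  cv_dep : forall e f s t, e != f -> ~~ indep e f -> 0 <= s <= 1 -> 0 <= t <= 1 ->
    ga e s = ga f t -> s = 0 \/ s = 1;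
  cv_si : forall e f, indep e f -> 0 < si e f < 1;
  cv_meet : forall e f, indep e f -> ga e (si e f) = ga f (si f e);
  cv_meet_uniq : forall e f s t, indep e f -> 0 <= s <= 1 -> 0 <= t <= 1 ->
    ga e s = ga f t -> s = si e f /\ t = si f e;
  cv_triple : forall e f g t, indep e f -> g != e -> g != f -> 0 < t < 1 ->
    ga e (si e f) != ga g t }.

Record middles (r : R) (m : E -> R -> pt) (si : E -> E -> R) := Middles {
  md_cont : forall e, cont01 (m e);
  md_dep : forall e f s t, e != f -> ~~ indep e f -> 0 <= s <= 1 -> 0 <= t <= 1 ->
    m e s <> m f t;
  md_si : forall e f, indep e f -> 0 < si e f < 1;
  md_meet : forall e f, indep e f -> m e (si e f) = m f (si f e);
  md_meet_uniq : forall e f s t, indep e f -> 0 <= s <= 1 -> 0 <= t <= 1 ->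
    m e s = m f t -> s = si e f /\ t = si f e;
  md_triple : forall e f g t, indep e f -> g != e -> g != f -> 0 <= t <= 1 ->
    m e (si e f) != m g t;
  md_r : 0 < r;
  md_pos : forall u v, u != v -> 2%:R * r < dst (pos u) (pos v);
  md_0 : forall e, dst (m e 0) (pos (al e)) = r;
  md_1 : forall e, dst (m e 1) (pos (be e)) = r;
  md_al : forall e t, 0 < t <= 1 -> r < dst (m e t) (pos (al e));
  md_be : forall e t, 0 <= t < 1 -> r < dst (m e t) (pos (be e));
  md_other : forall e v t, 0 <= t <= 1 -> v != al e -> v != be e ->
    r < dst (m e t) (pos v) }.

(** Each curve is kept from its last exit from the square at its start to its first entry into the
    square at its end, and rescaled. The radius is so small that a curve is within [r] of a vertex
    only at parameters within [d] of that end, and [d] is below the distance of every meeting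
    parameter from 0 and 1. So no meeting of independent edges is lost. *)
Lemma curves_middles ga si : curves ga si -> exists r m si', middles r m si'.
Proof.
move=> C.
have [ep ep0 Hep] : exists2 ep : R, 0 < ep & forall ep', 0 < ep' <= ep ->
    forall i : E * E, indep i.1 i.2 -> ep' < si i.1 i.2 < 1 - ep'.
  apply: (fin_small (P := fun i r => indep i.1 i.2 -> r < si i.1 i.2 < 1 - r)).
  move=> [e f] /=; have [ef|] := boolP (indep e f); last by exists 1.
  have /andP[s0 s1] := cv_si C ef.
  exists (Num.min (si e f) (1 - si e f) / 2%:R) => [|r' /andP[r0]].
    by rewrite divr_gt0 // lt_min s0 subr_gt0.
  rewrite ler_pdivlMr // le_min => /andP[h1 h2] _; lra.
pose d := Num.min ep 4^-1.
have [d0 dep d4] : [/\ 0 < d, d <= ep & d <= 4^-1].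
  by rewrite /d lt_min ep0 invr_gt0 ltr0n !ge_min !lexx orbT.
have {Hep ep0 dep} Hd e f : indep e f -> d < si e f < 1 - d.
  by apply: (Hep d _ (e, f)); rewrite d0.
have [r1 r10 H1] : exists2 r, 0 < r & forall r', 0 < r' <= r -> forall i : E * V,
    forall s, 0 <= s <= 1 -> dst (ga i.1 s) (pos i.2) <= r' ->
      (i.2 = al i.1 /\ s < d) \/ (i.2 = be i.1 /\ 1 - d < s).
  apply: (fin_small (P := fun i r => forall s, 0 <= s <= 1 -> dst (ga i.1 s) (pos i.2) <= r ->
      (i.2 = al i.1 /\ s < d) \/ (i.2 = be i.1 /\ 1 - d < s))) => -[e v] /=.
  have [s t s01 _|r r0 hr] := @sep R (ga e) (fun=> pos v)
      (fun s _ => (v = al e /\ s < d) \/ (v = be e /\ 1 - d < s)) (cv_cont C e)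
      (cont01_cst (pos v)).
    move=> /(cv_vertex C s01)[[-> ->]|[-> ->]]; exists d => // s' t' s'01 _.
      by rewrite sub0r normrN ger0_norm; [left | lra].
    by rewrite ger0_norm; [right; split => //; lra | lra].
  exists (r / 2%:R) => [|r' /andP[r'0]]; first by rewrite divr_gt0.
  rewrite ler_pdivlMr // => rr s s01 h; apply: (hr s s 0 0 _ _ _ _ _ _ (ga e s) (pos v)) => //;
    rewrite ?lexx ?ler01 ?subrr ?normr0 //; try exact: on_seg1; lra.
have [r2 r20 H2] : exists2 r, 0 < r & forall r', 0 < r' <= r -> forall i : V * V,
    i.1 != i.2 -> 2%:R * r' < dst (pos i.1) (pos i.2).
  apply: (fin_small (P := fun i r => i.1 != i.2 -> 2%:R * r < dst (pos i.1) (pos i.2))).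
  move=> [u v] /=; have [uv|uv] := eqVneq u v; first by exists 1.
  have D0 : 0 < dst (pos u) (pos v) by rewrite dst_gt0 (inj_eq (cv_pos C)).
  exists (dst (pos u) (pos v) / 4%:R) => [|r' /andP[r0]]; first by rewrite divr_gt0.
  by rewrite ler_pdivlMr // => h _; lra.
pose r := Num.min r1 r2.
have [r0 rr1 rr2] : [/\ 0 < r, r <= r1 & r <= r2] by rewrite /r lt_min r10 !ge_min !lexx orbT.
have {}H1 e v s : 0 <= s <= 1 -> dst (ga e s) (pos v) <= r ->
    (v = al e /\ s < d) \/ (v = be e /\ 1 - d < s).
  by apply: (H1 r _ (e, v)); rewrite r0.
have {}H2 u v : u != v -> 2%:R * r < dst (pos u) (pos v) by apply: (H2 r _ (u, v)); rewrite r0.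
have albe e : al e = be e -> False by move/eqP; rewrite (negbTE (cv_bip C e e)).
have Hx e : exists x, [/\ 0 < x < d, dst (ga e x) (pos (al e)) = r &
    forall t, x < t -> t <= 1 -> r < dst (ga e t) (pos (al e))].
  have [||x [x01 xr hx]] := @last_time R (ga e) (pos (al e)) r (cv_cont C e).
  - by rewrite (cv_0 C) /dst !subrr normr0 maxxx ltW.
  - rewrite ltNge; apply/negP => /H1 [|[_ ?]|[/albe]] //; [by rewrite ler01 lexx | lra].
  - have x01' : 0 <= x <= 1 by lra.
    exists x; split => //; have := H1 e (al e) x x01'; rewrite xr lexx.
    move=> /(_ isT) [[_ xd]|[/albe]] //; rewrite xd andbT lt_neqAle.
    case/andP: x01 => -> _; rewrite andbT; apply/eqP => x0; move: xr r0.
    by rewrite -x0 (cv_0 C) /dst !subrr normr0 maxxx => <-; rewrite ltxx.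
have Hy e : exists y, [/\ 1 - d < y < 1, dst (ga e y) (pos (be e)) = r &
    forall t, t < y -> 0 <= t -> r < dst (ga e t) (pos (be e))].
  have [||x [x01 xr hx]] := @last_time R (fun t => ga e (1 - t)) (pos (be e)) r
      (cont01_rev (cv_cont C e)).
  - by rewrite subr0 (cv_1 C) /dst !subrr normr0 maxxx ltW.
  - rewrite subrr ltNge; apply/negP => /H1 [|[/esym/albe]|[_ ?]] //; [by rewrite ler01 lexx | lra].
  - have x01' : 0 <= 1 - x <= 1 by lra.
    exists (1 - x); split => //; last first.
      move=> t tx t0; have := hx (1 - t) ltac:(lra) ltac:(lra).
      by rewrite opprB addrC subrK.
    have := H1 e (be e) (1 - x) x01'; rewrite xr lexx.
    move=> /(_ isT) [[/esym/albe]|[_ xd]] //; rewrite xd /= gtrBl lt_neqAle.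
    case/andP: x01 => -> _; rewrite andbT; apply/eqP => x0; move: xr r0.
    by rewrite -x0 subr0 (cv_1 C) /dst !subrr normr0 maxxx => <-; rewrite ltxx.
have [x {}Hx] := choice Hx; have [y {}Hy] := choice Hy.
have xy e : 0 < y e - x e.
  by have [/andP[_ ?] _ _] := Hx e; have [/andP[? _] _ _] := Hy e; lra.
pose m e t := ga e (x e + t * (y e - x e)).
pose si' e f := (si e f - x e) / (y e - x e).
have x01 e : 0 < x e < 1 by have [/andP[? ?] _ _] := Hx e; lra.
have y01 e : 0 < y e < 1 by have [/andP[? ?] _ _] := Hy e; lra.
have p01' e t : 0 <= t <= 1 -> x e <= x e + t * (y e - x e) <= y e.
  move=> /andP[t0 t1]; have := mulr_ge0 t0 (ltW (xy e)).
  have := ler_piMl (ltW (xy e)) t1; move: (_ * _) => u *; lra.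
have p01 e t : 0 <= t <= 1 -> 0 < x e + t * (y e - x e) < 1.
  by move=> /(p01' e); have := x01 e; have := y01 e; move: (_ + _ * _) => u *; lra.
have p01w e t : 0 <= t <= 1 -> 0 <= x e + t * (y e - x e) <= 1.
  by move=> /(p01 e) /andP[? ?]; rewrite !ltW.
have msi e f : m e (si' e f) = ga e (si e f).
  by rewrite /m /si' divfK ?gt_eqF // addrC subrK.
have siE e f t : x e + t * (y e - x e) = si e f -> t = si' e f.
  by move=> h; rewrite /si' -h addrAC subrr add0r mulfK // gt_eqF.
exists r, m, si'; split => //.
- by move=> e; apply: cont01_affine; [exact: (cv_cont C) | have := x01 e | have := y01 e]; lra.
- move=> e f s t ef nef s01 t01 /(cv_dep C ef nef (p01w _ _ s01) (p01w _ _ t01)).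
  by have := p01 e s s01; move: (_ + _ * _) => u; lra.
- move=> e f ef; have := Hd e f ef; have [/andP[_ ?] _ _] := Hx e.
  have [/andP[? _] _ _] := Hy e => ?.
  by rewrite /si' divr_gt0 ?ltr_pdivrMr ?mul1r //; lra.
- by move=> e f ef; rewrite !msi; apply: (cv_meet C).
- move=> e f s t ef s01 t01 h.
  have [h1 h2] := cv_meet_uniq C ef (p01w _ _ s01) (p01w _ _ t01) h.
  by split; apply: siE.
- by move=> e f g t ef ge gf t01; rewrite msi; apply: (cv_triple C); rewrite ?p01.
- by move=> e; rewrite /m mul0r addr0; have [] := Hx e.
- by move=> e; rewrite /m mul1r addrC subrK; have [] := Hy e.
- move=> e t /andP[t0 t1]; have [_ _] := Hx e; apply.
    by rewrite ltrDl mulr_gt0.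
  by have /andP[] := p01w e t ltac:(lra).
- move=> e t /andP[t0 t1]; have [_ _] := Hy e; apply.
    by rewrite -ltrBrDl gtr_pMl.
  by have /andP[] := p01w e t ltac:(lra).
- move=> e v t t01 va vb; rewrite ltNge; apply/negP => /(H1 _ _ _ (p01w _ _ t01)).
  by case=> -[h _]; move: va vb; rewrite h eqxx.
Qed.

End Curves.

Section Small.
Local Open Scope ring_scope.
Variable R : realType.
Notation pt := (R * R)%type.
Implicit Types (p q z o : pt) (a b : R -> pt).

Definition small (P : R -> Prop) := exists2 r, 0 < r & forall r', 0 < r' <= r -> P r'.

Lemma small_and P Q : small P -> small Q -> small (fun r => P r /\ Q r).
Proof.
move=> [r r0 hr] [s s0 hs]; exists (Num.min r s); first by rewrite lt_min r0.
by move=> r'; rewrite le_min => /and3P[h1 h2 h3]; split; [apply: hr | apply: hs]; rewrite h1.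
Qed.

Lemma small_sub (P : R -> Prop) : (exists2 r, 0 < r & P r) ->
  (forall r r', r' <= r -> P r -> P r') -> small P.
Proof. by move=> [r r0 hr] h; exists r => // r' /andP[_ hr']; apply: h hr. Qed.

Lemma small_imp (b : bool) P : (b -> small P) -> small (fun r => b -> P r).
Proof. by case: b => [/(_ isT) [r r0 hr]|_]; [exists r => // r' h _; apply: hr | exists 1]. Qed.

Lemma small_lt (x y : R) : x < y -> small (fun r => x + r < y).
Proof.
move=> xy; apply: small_sub; last by move=> r r' h1 h2; lra.
by exists ((y - x) / 2%:R); [rewrite divr_gt0 ?subr_gt0 | lra].
Qed.

Definition step b (d : R) (P : R -> pt -> Prop) := forall t t', 0 <= t <= 1 -> 0 <= t' <= 1 ->
  `|t - t'| < d -> forall z, on_seg (b t, b t') z -> P t z.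

Lemma on_seg_scale p q z : on_seg (p, q) z -> exists2 x, 0 <= x <= 1 &
  z = (p.1 + x * (q.1 - p.1), p.2 + x * (q.2 - p.2)) /\ dst p z = x * dst p q.
Proof.
move=> [x x01 ->]; exists x => //; split => //=; rewrite /dst /= maxr_pMr; last by case/andP: x01.
have K (v w : R) : `|v - (v + x * (w - v))| = x * `|v - w|.
  by rewrite -[x in RHS]ger0_norm -?normrM; [congr (`|_|); ring | case/andP: x01].
by rewrite !K.
Qed.

(** All points of the radius except [p] are closer than [r] to [o], so the curve misses the radius
    altogether; [sep] extends this to its short chords. *)
Lemma radius_off b o p (r : R) : cont01 b -> 0 < r -> dst p o = r ->
  (forall t, 0 <= t <= 1 -> r <= dst (b t) o /\ b t <> p) ->
  small (fun d => step b d (fun _ z => ~ on_seg (o, p) z)).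
Proof.
move=> cb r0 po hb; have [s t s01 t01 /esym E|d d0 hd] :=
  sep (cont01_line o p) cb (Good := fun _ _ => False).
  have : on_seg (o, p) (b t) by exists s.
  move=> /on_seg_scale[x /andP[x0 x1] [bE]]; rewrite (dstC o p) po => h.
  have [h1 h2] := hb t t01; move: h1; rewrite dstC h; case: (ltP x 1) => [x1'|h1 _].
    by rewrite leNgt gtr_pMl ?x1' /= ?r0.
  exfalso; apply: h2; rewrite bE (_ : x = 1); last by apply/eqP; rewrite eq_le x1.
  by rewrite !mul1r !subrKC; case: (p).
exists d => // d' /andP[d'0 d'd] t t' t01 t'01 tt z hz [s s01 zE].
apply: (hd s s t t' s01 s01 t01 t'01 _ _ z z) => //.
- by rewrite subrr normr0.
- exact: lt_le_trans tt d'd.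
- by rewrite zE; apply: (@on_seg1 _ (_, _)).
- by rewrite /dst !subrr normr0 maxxx.
Qed.

Lemma point_off b c : cont01 b -> (forall t, 0 <= t <= 1 -> b t <> c) ->
  small (fun d => step b d (fun _ z => d <= dst c z)).
Proof.
move=> cb h; have [s t _ t01 /esym /(h t t01)//|d d0 hd] :=
  sep (cont01_cst c) cb (Good := fun _ _ => False).
exists d => // d' /andP[d'0 d'd] t t' t01 t'01 tt z hz; rewrite leNgt; apply/negP => zc.
apply: (hd 0 0 t t' _ _ t01 t'01 _ _ c z) => //; rewrite ?lexx ?ler01 ?subrr ?normr0 //.
- exact: lt_le_trans tt d'd.
- exact: (@on_seg1 _ (_, _)).
- exact: lt_le_trans zc d'd.
Qed.

(** Two points on the boundary of a square, collinear with its centre, are equal or opposite, and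
    opposite points lie in different lexicographic halves. *)
Lemma same_ray o p q (r : R) : 0 < r -> dst p o = r -> dst q o = r ->
  lexlt o p = lexlt o q -> orient o p q = 0 -> p = q.
Proof.
case: o p q => [x y] [a b] [c d]; rewrite /dst /lexlt /orient /= => r0.
rewrite -(subr_gt0 x a) -(subr_gt0 x c) -(subr_gt0 y b) -(subr_gt0 y d).
rewrite -(subr_eq0 x a) -(subr_eq0 x c) -(opprB a) -(opprB c) !oppr_eq0.
move=> h1 h2 h3 h4; suff [] : a - x = c - x /\ b - y = d - y.
  by move=> /(addIr _) -> /(addIr _) ->.
move: (a - x) (b - y) (c - x) (d - y) h1 h2 h3 h4 => {a b c d x y} a b c d h1 h2 h3 h4.
have N (u v : R) : Num.max `|u| `|v| = r -> [/\ `|u| <= r, `|v| <= r & `|u| = r \/ `|v| = r].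
  move=> <-; split; rewrite ?le_max ?lexx ?orbT //.
  by rewrite /Num.max; case: ifP; auto.
have [a1 b1 ab] := N _ _ h1; have [c1 d1 cd] := N _ _ h2.
have E : a * d = b * c by lra.
have E' : `|a| * `|d| = `|b| * `|c| by rewrite -!normrM E.
have K (u v w : R) : u <= r -> v <= r -> 0 <= u -> 0 <= v -> u * v = r * r -> u = r.
  move=> u1 v1 u0 v0 e; apply/eqP; rewrite eq_le u1 /= -(ler_pM2r r0) -e.
  exact: ler_wpM2l.
have [[ar cr]|[br dr]] : (`|a| = r /\ `|c| = r) \/ (`|b| = r /\ `|d| = r).
  case: ab cd => [ar|br] [cr|dr]; try by [left | right].
  - by left; split => //; apply: (K _ `|b| 0) => //; rewrite mulrC -E' ar dr.
  - by left; split => //; apply: (K _ `|d| 0) => //; rewrite E' br cr.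
- have a0 : a != 0 by rewrite -normr_gt0 ar.
  have : a == c \/ a == - c by apply/orP; rewrite -eqr_norm2 ar cr.
  move=> [/eqP ac|/eqP ac].
    by split=> //; apply: (mulfI a0); rewrite E ac mulrC.
  have cc : c = - a by rewrite ac opprK.
  exfalso; move: h3; rewrite cc oppr_eq0 (negbTE a0) !orbF /= oppr_gt0.
  by case: (ltgtP a 0) a0 => // ->; rewrite eqxx.
- have b0 : b != 0 by rewrite -normr_gt0 br.
  have : b == d \/ b == - d by apply/orP; rewrite -eqr_norm2 br dr.
  move=> [/eqP bd|/eqP bd].
    by split=> //; apply: (mulfI b0); rewrite -E -bd mulrC.
  have dd : d = - b by rewrite bd opprK.
  have cc : c = - a by apply: (mulfI b0); rewrite -E dd; ring.
  exfalso; move: h3; rewrite cc dd oppr_eq0 !oppr_gt0.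
  case: (ltgtP a 0) => //= _; by case: (ltgtP b 0) b0 => // ->; rewrite eqxx.
Qed.

End Small.

(** * Rounding parameters to a grid *)

Section Grid.
Local Open Scope ring_scope.
Variables (R : realType) (K W : nat).
Hypotheses (K0 : (0 < K)%N) (W2 : (1 < W)%N).
Notation N := (K * W)%N.
Implicit Types (s t : R) (k : nat).

(** The mesh has two scales: [K] separates the meeting parameters, and [W] subdivides each of the
    [K] intervals as finely as desired without affecting that separation. *)
Definition grid k : R := k%:R / N%:R.
Definition cell s : nat := Num.truncn (s * N%:R).

Let N0 : 0 < N%:R :> R.
Proof. by rewrite ltr0n muln_gt0 K0 ltnW. Qed.

Let WN : W%:R = N%:R / K%:R :> R.
Proof. by rewrite natrM mulrC mulKf // pnatr_eq0 -lt0n. Qed.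

Let mulW (c : R) : c * W%:R = c / K%:R * N%:R.
Proof. by rewrite WN mulrA mulrAC. Qed.

Let cellP s : 0 < s -> (cell s)%:R <= s * N%:R < (cell s)%:R + 1.
Proof.
by move=> s0; rewrite natr1; apply/truncn_itv/mulr_ge0; exact: ltW.
Qed.

Lemma grid01 k : (k <= N)%N -> 0 <= grid k <= 1.
Proof.
by move=> kN; rewrite divr_ge0 ?ler0n //= ler_pdivrMr // mul1r ler_nat.
Qed.

Lemma grid_step k : `|grid k - grid k.+1| = N%:R^-1.
Proof.
rewrite /grid -mulrBl -natr1 opprD addrA subrr add0r mulN1r normrN.
by rewrite gtr0_norm // invr_gt0.
Qed.

Lemma cell_grid s : 0 < s -> `|s - grid (cell s)| < N%:R^-1.
Proof.
move=> s0; have /andP[h1 h2] := cellP s0.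
have sE : s = s * N%:R / N%:R by rewrite mulfK // gt_eqF.
rewrite {1}sE /grid -mulrBl normrM [X in _ * X]gtr0_norm ?invr_gt0 //.
by rewrite gtr_pMl ?invr_gt0 // ger0_norm; lra.
Qed.

Let gridN k : grid k * N%:R = k%:R.
Proof. by rewrite divfK // gt_eqF. Qed.

(** The distance 1/(2K) is W/2 grid steps and rounding costs one more, which together is at most W
    as W >= 2. *)
Lemma cell_near s k : 0 < s -> `|grid k - s| < (2 * K)%:R^-1 ->
  (k <= cell s + W)%N && (cell s <= k + W)%N.
Proof.
move=> s0; rewrite natrM invfM => h; have /andP[h1 h2] := cellP s0.
have {h} : `|k%:R - s * N%:R| < 2%:R^-1 * W%:R.
  by rewrite -(gridN k) -mulrBl normrM [X in _ * X]gtr0_norm // WN mulrA mulrAC ltr_pM2r.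
have W2' : 2%:R <= W%:R :> R by rewrite ler_nat.
rewrite ltr_norml => /andP[h3 h4].
by apply/andP; split; rewrite -(ler_nat R) natrD; lra.
Qed.

Lemma cell_lo s : 4%:R / K%:R < s -> (3 * W < cell s)%N.
Proof.
move=> h; have s0 : 0 < s by apply: le_lt_trans h; rewrite divr_ge0.
have /andP[h1 h2] := cellP s0.
have W2' : 2%:R <= W%:R :> R by rewrite ler_nat.
have : 4%:R * W%:R < s * N%:R by rewrite mulW ltr_pM2r.
by rewrite -(ltr_nat R) natrM; lra.
Qed.

Lemma cell_hi s : 0 < s -> s < 1 - 4%:R / K%:R -> (cell s + 3 * W < N)%N.
Proof.
move=> s0 h; have /andP[h1 h2] := cellP s0.
have W2' : 2%:R <= W%:R :> R by rewrite ler_nat.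
have : s * N%:R < N%:R - 4%:R * W%:R.
  by rewrite mulW -[X in X - _]mul1r -mulrBl ltr_pM2r.
rewrite -(ltr_nat R) natrD (natrM _ 3); lra.
Qed.

Lemma cell_gap s t : 0 < s -> 0 < t -> 8%:R / K%:R < `|s - t| ->
  (cell s + 6 * W < cell t)%N \/ (cell t + 6 * W < cell s)%N.
Proof.
move=> s0 t0; have /andP[h1 h2] := cellP s0; have /andP[h3 h4] := cellP t0.
have W2' : 2%:R <= W%:R :> R by rewrite ler_nat.
rewrite -(ltr_pM2r N0) -[X in _ < _ * X -> _]gtr0_norm // -normrM mulrBl.
rewrite -mulW.
rewrite lter_normr => /orP[] h; [right | left]; rewrite -(ltr_nat R) natrD (natrM _ 6); lra.
Qed.

End Grid.

(** * Sampling the middles into a polygonal system *)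

Section Discretize.
Local Open Scope ring_scope.
Variables (R : realType) (V E : finType).
Notation pt := (R * R)%type.
Variables (al be : E -> V) (pos : V -> pt).
Notation indep := (indep al be).
Variables (r : R) (m : E -> R -> pt) (si : E -> E -> R).
Hypothesis M : middles al be pos r m si.
Hypothesis bip : forall e f, al e != be f.
Hypothesis inj : forall e f, al e = al f -> be e = be f -> e = f.

Let small_all (I : finType) (P : I -> R -> Prop) :
  (forall i, small (P i)) -> small (fun d => forall i, P i d).
Proof. exact: fin_small. Qed.

(** Two meetings on [e] at the same parameter would put a meeting point of two edges on a third one,
    against [md_triple]. *)
Let gaps : small (fun d => forall i : E * E * E, indep i.1.1 i.1.2 ->
  d < si i.1.1 i.1.2 < 1 - d /\
  (indep i.1.1 i.2 -> i.1.2 != i.2 -> d < `|si i.1.1 i.1.2 - si i.1.1 i.2|)).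
Proof.
apply: small_all => -[[e f] g] /=; apply: small_imp => ef.
have /andP[s0 s1] := md_si M ef.
apply: small_and.
  have [d d0 hd] := small_and (small_lt s0) (small_lt s1).
  by exists d => // r' /hd[]; rewrite add0r => -> /=; lra.
apply: small_imp => eg; apply: small_imp => fg.
have : 0 < `|si e f - si e g|.
  rewrite normr_gt0 subr_eq0; apply/negP => /eqP h.
  have ge : g != e by apply: contraTneq eg => ->; rewrite /indep eqxx.
  have := md_triple M ef ge; rewrite eq_sym => /(_ (si g e) fg).
  have eg' : indep g e by rewrite indepC.
  have /andP[? ?] := md_si M eg'.
  by rewrite h (md_meet M eg) eqxx => /(_ ltac:(lra)).
by move=> /small_lt[d d0 hd]; exists d => // r' /hd; rewrite add0r.
Qed.

Let mid_mid (h : R) : 0 < h -> small (fun d => forall i : E * E, i.1 != i.2 ->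
  forall s s' t t', 0 <= s <= 1 -> 0 <= s' <= 1 -> 0 <= t <= 1 -> 0 <= t' <= 1 ->
  `|s - s'| < d -> `|t - t'| < d -> forall z, on_seg (m i.1 s, m i.1 s') z ->
  on_seg (m i.2 t, m i.2 t') z ->
  [/\ indep i.1 i.2, `|s - si i.1 i.2| < h & `|t - si i.2 i.1| < h]).
Proof.
move=> h0; apply: small_all => -[e f] /=; apply: small_imp => ef.
have [s t s01 t01 E0|d d0 hd] := sep (md_cont M e) (md_cont M f)
   (Good := fun s t => [/\ indep e f, `|s - si e f| < h & `|t - si f e| < h]).
  have [i|ni] := boolP (indep e f); last by case: (md_dep M ef ni s01 t01 E0).
  have [-> ->] := md_meet_uniq M i s01 t01 E0.
  by exists h => // s' t' _ _ h1 h2; rewrite distrC h1 distrC h2.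
exists d => // d' /andP[d'0 d'd] s s' t t' s01 s'01 t01 t'01 ss tt z hz hz'.
apply: (hd s s' t t' s01 s'01 t01 t'01 _ _ z z) => //; try exact: lt_le_trans d'd.
by rewrite /dst !subrr normr0 maxxx.
Qed.

Let mid_ge e v t : 0 <= t <= 1 -> r <= dst (m e t) (pos v).
Proof.
move=> t01; have [->|va] := eqVneq v (al e).
  have [->|t0] := eqVneq t 0; first by rewrite (md_0 M).
  by apply/ltW/(md_al M); rewrite lt_neqAle eq_sym t0.
have [->|vb] := eqVneq v (be e).
  have [->|t1] := eqVneq t 1; first by rewrite (md_1 M).
  by apply/ltW/(md_be M); rewrite lt_neqAle t1.
exact/ltW/(md_other M).
Qed.

Let pos_mid : small (fun d => forall i : E * V,
  step (m i.1) d (fun _ z => d <= dst (pos i.2) z)).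
Proof.
apply: small_all => -[e v] /=; apply: (point_off (md_cont M e)) => t t01 h.
have := mid_ge e v t01; rewrite h /dst !subrr normr0 maxxx.
by rewrite leNgt (md_r M).
Qed.

Let nindep_al e f : al e = al f -> ~~ indep e f.
Proof. by rewrite /indep => ->; rewrite eqxx. Qed.

Let nindep_be e f : be e = be f -> ~~ indep e f.
Proof. by rewrite /indep => ->; rewrite eqxx andbF. Qed.

Let mid_neq e f s t : e != f -> s = 0 \/ s = 1 -> 0 <= t <= 1 -> m f t <> m e s.
Proof.
move=> ef s01 t01 h; have s01' : 0 <= s <= 1 by case: s01 => ->; rewrite ?lexx ?ler01.
have [i|ni] := boolP (indep e f); last by case: (md_dep M ef ni s01' t01).
have [sE _] := md_meet_uniq M i s01' t01 (esym h).
by have := md_si M i; case: s01 => hs; rewrite -sE hs ltxx ?andbF.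
Qed.

(** The order of choices matters: [K] from the gaps between meetings, then [d] so that chords of
    parameter length below [d] come together only within 1/(2K) of a meeting, then [d1] so that
    samples within [d1] of a meeting lie within [d] of the common point, and last [W], so that the
    mesh 1/(K W) is below [d] and [d1]. *)
Theorem middles_system : exists N W q kk, system al be pos N W q kk.
Proof.
have [g g0 /(_ g)] := gaps; rewrite g0 lexx => /(_ isT) G.
pose K := (Num.truncn (8%:R / g)).+1.
have K0 : 0 < K%:R :> R by rewrite ltr0n.
have Kg : 8%:R / K%:R < g by rewrite ltr_pdivrMr // mulrC -ltr_pdivrMr // truncnS_gt.
have gap e f f' : indep e f -> indep e f' -> f != f' -> 8%:R / K%:R < `|si e f - si e f'|.
  by move=> h1 h2 h3; apply: lt_trans Kg _; have [_] := G (e, f, f') h1; apply.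
have si01 e f : indep e f -> 4%:R / K%:R < si e f < 1 - 4%:R / K%:R.
  have : 8%:R / K%:R = 2%:R * (4%:R / K%:R) :> R by rewrite mulrA -natrM.
  have : 0 < 4%:R / K%:R :> R by rewrite divr_gt0.
  by move: (4%:R / _) => x x0 xE h; have [/= + _] := G (e, f, f) h; rewrite xE in Kg; lra.
pose c e f := m e (si e f).
have rad_al : small (fun d => forall i : E * E, i.1 != i.2 ->
    step (m i.2) d (fun _ z => ~ on_seg (pos (al i.1), m i.1 0) z)).
  apply: small_all => -[e f] /=; apply: small_imp => ef.
  apply: (radius_off (md_cont M f) (md_r M) (md_0 M e)) => t t01.
  by split; [exact: mid_ge | apply: mid_neq => //; left].
have rad_be : small (fun d => forall i : E * E, i.1 != i.2 ->
    step (m i.2) d (fun _ z => ~ on_seg (pos (be i.1), m i.1 1) z)).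
  apply: small_all => -[e f] /=; apply: small_imp => ef.
  apply: (radius_off (md_cont M f) (md_r M) (md_1 M e)) => t t01.
  by split; [exact: mid_ge | apply: mid_neq => //; right].
have jmp : small (fun d => forall i : E * E * E, indep i.1.1 i.1.2 -> i.2 != i.1.1 ->
    i.2 != i.1.2 -> step (m i.2) d (fun _ z => d <= dst (c i.1.1 i.1.2) z)).
  apply: small_all => -[[e f] h] /=; do 3! (apply: small_imp => ?).
  apply: (point_off (md_cont M h)) => t t01; apply/eqP.
  by rewrite eq_sym; apply: (md_triple M).
have jmps : small (fun d => forall i : E * E * (E * E), indep i.1.1 i.1.2 ->
    indep i.2.1 i.2.2 -> i.2.1 != i.1.1 -> i.2.1 != i.1.2 ->
    0 + d < 2%:R^-1 * dst (c i.1.1 i.1.2) (c i.2.1 i.2.2)).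
  apply: small_all => -[[e f] [h h']] /=; apply: small_imp => ?; apply: small_imp => hh.
  do 2! (apply: small_imp => ?).
  apply: small_lt; rewrite mulr_gt0 ?invr_gt0 ?ltr0n // dst_gt0; apply: (md_triple M) => //.
  by have /andP[? ?] := md_si M hh; rewrite !ltW.
have h0 : 0 < (2 * K)%:R^-1 :> R by rewrite invr_gt0 ltr0n.
have [d d0] := small_and (mid_mid h0) (small_and pos_mid (small_and rad_al
  (small_and rad_be (small_and jmp jmps)))).
move=> /(_ d); rewrite d0 lexx => /(_ isT) [Hmid [Hpos [Hral [Hrbe [Hj Hjj]]]]].
have [d1 d10 /(_ d1)] : small (fun d1 => forall i : E * E, indep i.1 i.2 ->
    forall u, 0 <= u <= 1 -> `|si i.1 i.2 - u| < d1 -> dst (c i.1 i.2) (m i.1 u) < d).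
  apply: small_all => -[e f] /=; apply: small_imp => ef; apply: small_sub.
    by have /andP[? ?] := md_si M ef; apply: (md_cont M) => //; rewrite !ltW.
  by move=> r1 r2 r12 h u u01 hu; apply: h => //; apply: lt_le_trans r12.
rewrite d10 lexx => /(_ isT) Hc.
pose W := (Num.truncn (Num.min d d1)^-1).+2.
have dd0 : 0 < Num.min d d1 by rewrite lt_min d0.
have [Nd Nd1] : (K * W)%:R^-1 < d /\ (K * W)%:R^-1 < d1.
  apply/andP; rewrite -lt_min invf_plt ?posrE // ?ltr0n //.
  apply: lt_le_trans (truncnS_gt _) _; rewrite ler_nat.
  by rewrite (leq_trans (leqnSn _)) // leq_pmull.
pose q e k := m e (grid R K W k); pose kk e f := cell K W (si e f).
have stp k : (k < K * W)%N -> [/\ 0 <= grid R K W k <= 1, 0 <= grid R K W k.+1 <= 1 &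
    `|grid R K W k - grid R K W k.+1| < d].
  by move=> kN; rewrite !grid01 ?grid_step // ltnW.
have q0 e : q e 0%N = m e 0 by rewrite /q /grid mul0r.
have qN e : q e (K * W)%N = m e 1 by rewrite /q /grid divff // pnatr_eq0.
have si0 e f : indep e f -> 0 < si e f by move=> /(md_si M)/andP[].
have K1 : (0 < K)%N by [].
have W1 : (1 < W)%N by [].
have hi e f : indep e f -> (kk e f + 3 * W < K * W)%N.
  by move=> ef; have /andP[_ h] := si01 _ _ ef; apply: (cell_hi K1 W1 (si0 _ _ ef) h).
have kk01 e f : indep e f -> 0 <= grid R K W (kk e f) <= 1.
  move=> /hi h; apply: grid01 => //.
  exact: leq_trans (leq_addr (3 * W) _) (ltnW h).
have ckk e f : indep e f -> dst (c e f) (q e (kk e f)) < d.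
  move=> ef; apply: (Hc (e, f)) => //=; first exact: kk01.
  exact: lt_trans (cell_grid K1 W1 (si0 _ _ ef)) Nd1.
have cjump e f z : indep e f -> on_seg (jump q kk e f) z -> dst (c e f) z < d.
  move=> ef hz; have fe : indep f e by rewrite indepC.
  by apply: (on_seg_dst hz); rewrite ?ckk // /c (md_meet M ef) ckk.
have ra_r e z : on_seg (ra al pos q e) z -> dst (pos (al e)) z <= r.
  by move=> /on_seg_dst_start; rewrite q0 (dstC _ (m e 0)) (md_0 M).
have rb_r e z : on_seg (rb be pos (K * W) q e) z -> dst (pos (be e)) z <= r.
  by move=> /on_seg_rev/on_seg_dst_start; rewrite qN (dstC _ (m e 1)) (md_1 M).
have far u v z : dst (pos u) z <= r -> dst (pos v) z <= r -> u = v.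
  move=> hu hv; apply/eqP/negPn/negP => /(md_pos M).
  by have := dst_tri (pos u) z (pos v); rewrite (dstC z); lra.
have far' u v : dst (pos u) (pos v) <= r -> v = u.
  by move=> h; apply/esym/(far _ _ _ h); rewrite /dst !subrr normr0 maxxx ltW // (md_r M).
exists (K * W)%N, W, q, kk; split => //.
- move=> u v uv; apply/esym/far'; rewrite uv /dst !subrr normr0 maxxx ltW //; exact: md_r M.
- move=> e f k l ef /stp[k0 k1 kd] /stp[l0 l1 ld]; apply: contraNP => /existsNP[z].
  move=> /not_implyP[hz] /contrapT hz'.
  have [i h1 h2] := Hmid (e, f) ef _ _ _ _ k0 k1 l0 l1 kd ld z hz hz'.
  have i' : indep f e by rewrite indepC.
  by rewrite i /=; apply/andP; split; apply: (cell_near K1 W1 (si0 _ _ _)).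
- move=> e f l ef /stp[l0 l1 ld] z hz hz'.
  by apply: (Hral (e, f) ef _ _ l0 l1 ld z hz'); rewrite -q0.
- move=> e f l ef /stp[l0 l1 ld] z /on_seg_rev hz hz'.
  by apply: (Hrbe (e, f) ef _ _ l0 l1 ld z hz'); rewrite -qN.
- by move=> e f ef z /ra_r h1 /ra_r h2; move: ef; rewrite (far _ _ _ h1 h2) eqxx.
- by move=> e f ef z /rb_r h1 /rb_r h2; move: ef; rewrite (far _ _ _ h1 h2) eqxx.
- by move=> e f ef z /ra_r h1 /rb_r h2; have := bip e f; rewrite (far _ _ _ h1 h2) eqxx.
- move=> e k v /stp[k0 k1 kd] h; have := Hpos (e, v) _ _ k0 k1 kd _ h.
  by rewrite /dst !subrr normr0 maxxx leNgt d0.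
- by move=> e v /ra_r/far'.
- by move=> e v /rb_r/far'.
- by move=> e f f' h1 h2 h3; apply: (cell_gap K1 W1 (si0 _ _ h1) (si0 _ _ h2) (gap _ _ _ h1 h2 h3)).
- by move=> e f /si01/andP[h1 h2]; apply: (cell_lo K1 W1 h1).
- move=> e f h l ef he hf /stp[l0 l1 ld] z /(cjump _ _ _ ef) h1 h2.
  by have := Hj (e, f, h) ef he hf _ _ l0 l1 ld z h2; rewrite leNgt h1.
- move=> e f h h' ef hh he hf _ _ z /(cjump _ _ _ ef) h1 /(cjump _ _ _ hh) h2.
  have := Hjj ((e, f), (h, h')) ef hh he hf; have := dst_tri (c e f) z (c h h').
  by rewrite /= (dstC z); lra.
- move=> e f ef ae; rewrite !q0 => hl; apply/eqP => h0'.
  have E0 : m e 0 = m f 0.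
    by apply: (same_ray (md_r M) (md_0 M e) _ _ h0'); rewrite ae ?(md_0 M) // -{1}ae.
  by apply: (md_dep M ef (nindep_al ae) _ _ E0); rewrite lexx ler01.
- move=> e f ef ae; rewrite !qN => hl; apply/eqP => h0'.
  have E0 : m e 1 = m f 1.
    by apply: (same_ray (md_r M) (md_1 M e) _ _ h0'); rewrite ae ?(md_1 M) // -{1}ae.
  by apply: (md_dep M ef (nindep_be ae) _ _ E0); rewrite lexx ler01.
- by move=> e; rewrite -dst_gt0 q0 (md_0 M) (md_r M).
- by move=> e; rewrite -dst_gt0 qN (md_1 M) (md_r M).
Qed.

End Discretize.

Definition cuts (V : finType) (side : {ffun V -> bool}) (e : {set V}) :=
  [exists u in e, side u] && [exists v in e, ~~ side v].

(** Average over all sides: moving one end of an edge to the other side exchanges the sides that cut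
    this edge with those that do not, so each edge is cut by exactly half of them. *)
Lemma half_cut (V : finType) (A : {set {set V}}) :
  (forall e, e \in A -> exists u v, u != v /\ e = [set u; v]%SET) ->
  exists side : {ffun V -> bool}, #|A| <= 2 * #|[set e in A | cuts side e]%SET|.
Proof.
move=> hA; apply/existsP; apply: contraT => /existsPn h.
have T0 : 0 < #|{: {ffun V -> bool}}| by apply/card_gt0P; exists [ffun=> false].
suff E : \sum_(side : {ffun V -> bool}) 2 * #|[set e in A | cuts side e]%SET| =
    #|{: {ffun V -> bool}}| * #|A|.
  suff : \sum_(side : {ffun V -> bool}) 2 * #|[set e in A | cuts side e]%SET| <
    #|{: {ffun V -> bool}}| * #|A| by rewrite E ltnn.
  have /card_gt0P[s0 _] := T0.
  rewrite -sum_nat_const (bigD1 s0) //= [X in _ < X](bigD1 s0) //= -addSn.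
  apply: leq_add; first by rewrite ltnNge h.
  by apply: leq_sum => s _; rewrite ltnW // ltnNge h.
rewrite -big_distrr /= (eq_bigr (fun s => \sum_(e in A) (cuts s e : nat))); last first.
  move=> s _; rewrite -sum1_card [RHS]big_mkcond [LHS]big_mkcond /=.
  by apply: eq_bigr => e _; rewrite inE; case: (e \in A); case: (cuts s e).
rewrite exchange_big big_distrr /= mulnC -sum_nat_const; apply: eq_bigr => e eA.
have [u [v [uv ->]]] := hA e eA.
pose flip (s : {ffun V -> bool}) : {ffun V -> bool} := [ffun x => (x == u) (+) s x].
have flipK : involutive flip by move=> s; apply/ffunP => x; rewrite !ffunE addKb.
have cutE s : cuts s [set u; v]%SET = s u (+) s v.
  apply/andP/idP => [[/exists_inP[x xe sx] /exists_inP[y ye sy]]|].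
    move: xe ye sx sy; rewrite !inE => /orP[]/eqP -> /orP[]/eqP ->;
      by case: (s u); case: (s v).
  by case su: (s u); case sv: (s v) => // _; split; apply/exists_inP;
    [exists u | exists v | exists v | exists u]; rewrite ?inE ?eqxx ?orbT ?su ?sv.
rewrite mul2n -addnn {2}(reindex_inj (inv_inj flipK)) -big_split /= -sum1_card.
apply: eq_bigr => s _; rewrite !cutE !ffunE eqxx eq_sym (negbTE uv).
by case: (s u); case: (s v).
Qed.

(** * From a tangled-thrackle to a bipartite system of curves *)

Section Thrackle.
Local Open Scope classical_set_scope.
Local Open Scope ring_scope.
Variables (R : realType) (G : sgraph) (pos : G -> R * R) (arc : {set G} -> R -> R * R).
Hypothesis T : tangled_thrackle pos arc.
Variable side : {ffun G -> bool}.

Record oriented_arc (e : {set G}) (a b : G) (ga : R -> R * R) : Prop := OrientedArc {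
  oa_ends : e = [set a; b]%SET;
  oa_side : side a && ~~ side b;
  oa_cont : cont01 ga;
  oa_inj : forall s t, 0 <= s <= 1 -> 0 <= t <= 1 -> ga s = ga t -> s = t;
  oa_0 : ga 0 = pos a;
  oa_1 : ga 1 = pos b;
  oa_pts : forall p, arc_pts (arc e) p <-> exists2 t, 0 <= t <= 1 & ga t = p;
  oa_int : forall t, 0 < t < 1 -> arc_int (arc e) (ga t) }.

Lemma oriented_arcP e : e \in edges G -> cuts side e ->
  exists x : G * G * (R -> R * R), oriented_arc e x.1.1 x.1.2 x.2.
Proof.
move=> eG; case: T => -[_ /(_ e eG)[[/within_cont01 ca ia] [u [v [E a0 a1]]]] _] cut.
have inj s t : 0 <= s <= 1 -> 0 <= t <= 1 -> arc e s = arc e t -> s = t.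
  by move=> s01 t01; apply: ia; rewrite ?inE /= ?in_itv /=.
have : (side u && ~~ side v) || (side v && ~~ side u).
  move: cut; rewrite E => /andP[/exists_inP[x xe sx] /exists_inP[y ye sy]].
  move: xe ye sx sy; rewrite !inE => /orP[]/eqP -> /orP[]/eqP ->;
    by case: (side u); case: (side v).
case/orP => uv.
  exists (u, v, arc e); split => //=.
  by move=> t t01; exists t; rewrite /= ?in_itv.
exists (v, u, fun t => arc e (1 - t)); split => //=.
- by rewrite E finset.setUC.
- exact: cont01_rev.
- move=> s t s01 t01 h; have := inj (1 - s) (1 - t) ltac:(lra) ltac:(lra) h; lra.
- by rewrite subr0.
- by rewrite subrr.
- move=> p; split=> -[t].
    by rewrite /= ?in_itv /= => t01 <-; exists (1 - t); [lra | rewrite subKr].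
  by move=> t01 <-; exists (1 - t); rewrite //= ?in_itv /=; lra.
- by move=> t t01; exists (1 - t); rewrite //= ?in_itv /=; lra.
Qed.

Let E := {e : {set G} | (e \in edges G) && cuts side e}.

(** The cut orients every arc from the true side to the false side, so a common vertex of two edges
    is the start of both or the end of both. It is then their only common point. The common point of
    independent edges is interior to both, since an edge avoids all vertices but its ends. *)
Lemma thrackle_curves : exists al be : E -> G, exists ga si,
  [/\ curves al be pos ga si, forall e f, al e != be f &
   forall e f, al e = al f -> be e = be f -> e = f].
Proof.
have eE (e : E) : val e \in edges G by case/andP: (valP e).
have /choice[x X] (e : E) : exists x : G * G * (R -> R * R),
    oriented_arc (val e) x.1.1 x.1.2 x.2.
  by case/andP: (valP e); apply: oriented_arcP.
pose al e := (x e).1.1; pose be e := (x e).1.2; pose ga e := (x e).2.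
have {}X e : oriented_arc (val e) (al e) (be e) (ga e) := X e.
case: T => _ [Ta _ Tc Td].
have bip e f : al e != be f.
  by have /andP[h _] := oa_side (X e); have /andP[_ h'] := oa_side (X f);
    apply: contraNneq h' => <-.
have inj e f : al e = al f -> be e = be f -> e = f.
  by move=> h h'; apply: val_inj; rewrite (oa_ends (X e)) (oa_ends (X f)) h h'.
have pts e t : 0 <= t <= 1 -> arc_pts (arc (val e)) (ga e t).
  by move=> t01; apply/(oa_pts (X e)); exists t.
have vertex e v t : 0 <= t <= 1 -> ga e t = pos v -> (v = al e /\ t = 0) \/ (v = be e /\ t = 1).
  move=> t01 h; have /= := Ta _ v (eE e); have := pts e t t01; rewrite h => hp /(_ _ hp).
  have [ve _|_ /(_ isT)//] := boolP (v \in val e).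
  move: ve; rewrite (oa_ends (X e)) !inE => /orP[]/eqP vE; [left|right]; split => //.
    by apply: (oa_inj (X e)) => //; [lra | rewrite h vE (oa_0 (X e))].
  by apply: (oa_inj (X e)) => //; [lra | rewrite h vE (oa_1 (X e))].
have uniq e f : e != f -> exists s t, [/\ 0 <= s <= 1, 0 <= t <= 1, ga e s = ga f t &
    forall s' t', 0 <= s' <= 1 -> 0 <= t' <= 1 -> ga e s' = ga f t' -> s' = s].
  move=> ef; have [p [pE _]] := Td _ _ (eE e) (eE f) ef.
  have : [set p] p by []. rewrite -pE => -[/(oa_pts (X e))[s s01 sp] /(oa_pts (X f))[t t01 tp]].
  exists s, t; split=> // [|s' t' s'01 t'01 h]; first by rewrite sp.
  apply: (oa_inj (X e)) => //; rewrite sp; suff : [set p] (ga e s') by [].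
  by rewrite -pE; split; [|rewrite h]; apply: pts.
have [si S] : exists si : E -> E -> R, forall e f, e != f ->
    [/\ 0 <= si e f <= 1, exists2 t, 0 <= t <= 1 & ga e (si e f) = ga f t &
    forall s t, 0 <= s <= 1 -> 0 <= t <= 1 -> ga e s = ga f t -> s = si e f].
  have /choice[si S] (i : E * E) : exists s0 : R, i.1 != i.2 ->
      [/\ 0 <= s0 <= 1, exists2 t, 0 <= t <= 1 & ga i.1 s0 = ga i.2 t &
      forall s t, 0 <= s <= 1 -> 0 <= t <= 1 -> ga i.1 s = ga i.2 t -> s = s0].
    (* On the diagonal the value 0 is only a default. *)
    case: i => e f /=; have [->|/uniq[s [t [s01 t01 st h]]]] := eqVneq e f; first by exists 0.
    by exists s => _; split => //; exists t.
  by exists (fun e f => si (e, f)) => e f; apply: (S (e, f)).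
have meetU e f s t : e != f -> 0 <= s <= 1 -> 0 <= t <= 1 -> ga e s = ga f t ->
    s = si e f /\ t = si f e.
  move=> ef s01 t01 h; have [_ _ U] := S e f ef; rewrite eq_sym in ef.
  by have [_ _ U'] := S f e ef; split; [apply: U h | apply: U' (esym h)].
have meet e f : e != f -> ga e (si e f) = ga f (si f e).
  move=> ef; have [s01 [t t01 h] _] := S e f ef.
  by have [_ <-] := meetU _ _ _ _ ef s01 t01 h.
have neq e f : indep al be e f -> e != f.
  by apply: contraTneq => ->; rewrite /indep eqxx.
have si01 e f : indep al be e f -> 0 < si e f < 1.
  move=> i; have [/andP[s0 s1] [t t01 h] _] := S e f (neq _ _ i).
  move: i; rewrite /indep => /andP[aa bb].
  rewrite !lt_neqAle s0 s1 !andbT eq_sym; apply/andP; split; apply/eqP => e01.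
    move: h; rewrite e01 (oa_0 (X e)) => /esym /(vertex _ _ _ t01)[[h _]|[h _]].
      by rewrite h eqxx in aa.
    by have := bip e f; rewrite h eqxx.
  move: h; rewrite e01 (oa_1 (X e)) => /esym /(vertex _ _ _ t01)[[h _]|[h _]].
    by have := bip f e; rewrite h eqxx.
  by rewrite h eqxx in bb.
exists al, be, ga, si; split=> //; split => //.
- by case: T => -[].
- by move=> e; apply: oa_cont (X e).
- by move=> e; apply: oa_0 (X e).
- by move=> e; apply: oa_1 (X e).
- move=> e f s t ef; rewrite negb_and !negbK => ab s01 t01 h.
  have [sE _] := meetU e f s t ef s01 t01 h.
  have I0 : 0 <= (0 : R) <= 1 by rewrite lexx ler01.
  have I1 : 0 <= (1 : R) <= 1 by rewrite lexx ler01.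
  case/orP: ab => /eqP ab; [left|right].
    have [] := meetU e f 0 0 ef I0 I0; last by rewrite sE.
    by rewrite (oa_0 (X e)) (oa_0 (X f)) ab.
  have [] := meetU e f 1 1 ef I1 I1; last by rewrite sE.
  by rewrite (oa_1 (X e)) (oa_1 (X f)) ab.
- by move=> e f /neq/meet.
- by move=> e f s t /neq; apply: meetU.
- move=> e f g t i ge gf t01; apply/eqP => h; have ef := neq _ _ i.
  have := Tc _ _ _ (eE e) (eE f) (eE g) ef.
  rewrite ![val e == _]eq_sym ![val f == val g]eq_sym => /(_ ge gf).
  suff : (arc_int (arc (val e)) `&` arc_int (arc (val f)) `&` arc_int (arc (val g))) (ga g t).
    by move=> + E0; rewrite E0.
  split; last exact: (oa_int (X g)).
  split; first by rewrite -h; apply: (oa_int (X e)); apply: si01.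
  by rewrite -h meet //; apply: (oa_int (X f)); apply: si01; rewrite indepC.
Qed.

End Thrackle.

Theorem theorem1p2 :
  exists C : nat,
    forall (R : realType) (G : sgraph)
      (pos : G -> R * R) (arc : {set G} -> R -> R * R),
      tangled_thrackle pos arc ->
      #|edges G| <= C * #|G|.
Proof.
have [C hC] := system_bound; exists (2 * C) => R G pos arc T.
have [|side hs] := @half_cut G (edges G).
  move=> e; rewrite inE => /existsP[u /existsP[v /andP[uv /eqP ->]]]; exists u, v.
  by split=> //; apply: contraTneq uv => ->; rewrite adj_irrefl.
have [al [be [ga [si [Cv bip inj]]]]] := thrackle_curves T side.
have [r [m [si' M]]] := curves_middles Cv.
have [N [W [q [kk S]]]] := middles_system M bip inj.
apply: leq_trans hs _; rewrite -mulnA leq_mul2l /=.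
have := hC R _ _ al be pos N W q kk S; apply: leq_trans.
by rewrite card_sig; apply: subset_leq_card; apply/fintype.subsetP => e; rewrite !inE.
Qed.
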